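(* Suppose $U$ satisfies the Main Assumption (with sets $\Omega_1,\dots,\Omega_n$ and function $\mu$). Then for every extremal $t\mapsto(x(t),y(t),z(t))$, $t\in[0,T]$, of problem (P) there exist - constants $\gamma\in\{0,1,-1\}$ and $A=(A_1,\dots,A_n)\in\mathbb{R}^n_+$, not both zero (i.e. not $\gamma=0$ and $A=0$ simultaneously); - a constant $\theta^\circ_{i0}\in\mathbb{R}$ for each $i$ with $A_i>0$; - a measurable function $\lambda(t)=(\lambda_1(t),\dots,\lambda_n(t))$ with $\lambda(t)\in\partial s_\Xi(A)$ for a.e. $t$, such that $\lambda_i\equiv 0$ for every $i$ with $A_i=0$ whenever $\gamma\ne0$, such that: 1. If $\gamma\neq 0$: for each $i$ with $A_i>0$, \[ x_i=\gamma A_i\big(\sin_{\Omega_i^\circ}\theta_i^\circ-\sin_{\Omega_i^\circ}\theta_{i0}^\circ\big),\qquad y_i=\gamma A_i\big(\cos_{\Omega_i^\circ}\theta_{i0}^\circ-\cos_{\Omega_i^\circ}\theta_i^\circ\big), \] where $\theta_i^\circ(t)=\theta_{i0}^\circ+\frac{\gamma}{A_i}\int_0^t\lambda_i(\tau)\,d\tau$; for each $i$ with $A_i=0$, $x_i\equiv y_i\equiv0$; and \[ 2z=\gamma\, s_\Xi(A)\,t+\sum_{i:A_i>0}A_i^2\big(\sin_{\Omega_i^\circ}\theta_{i0}^\circ\cos_{\Omega_i^\circ}\theta_i^\circ-\cos_{\Omega_i^\circ}\theta_{i0}^\circ\sin_{\Omega_i^\circ}\theta_i^\circ\big). \] 2.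 If $\gamma=0$: for each $i$, \[ x_i(t)=\int_0^t\lambda_i(\tau)\cos_{\Omega_i}\theta_i(\tau)\,d\tau,\qquad y_i(t)=\int_0^t\lambda_i(\tau)\sin_{\Omega_i}\theta_i(\tau)\,d\tau, \] where $\theta_i(t)$ is a measurable function with $\theta_i(t)\xleftrightarrow{\Omega_i}\theta^\circ_{i0}$ for a.e. $t$ if $A_i>0$, and an arbitrary measurable function if $A_i=0$; and $z(t)=\frac12\int_0^t\sum_i\big(x_i\dot y_i-\dot x_iy_i\big)\,d\tau$. Conversely, every trajectory of one of the forms described in items 1 and 2 (with data $\gamma,A,\theta^\circ_{i0},\lambda,\theta_i$ satisfying the stated conditions) is an extremal of problem (P).
   Context: Heisenberg group: $\mathbb{H}_{2n+1}=\{(x,y,z):x\in\mathbb{R}^n,y\in\mathbb{R}^{n*},z\in\mathbb{R}\}$ with product $(x^1,y^1,z^1)(x^2,y^2,z^2)=(x^1+x^2,y^1+y^2,z^1+z^2+\frac12(\langle x^1,y^2\rangle-\langle x^2,y^1\rangle))$ and identity $0$. Problem (P): given a compact convex $U\subset\mathbb{R}^n\times\mathbb{R}^{n*}$ with $0\in\operatorname{int}U$, minimize $T$ over Lipschitz curves $q(t)=(x(t),y(t),z(t))$, $t\in[0,T]$, with $q(0)=0$, $q(T)=q_1$, $(\dot x,\dot y)\in U$ a.e. and $\dot z=\frac12\sum_{i=1}^n(x_i\dot y_i-\dot x_iy_i)$ (this is the left-invariant sub-Finsler problem $\dot q\in qU$). An extremal is the projection to $\mathbb{H}_{2n+1}$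 of a solution of the Pontryagin maximum principle (normal or abnormal) for this time-optimal problem. Main Assumption: there are compact convex sets $\Omega_i\subset\mathbb{R}^2$ with $0\in\operatorname{int}\Omega_i$, $i=1,\dots,n$, and a continuous convex positively homogeneous function $\mu:\mathbb{R}^n_+\to\mathbb{R}_+$, nondecreasing in each argument and strictly positive outside the origin, such that $U=\{(\dot x,\dot y):\mu(\mu_{\Omega_1}(\dot x_1,\dot y_1),\dots,\mu_{\Omega_n}(\dot x_n,\dot y_n))\le1\}$, where $\mu_\Omega$ is the Minkowski functional of $\Omega$. Put $\Xi=\{\lambda\in\mathbb{R}^n:\lambda_i\ge0,\ \mu(\lambda)\le1\}$, $s_\Xi(A)=\max_{\lambda\in\Xi}\sum_iA_i\lambda_i$ its support function, and $\partial s_\Xi(A)$ its subdifferential (equal to $\arg\max_{\lambda\in\Xi}\sum_iA_i\lambda_i$). Convex trigonometry: for a compact convex $\Omega\subset\mathbb{R}^2$ with $0\in\operatorname{int}\Omega$ and area $\mathbb{S}$, and $\theta\in[0,2\mathbb{S})$, let $P_\theta\in\partial\Omega$ be the point such that the area of the sector of $\Omega$ swept counterclockwise from the positive $x$-axis to the ray $OP_\theta$ equals $\theta/2$; $(\cos_\Omega\theta,\sin_\Omega\theta)$ are the coordinates of $P_\theta$, and these functions are extended to $\mathbb{R}$ as $2\mathbb{S}$-periodic. The polar set is $\Omega^\circ=\{(p,q):pu+qv\le1\ \forall(u,v)\in\Omega\}$ (again compact convex with $0$ in its interior, area $\mathbb{S}^\circ$), and $\cos_{\Omega^\circ},\sin_{\Omega^\circ}$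 are defined the same way. We write $\theta\xleftrightarrow{\Omega}\theta^\circ$ if $\cos_\Omega\theta\cos_{\Omega^\circ}\theta^\circ+\sin_\Omega\theta\sin_{\Omega^\circ}\theta^\circ=1$ (equivalently, the covector $(\cos_{\Omega^\circ}\theta^\circ,\sin_{\Omega^\circ}\theta^\circ)$ defines a supporting half-plane of $\Omega$ at $P_\theta$). *)

(* Defs.v *)
From mathcomp Require Import all_boot all_order all_algebra.
From mathcomp Require Import all_classical all_reals all_analysis.
Set Implicit Arguments.
Unset Strict Implicit.
Unset Printing Implicit Defensive.
Import Order.TTheory GRing.Theory Num.Theory numFieldNormedType.Exports.
Local Open Scope classical_set_scope.
Local Open Scope ring_scope.

Section PlanarConvex.
Variable R : realType.

Definition convex2 (O : set (R * R)) : Prop :=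
  forall (p q : R * R) (s : R), O p -> O q -> 0 <= s <= 1 ->
    O (s * p.1 + (1 - s) * q.1, s * p.2 + (1 - s) * q.2).

Definition convex_body2 (O : set (R * R)) : Prop :=
  [/\ compact O, convex2 O & O° (0, 0)].

Definition gauge (O : set (R * R)) (p : R * R) : R :=
  inf [set r : R | 0 < r /\ exists w : R * R, O w /\ p = (r * w.1, r * w.2)].

Definition polar (O : set (R * R)) : set (R * R) :=
  [set pq | forall uv : R * R, O uv -> pq.1 * uv.1 + pq.2 * uv.2 <= 1].

Definition boundary2 (O : set (R * R)) : set (R * R) := closure O `\` O°.

Definition area (A : set (R * R)) : R :=
  fine (((@lebesgue_measure R) \x (@lebesgue_measure R))%E A).

Definition sector (O : set (R * R)) (phi : R) : set (R * R) :=
  [set p | O p /\ exists rho alpha : R,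
     [/\ 0 <= rho, 0 <= alpha <= phi & p = (rho * cos alpha, rho * sin alpha)]].

(** P_theta for theta in [0, 2 S): the point of the boundary of O whose
    ray from the origin bounds, together with the positive x-axis, a
    sector of area theta/2 *)
Definition trigP (O : set (R * R)) (theta : R) : R * R :=
  xget (0, 0) [set p | boundary2 O p /\ exists phi rho : R,
     [/\ 0 <= phi < 2 * pi, 0 < rho, p = (rho * cos phi, rho * sin phi)
       & area (sector O phi) = theta / 2]].

Definition trig_reduce (O : set (R * R)) (theta : R) : R :=
  theta - 2 * area O * (Num.floor (theta / (2 * area O)))%:~R.

Definition cosO (O : set (R * R)) (theta : R) : R :=
  (trigP O (trig_reduce O theta)).1.
Definition sinO (O : set (R * R)) (theta : R) : R :=
  (trigP O (trig_reduce O theta)).2.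

Definition trig_dual (O : set (R * R)) (theta thetad : R) : Prop :=
  cosO O theta * cosO (polar O) thetad + sinO O theta * sinO (polar O) thetad = 1.

End PlanarConvex.

Section Heisenberg.
Variables (R : realType) (n : nat).

Definition nonneg_vec (l : 'I_n -> R) : Prop := forall i, 0 <= l i.

Definition main_assumption (Om : 'I_n -> set (R * R))
    (mu : ('I_n -> R) -> R) : Prop :=
  (forall i, convex_body2 (Om i)) /\
  [/\
      (forall l, nonneg_vec l -> 0 <= mu l),
      (forall l, nonneg_vec l -> forall e : R, 0 < e -> exists2 d : R, 0 < d &
         forall l', nonneg_vec l' -> (forall i, `|l' i - l i| < d) ->
           `|mu l' - mu l| < e),
      (forall l l' (s : R), nonneg_vec l -> nonneg_vec l' -> 0 <= s <= 1 ->
         mu (fun i => s * l i + (1 - s) * l' i) <= s * mu l + (1 - s) * mu l') /\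
      (forall l (c : R), nonneg_vec l -> 0 < c -> mu (fun i => c * l i) = c * mu l),
      (forall l (i : 'I_n) (a : R), nonneg_vec l -> l i <= a ->
         mu l <= mu (fun j => if j == i then a else l j))
    &
      (forall l, nonneg_vec l -> (exists i, l i != 0) -> 0 < mu l)].

Definition Uset (Om : 'I_n -> set (R * R)) (mu : ('I_n -> R) -> R) :
    set (('I_n -> R) * ('I_n -> R)) :=
  [set uv | mu (fun i => gauge (Om i) (uv.1 i, uv.2 i)) <= 1].

Definition Xi (mu : ('I_n -> R) -> R) : set ('I_n -> R) :=
  [set l | nonneg_vec l /\ mu l <= 1].

Definition sXi (mu : ('I_n -> R) -> R) (A : 'I_n -> R) : R :=
  sup [set s | exists2 l, Xi mu l & s = \sum_(i < n) A i * l i].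

(** its subdifferential = argmax over Xi *)
Definition dsXi (mu : ('I_n -> R) -> R) (A : 'I_n -> R) : set ('I_n -> R) :=
  [set l | Xi mu l /\ \sum_(i < n) A i * l i = sXi mu A].

End Heisenberg.

Section Curves.
Variable R : realType.

Definition in0T (T t : R) : Prop := 0 <= t <= T.

Definition ae0T (T : R) (P : R -> Prop) : Prop :=
  {ae (@lebesgue_measure R), forall t, `[0, T]%classic t -> P t}.

Definition lipschitz0T (T : R) (f : R -> R) : Prop :=
  exists L : R, forall s t, in0T T s -> in0T T t -> `|f s - f t| <= L * `|s - t|.

Definition abscont0T (T : R) (f : R -> R) : Prop :=
  forall e : R, 0 < e -> exists2 d : R, 0 < d &
    forall (m : nat) (a b : 'I_m -> R),
      (forall k, 0 <= a k /\ a k <= b k /\ b k <= T) ->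
      (forall k l, k != l -> b k <= a l \/ b l <= a k) ->
      \sum_(k < m) (b k - a k) < d ->
      \sum_(k < m) `|f (b k) - f (a k)| < e.

Definition int0 (t : R) (f : R -> R) : R :=
  \int[@lebesgue_measure R]_(s in `[0, t]%classic) f s.

End Curves.

Section Extremals.
Variables (R : realType) (n : nat).

Definition comp (x : R -> 'I_n -> R) (i : 'I_n) : R -> R := fun t => x t i.

Definition hamH (x y : 'I_n -> R) (px py : 'I_n -> R) (pz : R)
    (u v : 'I_n -> R) : R :=
  \sum_(i < n) px i * u i + \sum_(i < n) py i * v i
  + pz * (2^-1 * \sum_(i < n) (x i * v i - u i * y i)).

(** (x,y,z) restricted to [0,T] is an extremal of problem (P):
    an admissible (Lipschitz) trajectory starting at 0, together with a
    nontrivial absolutely continuous covector satisfying the adjoint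
    system and the maximum condition of the Pontryagin maximum principle
    for the time-optimal problem (normal: c > 0, abnormal: c = 0). *)
Definition extremal (Om : 'I_n -> set (R * R)) (mu : ('I_n -> R) -> R)
    (T : R) (x y : R -> 'I_n -> R) (z : R -> R) : Prop :=
  let dx i t := derive1 (comp x i) t in
  let dy i t := derive1 (comp y i) t in
  [/\ (forall i, x 0 i = 0 /\ y 0 i = 0) /\ z 0 = 0,
      (forall i, lipschitz0T T (comp x i) /\ lipschitz0T T (comp y i))
        /\ lipschitz0T T z,
      ae0T T (fun t =>
        [/\ forall i, derivable (comp x i) t 1 /\ derivable (comp y i) t 1,
            derivable z t 1,
            Uset Om mu (fun i => dx i t, fun i => dy i t)
          & derive1 z t = 2^-1 * \sum_(i < n) (x t i * dy i t - dx i t * y t i)])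
    & exists (px py : R -> 'I_n -> R) (pz : R -> R),
      [/\ (forall i, abscont0T T (comp px i) /\ abscont0T T (comp py i))
            /\ abscont0T T pz,
          (forall t, in0T T t ->
             ~ ((forall i, px t i = 0 /\ py t i = 0) /\ pz t = 0)),
          ae0T T (fun t =>
            [/\ forall i, derivable (comp px i) t 1 /\
                          derive1 (comp px i) t = - (2^-1 * pz t * dy i t),
                forall i, derivable (comp py i) t 1 /\
                          derive1 (comp py i) t = 2^-1 * pz t * dx i t
              & derivable pz t 1 /\ derive1 pz t = 0])
        & exists2 c : R, 0 <= c &
          ae0T T (fun t =>
            hamH (x t) (y t) (px t) (py t) (pz t)
                 (fun i => dx i t) (fun i => dy i t) = c /\
            forall uv, Uset Om mu uv ->
              hamH (x t) (y t) (px t) (py t) (pz t) uv.1 uv.2 <= c)]].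

Definition thetad (g : R) (A th0 : 'I_n -> R) (lam : R -> 'I_n -> R)
    (i : 'I_n) (t : R) : R :=
  th0 i + g / A i * int0 t (comp lam i).

Definition form_normal (Om : 'I_n -> set (R * R)) (mu : ('I_n -> R) -> R)
    (T : R) (x y : R -> 'I_n -> R) (z : R -> R)
    (g : R) (A th0 : 'I_n -> R) (lam : R -> 'I_n -> R) : Prop :=
  forall t, in0T T t ->
  [/\ (forall i, 0 < A i ->
         x t i = g * A i * (sinO (polar (Om i)) (thetad g A th0 lam i t)
                            - sinO (polar (Om i)) (th0 i)) /\
         y t i = g * A i * (cosO (polar (Om i)) (th0 i)
                            - cosO (polar (Om i)) (thetad g A th0 lam i t))),
      (forall i, A i = 0 -> x t i = 0 /\ y t i = 0)
    & 2 * z t = g * sXi mu A * t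
        + \sum_(i < n | 0 < A i) A i ^+ 2 *
            (sinO (polar (Om i)) (th0 i) * cosO (polar (Om i)) (thetad g A th0 lam i t)
             - cosO (polar (Om i)) (th0 i) * sinO (polar (Om i)) (thetad g A th0 lam i t))].

Definition form_abnormal (Om : 'I_n -> set (R * R))
    (T : R) (x y : R -> 'I_n -> R) (z : R -> R)
    (A th0 : 'I_n -> R) (lam : R -> 'I_n -> R) : Prop :=
  exists th : R -> 'I_n -> R,
  [/\ forall i, measurable_fun `[0, T]%classic (comp th i),
      forall i, 0 < A i -> ae0T T (fun t => trig_dual (Om i) (th t i) (th0 i))
    & forall t, in0T T t ->
      (forall i, x t i = int0 t (fun s => lam s i * cosO (Om i) (th s i)) /\
                 y t i = int0 t (fun s => lam s i * sinO (Om i) (th s i))) /\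
      z t = 2^-1 * int0 t (fun s => \sum_(i < n)
               (x s i * derive1 (comp y i) s - derive1 (comp x i) s * y s i))].

Definition extremal_form (Om : 'I_n -> set (R * R)) (mu : ('I_n -> R) -> R)
    (T : R) (x y : R -> 'I_n -> R) (z : R -> R) : Prop :=
  exists (g : R) (A th0 : 'I_n -> R) (lam : R -> 'I_n -> R),
  [/\ g = 0 \/ g = 1 \/ g = -1,
      nonneg_vec A,
      ~ (g = 0 /\ forall i, A i = 0)
    & forall i, measurable_fun `[0, T]%classic (comp lam i)
  ] /\
  [/\ ae0T T (fun t => dsXi mu A (lam t)),
      g <> 0 -> forall i, A i = 0 -> forall t, in0T T t -> lam t i = 0,
      g <> 0 -> form_normal Om mu T x y z g A th0 lam
    & g = 0 -> form_abnormal Om T x y z A th0 lam].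

End Extremals.

(* Main.v *)
(* Put h_i = (px_i - pz y_i / 2, py_i + pz x_i / 2). The adjoint system makes pz constant and turns h_i
   by h_i' = pz J (u_i, v_i), where (u_i, v_i) is the velocity of (x_i, y_i). Since the maximized Hamiltonian
   splits over the planar factors, maximality forces <h_i, (u_i, v_i)> = A_i lambda_i, where
   A_i is the support function of Omega_i at h_i and lambda_i the gauge of (u_i, v_i); touching from below
   then shows that A_i is constant along the extremal. If pz = 0, then h_i is constant. If pz = gamma = +-1 after
   rescaling, then h_i / A_i runs along the boundary of the polar of Omega_i with areal velocity
   gamma lambda_i / (2 A_i). A Lipschitz curve on the boundary of a convex body is determined by its starting
   point and its areal velocity (Gronwall for the squared distance between the directions of two such curves),
   and (cos, sin)(theta0 + int omega) is such a curve, so h_i / A_i is given by convex trigonometric functions.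
   Conversely, a point c moving on the boundary of the polar of Omega_i with cross product omega of c and c'
   has c' = omega J w for a point w of Omega_i supported by c; this gives back the velocities. *)
From HB Require Import structures.
Require Import Defs.
From mathcomp Require Import all_boot all_order all_algebra.
From mathcomp Require Import all_classical all_reals all_analysis.
From mathcomp Require Import measurable_realfun zify ring lra.
Import Order.TTheory GRing.Theory Num.Theory numFieldNormedType.Exports.
Local Open Scope classical_set_scope.
Local Open Scope ring_scope.
Set Implicit Arguments.
Unset Strict Implicit.
Unset Printing Implicit Defensive.

(** * Absolutely continuous and Lipschitz functions on an interval *)

Section RealAnalysis.
Context {R : realType}.
Implicit Types (f g : R -> R) (T t : R).
Local Notation leb := (@lebesgue_measure R).

(** The definitions give [cosO] and [sinO] only through areas of sectors, and the boundary may have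
    corners and segments, so these functions need not be differentiable. All that is used of them:
    they are Lipschitz, they reach every boundary point, and the cross product of the points with
    parameters s and t is t - s up to a multiple of (t - s)^2. This expansion comes from comparing
    sectors with inner and outer triangles, and it makes twice the area the right parameter: the
    cross product with a frozen point has a derivative even where the moving point has none. The
    maximum principle speaks almost everywhere only, so identities along a curve are proved as
    equalities of absolutely continuous functions with equal derivatives almost everywhere; the
    covering argument in [abscont_nonincr] carries this. Gauges are Lipschitz but not smooth: where
    one would differentiate a support function, a linear function touching it from below is used
    instead. Multipliers and angles have to be measurable, which asks for a Borel choice of the
    angle of a boundary point and for bounded measurable versions of the velocities. *)

Lemma is_derive_epsP f t (d : R) : is_derive t 1 f d <->
  (forall e : R, 0 < e -> exists2 del : R, 0 < del & forall h : R, `|h| < del ->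
     `|f (t + h) - f t - d * h| <= e * `|h|).
Proof.
split=> [[df dfE] e e0|H].
  have /derivable1P := df => /derivable1_diffP dff.
  have : h^-1 *: (f (h *: 1 + t) - f t) @[h --> 0^'] --> d.
    by move: df; rewrite /derivable => /cvg_ex [l hl]; rewrite -dfE /derive (cvg_lim _ hl).
  move=> /cvgrPdist_le /(_ e e0); rewrite near_withinE => /nbhs_ballP[del /= del0 hdel].
  exists del => // h hd; have [->|h0] := eqVneq h 0.
    by rewrite addr0 subrr mulr0 subr0 normr0 mulr0.
  have := hdel h; rewrite /ball /= sub0r normrN => /(_ hd h0).
  rewrite -[X in _ <= X -> _]mulr1 -(@ler_pM2r _ `|h|) ?normr_gt0 // -normrM mulr1.
  rewrite /GRing.scale /= mulr1 distrC mulrBl mulrAC mulVf // mul1r (addrC h).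
  by [].
have cv : h^-1 *: (f (h *: 1 + t) - f t) @[h --> 0^'] --> d.
  apply/cvgrPdist_le => e e0; have [del del0 hd] := H e e0.
  rewrite near_withinE; apply/nbhs_ballP; exists del => //= h.
  rewrite /ball /= sub0r normrN => /hd {}hd h0.
  rewrite -(@ler_pM2r _ `|h|) ?normr_gt0 // -normrM /GRing.scale /= mulr1.
  by rewrite -normrN -mulNr opprB mulrBl mulrAC mulVf // mul1r (addrC h).
by split; [apply/cvg_ex; exists d | exact: (cvg_lim _ cv)].
Qed.

Lemma der_cst (a t : R) : is_derive t 1 (fun=> a) 0.
Proof. exact: is_derive_cst. Qed.

Lemma der_id t : is_derive t 1 (fun s : R => s) 1.
Proof. exact: is_derive_id. Qed.

Lemma derD f g t (a b : R) : is_derive t 1 f a -> is_derive t 1 g b ->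
  is_derive t 1 (fun s => f s + g s) (a + b).
Proof. by move=> df dg; exact: (@is_deriveD _ _ _ f g t 1 a b df dg). Qed.

Lemma derB f g t (a b : R) : is_derive t 1 f a -> is_derive t 1 g b ->
  is_derive t 1 (fun s => f s - g s) (a - b).
Proof. by move=> df dg; exact: (@is_deriveB _ _ _ f g t 1 a b df dg). Qed.

Lemma derM f g t (a b : R) : is_derive t 1 f a -> is_derive t 1 g b ->
  is_derive t 1 (fun s => f s * g s) (a * g t + f t * b).
Proof.
move=> df dg; have := @is_deriveM _ _ f g t 1 a b df dg.
by rewrite /GRing.scale /= addrC (mulrC (g t)).
Qed.

Lemma derZ f t (c a : R) : is_derive t 1 f a -> is_derive t 1 (fun s => c * f s) (c * a).
Proof. by move=> df; have := derM (der_cst c t) df; rewrite mul0r add0r. Qed.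

Lemma derE f t (a b : R) : is_derive t 1 f a -> a = b -> is_derive t 1 f b.
Proof. by move=> ? <-. Qed.

Lemma der_uniq f t (a b : R) : is_derive t 1 f a -> is_derive t 1 f b -> a = b.
Proof. by move=> /@derive_val <- /@derive_val. Qed.

Lemma der_sum (I : Type) (r : seq I) (P : pred I) (F : I -> R -> R) (a : I -> R) t :
  (forall i, P i -> is_derive t 1 (F i) (a i)) ->
  is_derive t 1 (fun s => \sum_(i <- r | P i) F i s) (\sum_(i <- r | P i) a i).
Proof.
move=> H; elim: r => [|i r IH].
  by rewrite big_nil (_ : (fun _ => _) = fun=> 0); [exact: der_cst|apply/funext => s; rewrite big_nil].
rewrite big_cons (_ : (fun _ => _) = fun s => if P i then F i s + \sum_(j <- r | P j) F j s
  else \sum_(j <- r | P j) F j s); last by apply/funext => s; rewrite big_cons.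
by case: ifP => // Pi; apply: derD => //; exact: H.
Qed.

(** Intervals are listed from right to left: the sweep in [abscont_nonincr] moves rightwards and
    conses each new interval in front. Lists suit this induction better than the indexed families of
    [abscont0T]. *)
Definition nonoverlap (s : seq (R * R)) := pairwise (fun p q : R * R => q.2 <= p.1) s.

Lemma abscont_seq T f (e : R) : abscont0T T f -> 0 < e -> exists2 d : R, 0 < d &
  forall s : seq (R * R), all (fun p => (0 <= p.1) && (p.1 <= p.2) && (p.2 <= T)) s ->
   nonoverlap s -> \sum_(p <- s) (p.2 - p.1) < d ->
   \sum_(p <- s) `|f p.2 - f p.1| < e.
Proof.
move=> acf e0; have [d d0 H] := acf e e0; exists d => // s /all_nthP sa sp sd.
rewrite (big_nth (0, 0)) big_mkord.
apply: (H (size s) (fun k => (nth (0, 0) s k).1) (fun k => (nth (0, 0) s k).2)).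
- by move=> k; have /andP[/andP[-> ->] ->] := sa (0, 0) k (ltn_ord k).
- move=> k l kl; have /(pairwiseP (0, 0)) P := sp.
  have [lkl|llk|/val_inj E] := ltngtP (k : nat) l.
  + by right; apply: P => //; rewrite inE.
  + by left; apply: P => //; rewrite inE.
  + by rewrite E eqxx in kl.
- by move: sd; rewrite (big_nth (0, 0)) big_mkord.
Qed.

Lemma lipschitz_abscont T f : lipschitz0T T f -> abscont0T T f.
Proof.
move=> [L0 HL0]; pose L := `|L0| + 1.
have L1 : 0 < L by rewrite /L ltr_wpDl.
have HL s t : in0T T s -> in0T T t -> `|f s - f t| <= L * `|s - t|.
  move=> hs ht; apply: (le_trans (HL0 s t hs ht)); apply: ler_wpM2r => //.
  by rewrite /L (le_trans (ler_norm _)) // lerDl.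
move=> e e0; exists (e / L); first exact: divr_gt0.
move=> m a b hab _ hs.
apply: (@le_lt_trans _ _ (\sum_(k < m) L * (b k - a k))).
  apply: ler_sum => k _; have [a0 [ab bT]] := hab k.
  rewrite -(ger0_norm (x := b k - a k)) ?subr_ge0 //; apply: HL; apply/andP; split => //.
  - exact: le_trans ab.
  - exact: le_trans bT.
by rewrite -mulr_sumr mulrC -ltr_pdivlMr.
Qed.

Lemma abscontS T T' f : T' <= T -> abscont0T T f -> abscont0T T' f.
Proof.
move=> TT acf e e0; have [d d0 H] := acf e e0; exists d => // m a b hab.
apply: H => k; have [a0 [ab bT]] := hab k; split=> //; split => //.
exact: le_trans TT.
Qed.

Lemma ae0TS T T' (P : R -> Prop) : T' <= T -> ae0T T P -> ae0T T' P.
Proof.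
move=> TT; rewrite /ae0T; apply: filterS; first exact: (ae_filter_ringOfSetsType leb).
move=> t H; rewrite /= in_itv /= => /andP[t0 tT].
by apply: H; rewrite /= in_itv /= t0 (le_trans tT).
Qed.

(** The straddle lemma: the estimates at the two ends are subtracted, so the derivative at [t]
    controls increments over intervals containing [t] anywhere. In [abscont_nonincr] the left end
    lies before a supremum and the right end after it. *)
Lemma is_derive_straddle f t (d e : R) : is_derive t 1 f d -> 0 < e ->
  exists2 del : R, 0 < del & forall r s : R, r <= t <= s -> t - r < del -> s - t < del ->
    `|f s - f r - d * (s - r)| <= e * (s - r).
Proof.
move=> /is_derive_epsP H e0; have [del del0 Hd] := H e e0; exists del => // r s /andP[rt ts] h1 h2.
have A := Hd (s - t); have B := Hd (r - t).
rewrite ger0_norm ?subr_ge0 // in A; rewrite ler0_norm ?subr_le0 // opprB in B.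
have {A} := A h2; have {B} := B h1; rewrite !(addrC t) !subrK.
rewrite !ler_norml => /andP[B1 B2] /andP[A1 A2]; apply/andP; split; lra.
Qed.

Lemma ae0T_imp T (P Q : R -> Prop) : (forall t, in0T T t -> P t -> Q t) ->
  ae0T T P -> ae0T T Q.
Proof.
move=> H; rewrite /ae0T; apply: filterS; first exact: (ae_filter_ringOfSetsType leb).
by move=> t Ht tT; apply: H; [move: tT; rewrite /= in_itv|exact: Ht].
Qed.

Lemma ae0T_and T (P Q : R -> Prop) : ae0T T P -> ae0T T Q -> ae0T T (fun t => P t /\ Q t).
Proof.
rewrite /ae0T; apply: filterS2; first exact: (ae_filter_ringOfSetsType leb).
by move=> t HP HQ tT; split; [exact: HP|exact: HQ].
Qed.

Lemma ae0T_all T (I : finType) (P : I -> R -> Prop) : (forall i, ae0T T (P i)) ->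
  ae0T T (fun t => forall i, P i t).
Proof.
move=> H; have : forall s : seq I, ae0T T (fun t => forall i, i \in s -> P i t).
  elim=> [|i s IH]; first by apply: aeW.
  apply: ae0T_imp (ae0T_and (H i) IH) => t _ [Pi Ps] j.
  by rewrite inE => /orP[/eqP->|/Ps].
move=> /(_ (enum I)); apply: ae0T_imp => t _ Hs i; apply: Hs.
by rewrite mem_enum.
Qed.

Lemma ae0T_W T (P : R -> Prop) : (forall t, in0T T t -> P t) -> ae0T T P.
Proof. by move=> H; apply: aeW => t tT; apply: H; move: tT; rewrite /= in_itv. Qed.

Lemma ae0T_neq T (a : R) : ae0T T (fun t => t <> a).
Proof.
exists [set a]; split => //; first exact: lebesgue_measure_set1.
move=> t /=; apply: contra_notP => ta _; exact: ta.
Qed.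

Lemma ae0T_interior T : ae0T T (fun t => 0 < t < T).
Proof.
apply: ae0T_imp (ae0T_and (ae0T_neq T 0) (ae0T_neq T T)) => t /andP[t0 tT] [/eqP h1 /eqP h2].
by rewrite !lt_neqAle t0 tT h2 eq_sym h1.
Qed.

(** Outer regularity of the null set where [P] may fail. Openness of [V] gives each of its points a
    neighbourhood to use in the sweep below. *)
Lemma ae0T_cover T (P : R -> Prop) (e : R) : ae0T T P -> 0 < e ->
  exists V : set R, [/\ open V, (leb V < e%:E)%E &
    forall t, in0T T t -> V t \/ P t].
Proof.
move=> [N [mN N0 HN]] e0.
have Nout : ((wlength idfun)^* N = 0)%mu.
  by apply: (proj1 (negligible_outer_measure N)); exists N; split.
have e2 : 0 < e / 2 by lra.
have [V [oV NV Vd]] := outer_measure_open_le N e2.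
exists V; split => //.
  by apply: (le_lt_trans Vd); rewrite Nout add0e lte_fin; lra.
move=> t tT; have [Pt|nPt] := pselect (P t); [by right|left; apply: NV; apply: HN].
by move=> /=; apply: contra_not nPt; apply; rewrite /= in_itv.
Qed.

(** A sweep of [[0, T]] by real induction. Near a point with derivative at most 0 the function grows
    with slope at most [e]; near an exceptional point the increment is charged to an interval inside
    the open set [V]. Absolute continuity makes all charges together smaller than [e]. *)
Lemma abscont_nonincr T f : 0 <= T -> abscont0T T f ->
  ae0T T (fun t => exists2 d : R, is_derive t 1 f d & d <= 0) -> f T <= f 0.
Proof.
move=> T0 acf aef.
apply/ler_addgt0Pr => e' e'0.
pose e := e' / (T + 2).
have T2 : 0 < T + 2 by lra.
have e0 : 0 < e by apply: divr_gt0.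
have eE : e * T + e <= e'.
  have : e * (T + 2) = e' by rewrite /e mulfVK // gt_eqF.
  by rewrite mulrDr => <-; lra.
have [d d0 Hd] := abscont_seq acf e0.
have [V [oV Vd HV]] := ae0T_cover aef d0.
have mV : measurable V by exact: measurable_realfun.open_measurable.
(* The budget: the measure of [V] up to [x] bounds the total length of the charged intervals and
   stays below [d]. *)
pose v x := fine (leb (V `&` `[0, x]%classic)).
have vfin x : (leb (V `&` `[0%R, x]%classic) \is a fin_num)%E.
  rewrite ge0_fin_numE //; apply: (le_lt_trans _ (lt_trans Vd (ltry d))).
  by apply: le_measure; rewrite ?inE //; exact: measurableI.
have vd x : v x < d.
  rewrite /v -lte_fin fineK //; apply: le_lt_trans Vd.
  by apply: le_measure; rewrite ?inE //; exact: measurableI.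
have vmono x1 x2 : x1 <= x2 -> v x1 <= v x2.
  move=> x12; rewrite /v fine_le //; apply: le_measure; rewrite ?inE; do ?exact: measurableI.
  apply: setIS => z /=; rewrite !in_itv /= => /andP[-> /le_trans]; exact.
have vadd x1 x2 : 0 <= x1 -> x1 <= x2 -> `]x1, x2] `<=` V -> v x1 + (x2 - x1) <= v x2.
  move=> x10 x12 sub; rewrite /v -lee_fin EFinD !fineK //.
  have -> : ((x2 - x1)%:E = leb `]x1, x2]%classic)%E.
    rewrite lebesgue_measure_itv /= lte_fin; case: ltP => // x21.
    by rewrite (@le_anti _ _ x1 x2) ?subrr // x12.
  rewrite -measureU //; first last.
  - apply/seteqP; split => // z [[_ /=]]; rewrite !in_itv /= => /andP[_ zx1] /andP[x1z _].
    by move: (lt_le_trans x1z zx1); rewrite ltxx.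
  - exact: measurableI.
  apply: le_measure; rewrite ?inE; [|exact: measurableI|].
    by apply: measurableU => //; exact: measurableI.
  move=> z [[Vz]|zi] /=.
    by rewrite !in_itv /= => /andP[z0 zx]; split => //; apply/andP; split => //; exact: le_trans x12.
  split; first exact: sub.
  move: zi; rewrite /= !in_itv /= => /andP[z1 ->]; rewrite andbT.
  by apply: (le_trans x10); exact: ltW.
(* The induction predicate: the increment from 0 to [x] is paid by slope [e] and by the charged
   intervals [s]. *)
pose Q x := exists s : seq (R * R), [/\ all (fun p => (0 <= p.1) && (p.1 <= p.2) && (p.2 <= x)) s,
   nonoverlap s, \sum_(p <- s) (p.2 - p.1) <= v x &
   f x - f 0 <= e * x + \sum_(p <- s) `|f p.2 - f p.1|].
have Qext x1 x2 : 0 <= x1 -> x1 <= x2 -> Q x1 ->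
    (`]x1, x2] `<=` V \/ f x2 - f x1 <= e * (x2 - x1)) -> Q x2.
  move=> x10 x12 [s [sa sn sv sf]] [sub|df].
    exists ((x1, x2) :: s); rewrite !big_cons /= x10 x12 lexx /=; split.
    - by apply: sub_all sa => p /andP[-> /le_trans]; apply.
    - rewrite /nonoverlap /= [pairwise _ s]sn andbT; apply: sub_all sa => p /andP[_ ->] //.
    - by rewrite addrC; apply: le_trans (vadd _ _ x10 x12 sub); rewrite lerD2r.
    - have := ler_norm (f x2 - f x1); have := ler_wpM2l (ltW e0) x12; lra.
  exists s; split => //.
  - by apply: sub_all sa => p /andP[-> /le_trans]; apply.
  - by apply: (le_trans sv); exact: vmono.
  - lra.
have local t : in0T T t -> exists2 del : R, 0 < del & forall r s : R, r <= t <= s ->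
    t - r < del -> s - t < del -> `]r, s] `<=` V \/ f s - f r <= e * (s - r).
  move=> tT; have [Vt|[D Dt D0]] := HV t tT.
    have [del /= del0 Hdel] : nbhs_ball t V by apply/nbhs_ballP; exact: open_nbhs_nbhs.
    exists del => // r s /andP[rt ts] h1 h2; left => z /=; rewrite in_itv /= => /andP[rz zs].
    by apply: Hdel; rewrite /ball /= ltr_norml; apply/andP; split; lra.
  have [del del0 Hdel] := is_derive_straddle Dt e0.
  exists del => // r s rts h1 h2; right.
  have := Hdel r s rts h1 h2; rewrite ler_norml => /andP[_].
  have : D * (s - r) <= 0 by move/andP: rts => [? ?]; apply: mulr_le0_ge0; lra.
  lra.
pose E := [set x | in0T T x /\ Q x].
have Q0 : Q 0.
  exists [::]; rewrite !big_nil; split => //; last by rewrite mulr0 subrr addr0.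
  by rewrite /v fine_ge0.
have E0 : E 0 by split => //; apply/andP.
have hsE : has_sup E by split; [exists 0|exists T => x [/andP[]]].
have [sT0 sTT] : 0 <= sup E /\ sup E <= T.
  split; first exact: (ub_le_sup hsE.2).
  by apply: ge_sup; [exists 0|move=> x [/andP[]]].
have sET : in0T T (sup E) by apply/andP.
have [del del0 Hdel] := local _ sET.
have [x1 [x1T Qx1] x1s] := sup_adherent del0 hsE.
have x1le : x1 <= sup E by apply: (ub_le_sup hsE.2).
have [x10 _] := andP x1T.
(* A single straddling interval, from [x1] just left of the supremum to [x2], carries [Q] across it.
   Hence [Q] holds at the supremum, which cannot be smaller than [T]. *)
have Qs x2 : sup E <= x2 -> x2 - sup E < del -> Q x2.
  move=> h1 h2; apply: (Qext x1) => //; first exact: le_trans h1.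
  by apply: Hdel => //; [apply/andP|lra].
have sE : sup E = T.
  apply/eqP; rewrite eq_le sTT /= leNgt; apply/negP => ltT.
  pose x2 := Num.min T (sup E + del / 2).
  have [h1 h2] : sup E < x2 /\ x2 - sup E < del.
    by rewrite /x2 minElt; case: (ltP T (sup E + del / 2)) => ?; split; lra.
  have : E x2.
    split; last by apply: Qs => //; exact: ltW.
    by apply/andP; split; [apply: le_trans (ltW h1)|rewrite /x2 ge_min lexx].
  by move=> /(ub_le_sup hsE.2); lra.
have [s [sa sn sv sf]] : Q T by apply: Qs; rewrite sE ?subrr.
have := Hd s sa sn (le_lt_trans sv (vd T)); lra.
Qed.

Lemma abscont_unique T f g : abscont0T T f -> abscont0T T g ->
  ae0T T (fun t => exists2 d : R, is_derive t 1 f d & is_derive t 1 g d) ->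
  f 0 = g 0 -> forall t, in0T T t -> f t = g t.
Proof.
move=> acf acg ae fg0.
have T0T : forall t, in0T T t -> 0 <= t /\ t <= T by move=> t /andP[].
have acB (h k : R -> R) : abscont0T T h -> abscont0T T k -> abscont0T T (fun t => h t - k t).
  move=> ach ack e e0; have e2 : 0 < e / 2 by lra.
  have [d1 d10 H1] := ach _ e2; have [d2 d20 H2] := ack _ e2.
  exists (Num.min d1 d2); first by rewrite lt_min d10.
  move=> m a b hab hd; rewrite lt_min => /andP[s1 s2].
  have := H1 m a b hab hd s1; have := H2 m a b hab hd s2 => A B.
  apply: (@le_lt_trans _ _ (\sum_(k0 < m) (`|h (b k0) - h (a k0)| + `|k (b k0) - k (a k0)|))).
    apply: ler_sum => i _; have -> : h (b i) - k (b i) - (h (a i) - k (a i)) =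
      (h (b i) - h (a i)) - (k (b i) - k (a i)) by ring.
    exact: ler_normB.
  by rewrite big_split /=; lra.
move=> t tT; have [t0 tT'] := T0T t tT.
have H (h k : R -> R) : abscont0T T h -> abscont0T T k ->
  ae0T T (fun t => exists2 d : R, is_derive t 1 h d & is_derive t 1 k d) ->
  h t - k t <= h 0 - k 0.
  move=> ach ack aeh; apply: (@abscont_nonincr t (fun t => h t - k t)) => //.
    by apply: abscontS tT' _; exact: acB.
  apply: ae0TS tT' _; apply: ae0T_imp aeh => s _ [d dh dk]; exists 0 => //.
  have -> : (0 : R) = d - d by rewrite subrr.
  exact: is_deriveB.
have H1 := H f g acf acg ae.
have H2 : g t - f t <= g 0 - f 0.
  by apply: H => //; apply: ae0T_imp ae => s _ [d dh dk]; exists d.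
by rewrite fg0 in H1 H2; apply/eqP; rewrite eq_le; apply/andP; split; lra.
Qed.

Lemma is_derive_near f g t (d : R) : (exists2 del : R, 0 < del &
  forall s, `|s - t| < del -> f s = g s) -> is_derive t 1 g d -> is_derive t 1 f d.
Proof.
move=> [del del0 fg] /is_derive_epsP H; apply/is_derive_epsP => e e0.
have [del' del'0 H'] := H e e0; exists (Num.min del del'); first by rewrite lt_min del0.
move=> h; rewrite lt_min => /andP[h1 h2]; rewrite !fg ?subrr ?normr0 //; first exact: H'.
by rewrite addrC addKr.
Qed.

Lemma is_derive_in0T T f g t (d : R) : 0 < t < T -> (forall s, in0T T s -> f s = g s) ->
  is_derive t 1 g d -> is_derive t 1 f d.
Proof.
move=> /andP[t0 tT] fg; apply: is_derive_near; exists (Num.min t (T - t)).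
  by rewrite lt_min t0 subr_gt0.
move=> s; rewrite lt_min !ltr_norml => /andP[/andP[? ?] /andP[? ?]]; apply: fg.
by apply/andP; split; lra.
Qed.

(** The retraction of the line onto [[0, T]]; composing with it extends a Lipschitz function to all
    of [R] with the same constant. *)
Definition clamp T t := Num.max 0 (Num.min t T).

Lemma clamp_in T t : 0 <= T -> in0T T (clamp T t).
Proof. by move=> T0; rewrite /in0T /clamp le_max lexx /= ge_max T0 ge_min lexx orbT. Qed.

Lemma clamp_id T t : in0T T t -> clamp T t = t.
Proof. by move=> /andP[t0 tT]; rewrite /clamp min_l // max_r. Qed.

Lemma clamp_mono T s t : s <= t -> clamp T s <= clamp T t.
Proof.
move=> st; rewrite /clamp ge_max le_max lexx /= le_max; apply/orP; right.
by rewrite le_min !ge_min st lexx orbT.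
Qed.

Lemma clamp_le T s t : 0 <= T -> s <= t -> clamp T t - clamp T s <= t - s.
Proof.
move=> T0 st; rewrite /clamp !minElt !maxElt.
by case: (ltP t T) => ?; case: (ltP s T) => ?; case: (ltP 0 t) => ?; case: (ltP 0 s) => ?; case: (ltP 0 T) => ?; lra.
Qed.

Lemma lipschitz_pos T f : lipschitz0T T f -> exists2 L : R, 0 < L &
  forall s t, in0T T s -> in0T T t -> `|f s - f t| <= L * `|s - t|.
Proof.
move=> [L0 HL0]; exists (`|L0| + 1); first by rewrite ltr_wpDl.
move=> s t hs ht; apply: (le_trans (HL0 s t hs ht)); apply: ler_wpM2r => //.
by rewrite (le_trans (ler_norm _)) // lerDl.
Qed.

Lemma lipschitz_continuous f (L : R) : 0 < L ->
  (forall s t, `|f s - f t| <= L * `|s - t|) -> continuous f.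
Proof.
move=> L0 HL x; apply/cvgrPdist_lt => e e0.
near=> y; apply: (le_lt_trans (HL x y)).
rewrite mulrC -ltr_pdivlMr //; near: y.
by apply: cvgr_dist_lt => //; exact: divr_gt0.
Unshelve. all: by end_near. Qed.

(** A cover by half-open intervals that is cheap for the Lebesgue outer measure costs at most [L]
    times as much for [G]. Dividing by [L + 1] keeps the divisor positive when [L] is 0. *)
Lemma stieltjes_lipschitz_dominated (G : cumulative R R) (L : R) : 0 <= L ->
  (forall s t, s <= t -> G t - G s <= L * (t - s)) ->
  forall A, measurable A -> leb A = 0%E -> lebesgue_stieltjes_measure G A = 0%E.
Proof.
move=> L0 GL A mA A0; apply/eqP; rewrite eq_le measure_ge0 andbT.
have wle (B : set (ocitv_type R)) : measurable B ->
    (wlength G B <= L%:E * wlength idfun B)%E.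
  move=> /ocitvP[->|[x x12 ->]]; first by rewrite !wlength0 mule0.
  by rewrite !wlength_itv_bnd ?(ltW x12) // -EFinM lee_fin GL // ltW.
apply/lee_addgt0Pr => e e0; rewrite add0e.
have L1 : 0 < L + 1 by lra.
have : (mu_ext (wlength idfun) A < (e / (L + 1))%:E)%E.
  by move: A0; rewrite /lebesgue_measure /lebesgue_stieltjes_measure /measure_extension => ->; rewrite lte_fin divr_gt0.
move=> /ereal_inf_lt[_ [F FA <-]] Fe.
apply: (@le_trans _ _ (\sum_(0 <= k <oo) wlength G (F k))%E).
  by apply: ereal_inf_lbound; exists F.
apply: (@le_trans _ _ (\sum_(0 <= k <oo) L%:E * wlength idfun (F k))%E).
  by apply: lee_nneseries => // k _; apply: wle; case: FA.
rewrite nneseriesZl //.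
apply: (@le_trans _ _ (L%:E * (e / (L + 1))%:E)%E).
  by apply: lee_wpmul2l => //; exact: ltW.
rewrite -EFinM lee_fin mulrA ler_pdivrMr // mulrC; apply: ler_wpM2l; lra.
Qed.

Lemma stieltjes_itv (G : cumulative R R) s t : s <= t ->
  lebesgue_stieltjes_measure G `]s, t]%classic = (G t - G s)%:E.
Proof.
move=> st; rewrite /lebesgue_stieltjes_measure /measure_extension.
by rewrite measurable_mu_extE /= ?wlength_itv_bnd //; exact: is_ocitv.
Qed.

(** Adding [L * t] makes the function nondecreasing, so it has a Stieltjes measure, which is
    absolutely continuous by the previous domination. The function is then the indefinite integral
    of a Radon-Nikodym density, and Lebesgue differentiation applies. *)
Lemma lipschitz_ae_derive T f : 0 <= T -> lipschitz0T T f ->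
  ae0T T (fun t => derivable f t 1).
Proof.
move=> T0 /lipschitz_pos[L L0 HL].
pose G t := f (clamp T t) + L * clamp T t.
have Gle s t : s <= t -> 0 <= G t - G s <= 2 * L * (t - s).
  move=> st; have := HL _ _ (clamp_in t T0) (clamp_in s T0).
  rewrite (ger0_norm (x := clamp T t - clamp T s)) ?subr_ge0 ?clamp_mono // ler_norml /G => /andP[h3 h4].
  have h1 := clamp_le T0 st; have h2 := clamp_mono T st.
  by apply/andP; split; nra.
have Gnd : nondecreasing G by move=> s t /Gle /andP[]; rewrite subr_ge0.
have Gc : continuous G.
  apply: (@lipschitz_continuous G (2 * L)); first by lra.
  move=> s t; have [st|/ltW ts] := leP s t.
    rewrite distrC (distrC s) !ger0_norm ?subr_ge0 //; last exact: Gnd.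
    by have /andP[] := Gle _ _ st.
  rewrite !ger0_norm ?subr_ge0 //; last exact: Gnd.
  by have /andP[] := Gle _ _ ts.
have Gr := right_continuousW Gc.
pose GC : cumulative R R := HB.pack G (isCumulative.Build _ _ _ G Gnd Gr).
pose nu : {measure set (measurableTypeR R) -> \bar R} := lebesgue_stieltjes_measure GC.
have mD : measurable (`]0, T]%classic : set (measurableTypeR R)) by exact: measurable_itv.
have nuE s t : s <= t -> nu `]s, t]%classic = (G t - G s)%:E.
  by move=> st; exact: (stieltjes_itv GC st).
have nuD : (nu `]0%R, T]%classic < +oo)%E by rewrite nuE // ltry.
pose nu' : {finite_measure set _ -> \bar R} := mfrestr mD nuD.
have dom : charge_of_finite_measure nu' `<< leb.
  apply/null_content_dominatesP => A mA A0; rewrite /nu' /charge_of_finite_measure /= /mfrestr /mrestr.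
  apply: (@stieltjes_lipschitz_dominated GC (2 * L)) => //; first lra.
  - by move=> s t /Gle /andP[].
  - exact: measurableI.
  - by apply: (subset_measure0 _ _ _ A0) => //; exact: measurableI.
pose h := Radon_Nikodym (charge_of_finite_measure nu') leb.
have hfin x : (h x \is a fin_num)%E by exact: Radon_Nikodym_fin_num.
pose hr x := fine (h x).
have hrE : EFin \o hr = h by apply/funext => x; rewrite /= /hr fineK.
have ih : leb.-integrable setT (EFin \o hr) by rewrite hrE; exact: Radon_Nikodym_integrable.
pose F x := \int[leb]_(s in `]0, x]%classic) hr s.
have FE x : in0T T x -> F x = G x - G 0.
  move=> /andP[x0 xT]; rewrite /F /Rintegral.
  have -> : (\int[leb]_(s in `]0%R, x]) (hr s)%:E = charge_of_finite_measure nu' `]0%R, x]%classic)%E.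
    rewrite (Radon_Nikodym_integral dom) //; apply: eq_integral => s _.
    by rewrite -/h -hrE.
  rewrite /nu' /charge_of_finite_measure /= /mfrestr /mrestr.
  have -> : `]0, x]%classic `&` `]0, T]%classic = `]0, x]%classic.
    apply/setIidPl => s /=; rewrite !in_itv /= => /andP[-> sx] /=; exact: le_trans xT.
  by rewrite -/nu nuE.
have ih' y : leb.-integrable [set` Interval (BRight (0 : R)) (BRight y)] (EFin \o hr).
  exact: integrableS ih.
have lh : locally_integrable setT hr.
  by apply: open_integrable_locally => //; exact: openT.
have aeF := FTC1 ih' lh.
have {}aeF : ae0T T (fun x => 0 < x -> derivable F x 1).
  move: aeF; apply: filterS; first exact: (ae_filter_ringOfSetsType leb).
  by move=> x Hx _ x0; exact: (Hx x0).1.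
apply: ae0T_imp (ae0T_and (ae0T_interior T) aeF) => t tT [tio /(_ (andP tio).1) dF].
have := derivableP dF => dF'.
have := derB (derD dF' (der_cst (G 0) t)) (derZ L (der_id t)).
move=> /(@is_derive_in0T T f) H; have [] // := H tio _.
by move=> s sT; rewrite FE // subrK /G /= clamp_id // addrK.
Qed.

(** * Integrals of functions that agree off a null set *)

Import HBNNSimple.

(** A simple function below [f], cut off on [N], lies below [g] and has the same integral. The
    argument works for arbitrary functions; [int0_eq] relies on this, since integrands such as
    [derive1] of a component come without a measurability proof. *)
Lemma ge0_integral_le_off_null (N : set R) (f g : R -> \bar R) : measurable N -> leb N = 0%E ->
  (forall x, 0 <= f x)%E -> (forall x, 0 <= g x)%E -> (forall x, ~ N x -> f x = g x) ->
  (\int[leb]_x f x <= \int[leb]_x g x)%E.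
Proof.
move=> mN N0 f0 g0 fg; rewrite ge0_integralTE // ge0_integralTE //.
apply: ge_ereal_sup => _ /= [h hf <-].
have mNC := measurableC mN.
pose h' := proj_nnsfun h mNC.
rewrite -integralT_nnsfun.
have -> : (\int[leb]_x (h x)%:E = \int[leb]_x (h' x)%:E)%E.
  apply: ge0_ae_eq_integral => //.
  - exact/measurable_EFinP.
  - exact/measurable_EFinP.
  - by move=> x _; rewrite lee_fin.
  - by move=> x _; rewrite lee_fin.
  exists N; split => // x /=; apply: contra_notP => Nx _.
  by rewrite /= mindicE mem_set // mulr1.
rewrite integralT_nnsfun; apply: ereal_sup_ubound; exists h' => // x /=.
rewrite mindicE; have [xN|xN] := boolP (x \in ~` N).
  by rewrite mulr1 -fg //; exact: set_mem.
by rewrite mulr0.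
Qed.

Lemma integral_eq_off_null (N D : set R) (f g : R -> \bar R) : measurable N -> leb N = 0%E ->
  (forall x, D x -> ~ N x -> f x = g x) ->
  (\int[leb]_(x in D) f x = \int[leb]_(x in D) g x)%E.
Proof.
move=> mN N0 fg; rewrite [LHS]integral_mkcond [RHS]integral_mkcond.
have fgN x : ~ N x -> (f \_ D) x = (g \_ D) x.
  by move=> Nx; rewrite !patchE; case: ifPn => // /set_mem Dx; exact: fg.
rewrite [LHS]integralE [RHS]integralE; congr (_ - _)%E; apply/eqP; rewrite eq_le;
  apply/andP; split; apply: (ge0_integral_le_off_null mN N0) => // x Nx;
  by rewrite ?funepos.unlock ?funeneg.unlock /= fgN.
Qed.

Lemma int0_eq T t f g : in0T T t -> ae0T T (fun s => f s = g s) -> int0 t f = int0 t g.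
Proof.
move=> /andP[t0 tT] [N [mN N0 HN]]; rewrite /int0 /Rintegral; congr fine.
apply: (integral_eq_off_null mN N0) => x /=; rewrite in_itv /= => /andP[x0 xt] Nx.
congr EFin; apply: contrapT => fgx; apply: Nx; apply: HN => /= H; apply: fgx; apply: H.
by rewrite /= in_itv /= x0 (le_trans xt).
Qed.

(** * Indefinite integrals and measurable versions of derivatives *)

Definition bounded_mfun T g := measurable_fun `[0, T]%classic g /\
  exists M : R, forall t, in0T T t -> `|g t| <= M.

Lemma bounded_mfun_integrable T g : bounded_mfun T g ->
  leb.-integrable setT (EFin \o (g \_ `[0, T]%classic)).
Proof.
move=> [mg [M gM]]; have : leb.-integrable `[0, T]%classic (EFin \o g).
  apply: measurable_bounded_integrable => //.
    by have := @lebesgue_measure_itv R `[0, T]; rewrite /= => ->; case: ifP => _; rewrite ltry.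
  exists M; split; first exact: num_real.
  move=> x Mx t /=; rewrite in_itv /= => tT; apply: (le_trans (gM _ tT)); exact: ltW.
by rewrite -restrict_EFin => ?; apply/integrable_restrict => //=; rewrite setTI.
Qed.

Lemma int0_restrict T t g : t <= T ->
  int0 t g = \int[leb]_(s in `[0, t]%classic) (g \_ `[0, T]%classic) s.
Proof.
move=> tT; apply: eq_Rintegral => s; rewrite inE /= in_itv /= => /andP[s0 st].
by rewrite patchE mem_set //= in_itv /= s0 (le_trans st).
Qed.

Lemma int0_lipschitz T g : bounded_mfun T g -> lipschitz0T T (fun t => int0 t g).
Proof.
move=> bg; have ig := bounded_mfun_integrable bg; have [mg [M gM]] := bg.
have H s t : in0T T s -> in0T T t -> s <= t -> `|int0 t g - int0 s g| <= M * (t - s).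
  move=> /andP[s0 sT] /andP[t0 tT] st; rewrite (int0_restrict _ tT) (int0_restrict _ sT).
  rewrite Rintegral_itvB ?bnd_simp //; last exact: integrableS ig.
  apply: (le_trans (le_normr_Rintegral _ _)) => //; first exact: integrableS ig.
  apply: (@le_trans _ _ (\int[leb]_(x in `]s, t]) (cst M x))); last first.
    rewrite Rintegral_cst //= lebesgue_measure_itv /= lte_fin.
    case: (ltP s t) => //= ts; rewrite ?mulr0 // mulr_ge0 ?subr_ge0 // (le_trans _ (gM 0 _)) //; apply/andP; split => //; exact: le_trans sT.
  apply: le_Rintegral => //.
  - apply: integrableS (integrable_norm ig) => //.
  - apply: measurable_bounded_integrable => //.
      have := @lebesgue_measure_itv R `]s, t]; rewrite /= => ->; case: ifP => _; by rewrite ltry.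
    by exists `|M|; split => [|x Mx y _]; [exact: num_real|exact: ltW].
  move=> x /=; rewrite in_itv /= => /andP[sx xt].
  have xT : in0T T x by apply/andP; split; [apply: (le_trans s0); exact: ltW|exact: le_trans tT].
  by rewrite patchE mem_set //=; exact: gM.
exists M => s t sT tT; have [st|/ltW ts] := leP s t.
  by rewrite distrC (distrC s) (ger0_norm (x := t - s)) ?subr_ge0 //; exact: H.
by rewrite (ger0_norm (x := s - t)) ?subr_ge0 //; exact: H.
Qed.

Lemma int0_derive T g : bounded_mfun T g ->
  ae0T T (fun t => is_derive t 1 (fun s => int0 s g) (g t)).
Proof.
move=> bg; have ig := bounded_mfun_integrable bg; have [mg [M gM]] := bg.
pose F x := \int[leb]_(s in `[0, x]%classic) (g \_ `[0, T]%classic) s.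
have ig' y : leb.-integrable [set` Interval (BLeft (0 : R)) (BRight y)] (EFin \o (g \_ `[0, T]%classic)).
  exact: integrableS ig.
have lg : locally_integrable setT (g \_ `[0, T]%classic).
  by apply: open_integrable_locally => //; exact: openT.
have aeF := FTC1 ig' lg.
have {}aeF : ae0T T (fun x => 0 < x -> derivable F x 1 /\ derive1 F x = (g \_ `[0, T]%classic) x).
  move: aeF; apply: filterS; first exact: (ae_filter_ringOfSetsType leb).
  by move=> x Hx _ x0; apply: Hx; rewrite lte_fin.
apply: ae0T_imp (ae0T_and (ae0T_interior T) aeF) => t tT [tio /(_ (andP tio).1)[dF dFE]].
apply: (@is_derive_in0T T _ F) => //.
  by move=> s /andP[s0 sT]; exact: int0_restrict.
have -> : g t = derive1 F t by rewrite dFE patchE mem_set //= in_itv.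
by rewrite derive1E; exact: derivableP.
Qed.

Lemma int00 g : int0 0 g = 0.
Proof. by rewrite /int0 set_itv1 Rintegral_set1. Qed.

Lemma lipschitz_int0 T f g : lipschitz0T T f -> bounded_mfun T g ->
  ae0T T (fun t => is_derive t 1 f (g t)) -> forall t, in0T T t -> f t = f 0 + int0 t g.
Proof.
move=> lf bg df t tT.
apply: (@abscont_unique T f (fun t => f 0 + int0 t g)) => //.
- exact: lipschitz_abscont.
- apply: lipschitz_abscont; have [L HL] := int0_lipschitz bg.
  by exists L => s u sT uT; rewrite opprD addrACA subrr add0r; exact: HL.
- apply: ae0T_imp (ae0T_and df (int0_derive bg)) => s _ [h1 h2]; exists (g s) => //.
  by have := derD (der_cst (f 0) s) h2; rewrite add0r.
- by rewrite int00 addr0.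
Qed.

(** Off a Borel null set the derivative is the limit of difference quotients of the clamped
    extension, which are continuous on the whole line; on the null set the version is 0. The
    Lipschitz constant bounds it. *)
Lemma lipschitz_derive_version T f : 0 <= T -> lipschitz0T T f ->
  exists g, bounded_mfun T g /\ ae0T T (fun t => is_derive t 1 f (g t)).
Proof.
move=> T0 lf; have [L L0 HL] := lipschitz_pos lf.
pose fe := f \o clamp T.
have fec : continuous fe.
  apply: (@lipschitz_continuous fe L) => // s t.
  apply: (le_trans (HL _ _ (clamp_in _ T0) (clamp_in _ T0))); apply: ler_wpM2l; first exact: ltW.
  have [st|/ltW ts] := leP s t.
    by rewrite distrC (distrC s) !ger0_norm ?subr_ge0 ?clamp_mono // clamp_le.
  by rewrite !ger0_norm ?subr_ge0 ?clamp_mono // clamp_le.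
have [N [mN N0 HN]] : ae0T T (fun t => 0 < t < T /\ derivable f t 1).
  apply: ae0T_and; [exact: ae0T_interior|exact: lipschitz_ae_derive].
pose q (k : nat) t := k.+1%:R * (fe (t + k.+1%:R^-1) - fe t).
pose D := `[0, T]%classic `\` N.
pose g := (derive1 f) \_ D.
have mD : measurable D by exact: measurableD.
have good t : D t -> 0 < t < T /\ derivable f t 1.
  by move=> [tT tN]; apply: contrapT => H; apply: tN; apply: HN => /=; apply: contra_not H; exact.
have gE t : D t -> g t = derive1 f t by move=> Dt; rewrite /g patchE mem_set.
have dE t : D t -> is_derive t 1 f (derive1 f t).
  by move=> /good[_ dt]; rewrite derive1E; exact: derivableP.
have cv t : D t -> (q ^~ t) @ \oo --> derive1 f t.
  move=> Dt; have [tio _] := good t Dt.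
  have := dE t Dt => /(@is_derive_in0T T fe f t _ tio).
  have H0 : forall s, in0T T s -> fe s = f s by move=> s sT; rewrite /fe /= clamp_id.
  move=> /(_ H0) /is_derive_epsP H.
  apply/cvgrPdist_le => e e0; have [del del0 Hd] := H e e0.
  near=> k; rewrite /q.
  have k0 : 0 < k.+1%:R :> R by [].
  have : `|k.+1%:R^-1| < del :> R.
    rewrite ger0_norm ?invr_ge0 ?ler0n //; near: k.
    exact: near_infty_natSinv_lt (PosNum del0).
  move=> /Hd; rewrite (ger0_norm (x := k.+1%:R^-1)) ?invr_ge0 ?ler0n // => Hk.
  have := ler_wpM2l (ltW k0) Hk; rewrite mulrCA divff ?gt_eqF // mulr1.
  rewrite -{1}(ger0_norm (x := k.+1%:R)) ?ler0n // -normrM distrC; congr (`|_| <= _).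
  by rewrite mulrBr mulrCA divff ?gt_eqF // mulr1.
have aeg : ae0T T (fun t => is_derive t 1 f (g t)).
  exists N; split => // t /= nt; apply: contrapT => Nt; apply: nt => tT.
  have Dt : D t by split.
  by rewrite gE //; exact: dE.
have mg : measurable_fun setT g.
  apply: (measurable_restrictT _ mD).1.
  apply: (@measurable_fun_cvg _ _ _ D q) => // k.
  apply: measurable_funM; first exact: measurable_cst.
  apply: measurable_funB; apply: measurable_funTS; last exact: continuous_measurable_fun.
  apply: measurableT_comp; first exact: continuous_measurable_fun.
  by apply: measurable_funD; [exact: measurable_id|exact: measurable_cst].
exists g; split => //; split; first exact: measurable_funTS.
exists L => t tT; have [tD|tD] := boolP (t \in D); last first.
  by rewrite /g patchE (negbTE tD) normr0 ltW.
have Dt := set_mem tD; rewrite gE //.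
have [tio _] := good t Dt.
apply/ler_addgt0Pr => e e0; have /is_derive_epsP /(_ e e0)[del del0 Hd] := dE t Dt.
have [/andP[t0 tT']] := tio.
pose h := Num.min (del / 2) (T - t).
have h0 : 0 < h by rewrite /h lt_min; apply/andP; split; lra.
have hd : h < del by rewrite /h gt_min; apply/orP; left; lra.
have hT : h <= T - t by rewrite /h ge_min lexx orbT.
have := Hd h; rewrite ger0_norm; last exact: ltW.
move=> /(_ hd) H1.
have : `|f (t + h) - f t| <= L * `|t + h - t| by apply: HL => //; apply/andP; split; lra.
have h0' := ltW h0; rewrite addrAC subrr add0r (ger0_norm h0') => H2.
rewrite -(ler_pM2r h0) -{1}(gtr0_norm h0) -normrM mulrDl.
have -> : derive1 f t * h = (f (t + h) - f t) - (f (t + h) - f t - derive1 f t * h) by ring.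
by apply: (le_trans (ler_normB _ _)); exact: lerD.
Unshelve. all: by end_near. Qed.

End RealAnalysis.

(** * Planar Lebesgue measure *)

Section PlanarMeasure.
Context {R : realType}.
Local Notation leb := (@lebesgue_measure R).
Local Notation leb2 := ((@lebesgue_measure R) \x (@lebesgue_measure R))%E.

Lemma lebesgue_measure_translate (c : R) (A : set R) : measurable A ->
  leb [set y | A (y + c)] = leb A.
Proof.
move=> mA.
have mf : measurable_fun setT (fun y : measurableTypeR R => y + c : measurableTypeR R).
  by apply: measurable_funD; [exact: measurable_id|exact: measurable_cst].
pose f : {mfun measurableTypeR R >-> measurableTypeR R} :=
  HB.pack (fun y : measurableTypeR R => y + c : measurableTypeR R) (isMeasurableFun.Build _ _ _ _ _ mf).
apply/esym/(@lebesgue_measure_unique R (pushforward leb f)) => // _ [[a b]] _ <-.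
rewrite /pushforward /=.
transitivity (leb `]a - c, b - c]%classic).
  rewrite !lebesgue_measure_itv /= !lte_fin ltrD2r; case: ifP => // _.
  by rewrite -!EFinB; congr EFin; ring.
rewrite /pushforward; congr (leb _).
by apply/seteqP; split => y; rewrite /= !in_itv /= ltrBlDr lerBrDr.
Qed.

Lemma measurable_plane_fun (f : R * R -> R * R) :
  measurable_fun setT (fun p => (f p).1) -> measurable_fun setT (fun p => (f p).2) ->
  measurable_fun setT f.
Proof. by move=> h1 h2; apply/measurable_fun_pairP; split. Qed.

Lemma measurable_lin (a b : R) : measurable_fun setT (fun p : R * R => a * p.1 + b * p.2).
Proof.
apply: measurable_funD; apply: measurable_funM;
  by [exact: measurable_cst|exact: measurable_fst|exact: measurable_snd].
Qed.

Definition lin2 (a b c d : R) (p : R * R) := (a * p.1 + b * p.2, c * p.1 + d * p.2).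

Lemma measurable_lin2 a b c d : measurable_fun setT (lin2 a b c d).
Proof. by apply: measurable_plane_fun; exact: measurable_lin. Qed.

Lemma measurable_preimage_lin2 a b c d (A : set (R * R)) : measurable A ->
  measurable (lin2 a b c d @^-1` A).
Proof. by move=> mA; rewrite -[X in measurable X]setTI; exact: measurable_lin2. Qed.

(** A shear translates every vertical section, so Fubini and translation invariance on the line
    suffice. *)
Lemma leb2_shearl (k : R) (A : set (R * R)) : measurable A ->
  leb2 (lin2 1 0 k 1 @^-1` A) = leb2 A.
Proof.
move=> mA; apply: eq_integral => x _ /=.
rewrite -(lebesgue_measure_translate (k * x) (measurable_xsection x mA)).
congr lebesgue_measure; apply/seteqP; split => y;
  by rewrite /xsection /= !inE /lin2 /= !mul1r mul0r addr0 addrC.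
Qed.

Lemma leb2_ysection (A : set (R * R)) : measurable A ->
  leb2 A = (\int[leb]_y (leb (ysection A y)))%E.
Proof.
move=> mA; have := @product_measure_unique _ _ _ _ R leb leb (leb \x^ leb)%E.
move=> /(_ _ A mA) -> // B C mB mC; exact: product_measure2E.
Qed.

Lemma leb2_shearr (k : R) (A : set (R * R)) : measurable A ->
  leb2 (lin2 1 k 0 1 @^-1` A) = leb2 A.
Proof.
move=> mA; rewrite !leb2_ysection //; last exact: measurable_preimage_lin2.
apply: eq_integral => y _ /=.
rewrite -(lebesgue_measure_translate (k * y) (measurable_ysection y mA)).
congr lebesgue_measure; apply/seteqP; split => x;
  by rewrite /ysection /= !inE /lin2 /= !mul1r mul0r add0r.
Qed.

Lemma lin2_comp a b c d a' b' c' d' p :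
  lin2 a b c d (lin2 a' b' c' d' p) =
  lin2 (a * a' + b * c') (a * b' + b * d') (c * a' + d * c') (c * b' + d * d') p.
Proof. by rewrite /lin2 /=; congr (_, _); ring. Qed.

(** A matrix of determinant 1 whose entry [b] is nonzero is a product of three shears; [r] and [s]
    are read off from that factorization. *)
Lemma leb2_lin2_neq0 a b c d (A : set (R * R)) : a * d - b * c = 1 -> b != 0 ->
  measurable A -> leb2 (lin2 a b c d @^-1` A) = leb2 A.
Proof.
move=> det b0 mA; pose r := (d - 1) / b; pose s := (a - 1) / b.
have cE : c = (a * d - 1) / b by apply: (mulfI b0); rewrite mulrCA divff // mulr1 -det; ring.
have E p : lin2 1 0 r 1 (lin2 1 b 0 1 (lin2 1 0 s 1 p)) = lin2 a b c d p.
  by rewrite /lin2 /= cE /r /s; congr (_, _); field.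
have -> : lin2 a b c d @^-1` A = lin2 1 0 s 1 @^-1` (lin2 1 b 0 1 @^-1` (lin2 1 0 r 1 @^-1` A)).
  by apply/seteqP; split => p /=; rewrite E.
have m1 := measurable_preimage_lin2 1 0 r 1 mA.
have m2 := measurable_preimage_lin2 1 b 0 1 m1.
by rewrite (leb2_shearl s m2) (leb2_shearr b m1) (leb2_shearl r mA).
Qed.

(** If [b] is 0 then [a] is not, and splitting off one more shear leaves a matrix with upper right
    entry [a]. Only rotations are needed later, to move triangles into position. *)
Lemma leb2_lin2 a b c d (A : set (R * R)) : a * d - b * c = 1 ->
  measurable A -> leb2 (lin2 a b c d @^-1` A) = leb2 A.
Proof.
move=> det mA; have [b0|b0] := eqVneq b 0; last exact: leb2_lin2_neq0.
have a0 : a != 0 by apply/eqP => a0; move: det; rewrite a0 b0 !mul0r subrr => /eqP; rewrite eq_sym oner_eq0.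
have -> : lin2 a b c d @^-1` A = lin2 1 (- 1) 0 1 @^-1` (lin2 a a c (c + d) @^-1` A).
  have E p : lin2 a a c (c + d) (lin2 1 (-1) 0 1 p) = lin2 a b c d p.
    by rewrite lin2_comp /lin2 b0; congr (_, _); ring.
  by apply/seteqP; split => p /=; rewrite E.
rewrite leb2_shearr; last exact: measurable_preimage_lin2.
by apply: leb2_lin2_neq0 => //; rewrite -det b0; ring.
Qed.

(** The product sigma-algebra is generated by rectangles; an open set is the countable union of the
    boxes with rational centre and side [2 / (k + 1)] that it contains. *)
Lemma open_measurable2 (U : set (R * R)) : open U -> measurable U.
Proof.
move=> oU.
pose box (q : rat * rat * nat) := `](ratr q.1.1 - q.2.+1%:R^-1), (ratr q.1.1 + q.2.+1%:R^-1)[%classic `*`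
  `](ratr q.1.2 - q.2.+1%:R^-1), (ratr q.1.2 + q.2.+1%:R^-1)[%classic : set (R * R).
pose B i := if unpickle i is Some q then (if `[< box q `<=` U >] then box q else set0) else set0.
have Bq q : B (pickle q) = if `[< box q `<=` U >] then box q else set0.
  by rewrite /B pickleK.
have -> : U = \bigcup_i B i.
  apply/seteqP; split => [p Up|p [i _]]; last first.
    by rewrite /B; case: unpickle => // q; case: asboolP => // H; exact: H.
  have : nbhs p U by exact: open_nbhs_nbhs.
  move=> /nbhs_ballP[e /= e0 He].
  have e2 : 0 < e / 2 by lra.
  pose k := (Num.truncn (e / 2)^-1).
  have ke : k.+1%:R^-1 < e / 2 :> R.
    rewrite invf_plt ?posrE ?ltr0Sn //; first exact: truncnS_gt.
  have k0 : 0 < k.+1%:R^-1 :> R by rewrite invr_gt0.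
  have rat_near x : exists q : rat, (ratr q : R) \in `](x - k.+1%:R^-1), (x + k.+1%:R^-1)[.
    have [|q Hq] := @rat_in_itvoo R (x - k.+1%:R^-1) (x + k.+1%:R^-1); last by exists q.
    by rewrite ltrBlDr -addrA ltrDl addr_gt0.
  have [q1 Hq1] := rat_near p.1.
  have [q2 Hq2] := rat_near p.2.
  exists (pickle (q1, q2, k)); [exact: I|rewrite Bq].
  move: Hq1 Hq2; rewrite !in_itv /= => /andP[h1 h2] /andP[h3 h4].
  rewrite /box /=; move: ke k0 h1 h2 h3 h4.
  move: (k.+1%:R^-1 : R) (ratr q1 : R) (ratr q2 : R) => w s1 s2 ke k0 h1 h2 h3 h4.
  case: asboolP => [_|].
    by split; rewrite /= in_itv /=; apply/andP; split; lra.
  case=> -[r1 r2] [] /=; rewrite !in_itv /= => /andP[h5 h6] /andP[h7 h8].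
  apply: He; split; rewrite /ball /= ltr_norml; apply/andP; split; lra.
apply: bigcupT_measurable => i; rewrite /B; case: unpickle => // q.
by case: ifP => // _; apply: measurableX; exact: measurable_itv.
Qed.

Lemma closed_measurable2 (C : set (R * R)) : closed C -> measurable C.
Proof. by move=> cC; rewrite -[C]setCK; apply: measurableC; apply: open_measurable2; exact: closed_openC. Qed.

Lemma leb2_triangle (a k : R) (A : set (R * R)) : 0 < a -> 0 <= k ->
  (forall x, 0 <= x <= a -> leb (xsection A x) = (k * x)%:E) ->
  (forall x, ~~ (0 <= x <= a) -> xsection A x = set0) ->
  leb2 A = (k * a ^+ 2 / 2)%:E.
Proof.
move=> a0 k0 h1 h2; rewrite /product_measure1.
transitivity (\int[leb]_(x in `[0%R, a]) (k * x)%:E)%E.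
  rewrite [RHS]integral_mkcond; apply: eq_integral => x _ /=.
  rewrite patchE; case: ifPn => [|]; first by rewrite inE /= in_itv /= => /h1.
  rewrite notin_setE /= in_itv /= => /negP xa; rewrite h2 ?measure0 //.
rewrite (@continuous_FTC2 _ (fun x => k * x) (fun x => k / 2 * (x * x)) 0 a) //.
- by rewrite -EFinB; congr EFin; field.
- apply: continuous_subspaceT => x; apply: cvgM; [exact: cvg_cst|exact: cvg_id].
- have dF (x : R) : is_derive x 1 (fun x : R => k / 2 * (x * x)) (k * x).
    by apply: (derE (derZ _ (derM (der_id x) (der_id x)))); field.
  have cF : continuous (fun x : R => k / 2 * (x * x)).
    by move=> x; apply: cvgM; [exact: cvg_cst|apply: cvgM; exact: cvg_id].
  split.
  + by move=> x _; have [] := dF x.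
  + by apply: cvg_at_right_filter; exact: cF.
  + by apply: cvg_at_left_filter; exact: cF.
- move=> x _; rewrite derive1E; apply: derive_val.
  by apply: (derE (derZ _ (derM (der_id x) (der_id x)))); field.
Qed.

End PlanarMeasure.

(** * Gauges and polars of planar convex bodies *)

Section ConvexBody.
Context {R : realType}.
Implicit Types (K : set (R * R)) (p q w : R * R).

Definition dot p q : R := p.1 * q.1 + p.2 * q.2.
Definition cross p q : R := p.1 * q.2 - p.2 * q.1.
Definition sc (a : R) p : R * R := (a * p.1, a * p.2).
Definition nrm p : R := `|p.1| + `|p.2|.
Definition sub2 p q : R * R := (p.1 - q.1, p.2 - q.2).
Definition add2 p q : R * R := (p.1 + q.1, p.2 + q.2).

Lemma nrm_ge0 p : 0 <= nrm p. Proof. by rewrite addr_ge0. Qed.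

Lemma nrm_sc a p : nrm (sc a p) = `|a| * nrm p.
Proof. by rewrite /nrm /= !normrM mulrDr. Qed.

Lemma nbhs_plane K p : nbhs p K <-> exists2 e : R, 0 < e & forall q, nrm (sub2 q p) < e -> K q.
Proof.
split=> [/nbhs_ballP[e /= e0 He]|[e e0 He]].
  exists e => // q qp; apply: He; split; rewrite /ball /= distrC;
    apply: le_lt_trans qp; rewrite /nrm /sub2 /=; by rewrite ?lerDl ?lerDr.
apply/nbhs_ballP; exists (e / 2); first by rewrite /= divr_gt0.
move=> q [] /=; rewrite /ball /= => h1 h2; apply: He; rewrite /nrm /sub2 /= -(distrC p.1) -(distrC p.2).
by lra.
Qed.

Lemma body_ball K : convex_body2 K -> exists2 m : R, 0 < m & forall p, nrm p <= m -> K p.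
Proof.
move=> [_ _ /nbhs_plane[e e0 He]]; exists (e / 2); first by rewrite divr_gt0.
by move=> p pe; apply: He; rewrite /sub2 !subr0 -surjective_pairing; lra.
Qed.

Lemma body_closed K : convex_body2 K -> closed K.
Proof.
by move=> [cK _ _]; apply: compact_closed cK; exact: (@norm_hausdorff _ (R * R)%type).
Qed.

Lemma body_bounded K : convex_body2 K -> exists2 M : R, 0 < M & forall p, K p -> nrm p <= M.
Proof.
move=> [cK _ _]; have [M [_ HM]] := compact_bounded cK.
pose M' := `|M| + 1; exists (M' + M'); first by rewrite addr_gt0 // ltr_wpDl.
move=> p Kp; have := HM M'; rewrite /M' => /(_ _ p Kp) /= H.
have {}H : `|p| <= `|M| + 1 by apply: H; rewrite (le_lt_trans (ler_norm M)) // ltrDl.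
have [h1 h2] : `|p.1| <= `|M| + 1 /\ `|p.2| <= `|M| + 1.
  by split; apply: le_trans H; rewrite /Num.norm /= le_max lexx ?orbT.
by rewrite /nrm lerD.
Qed.

Lemma body_closure K p : convex_body2 K ->
  (forall e : R, 0 < e -> exists2 q, K q & nrm (sub2 q p) < e) -> K p.
Proof.
move=> bK H; apply: (body_closed bK) => B /nbhs_plane[e e0 He].
by have [q Kq qp] := H e e0; exists q; split => //; exact: He.
Qed.

Lemma body0 K : convex_body2 K -> K (0, 0).
Proof. by move=> [_ _ /nbhs_singleton]. Qed.

Lemma body_star K p (s : R) : convex_body2 K -> K p -> 0 <= s <= 1 -> K (sc s p).
Proof.
move=> bK Kp s01; have [_ cK _] := bK; have := cK p (0, 0) s Kp (body0 bK) s01.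
by rewrite /= !mulr0 !addr0.
Qed.

Definition gset K p := [set r : R | 0 < r /\ exists w : R * R, K w /\ p = (r * w.1, r * w.2)].

Lemma gset_lb K p : lbound (gset K p) 0.
Proof. by move=> r [/ltW]. Qed.

Lemma gset_ball K m p : 0 < m -> (forall p, nrm p <= m -> K p) -> forall e : R, 0 < e ->
  gset K p (nrm p / m + e).
Proof.
move=> m0 Hm e e0; set r := _ + e; have r0 : 0 < r by rewrite ltr_wpDl // divr_ge0 ?nrm_ge0 // ltW.
split => //; exists (sc r^-1 p); split; last first.
  by rewrite /= !mulrA !mulfV ?gt_eqF // !mul1r -surjective_pairing.
have ri0 : 0 <= r^-1 by rewrite invr_ge0 ltW.
apply: Hm; rewrite nrm_sc (ger0_norm ri0) mulrC ler_pdivrMr // mulrDr mulrC.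
by rewrite divfK ?gt_eqF // lerDl ltW // mulr_gt0.
Qed.

Lemma gset_neq0 K p : convex_body2 K -> gset K p !=set0.
Proof.
move=> bK; have [m m0 Hm] := body_ball bK; exists (nrm p / m + 1); exact: gset_ball.
Qed.

Lemma gauge_ge0 K p : convex_body2 K -> 0 <= gauge K p.
Proof. by move=> bK; apply: lb_le_inf; [exact: gset_neq0|exact: gset_lb]. Qed.

Lemma gauge_le K w (r : R) : 0 < r -> K w -> gauge K (sc r w) <= r.
Proof.
move=> r0 Kw; apply: ge_inf; last by split => //; exists w.
by exists 0; exact: gset_lb.
Qed.

Lemma gauge_lt K p (r : R) : convex_body2 K -> gauge K p < r -> exists2 w, K w & p = sc r w.
Proof.
move=> bK gr; have [||r' [r'0 [w [Kw pE]]] r'r] := @inf_adherent _ (gset K p) (r - gauge K p).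
- by rewrite subr_gt0.
- by split; [exact: gset_neq0|exists 0; exact: gset_lb].
have {}r'r : r' < r by move: r'r; rewrite /gauge -/(gset K p) addrC subrK.
have r0 : 0 < r by exact: lt_trans r'r.
exists (sc (r' / r) w).
  by apply: body_star => //; rewrite ler_pdivrMr // mul1r (ltW r'r) andbT divr_ge0 // ltW.
by rewrite pE /sc /=; congr (_, _); rewrite mulrA mulrCA divff ?gt_eqF // mulr1.
Qed.

Lemma scK (a : R) p : a != 0 -> sc a (sc a^-1 p) = p.
Proof. by move=> a0; rewrite /sc /= !mulrA !divff // !mul1r -surjective_pairing. Qed.

Lemma sc_sc (a b : R) p : sc a (sc b p) = sc (a * b) p.
Proof. by rewrite /sc /= !mulrA. Qed.

Lemma sc1 p : sc 1 p = p.
Proof. by rewrite /sc !mul1r -surjective_pairing. Qed.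

(** Closedness of [K] makes the infimum in the gauge attained: the points obtained for radii
    slightly above [r] lie in [K] and converge to the wanted one. *)
Lemma gauge_mem K p (r : R) : convex_body2 K -> 0 < r -> gauge K p <= r -> K (sc r^-1 p).
Proof.
move=> bK r0 gr; apply: body_closure => // e e0.
have [M M0 HM] := body_bounded bK.
(* Chosen so that the rescaling error [d / r * M] is [e / 2], where [M] bounds [K]. *)
pose d := r * e / (2 * M).
have d0 : 0 < d by rewrite divr_gt0 ?mulr_gt0.
have [|w Kw pE] := @gauge_lt K p (r + d) bK; first by rewrite (le_lt_trans gr) // ltrDl.
exists w => //; rewrite pE sc_sc /sub2 /sc /=.
have -> : (w.1 - r^-1 * (r + d) * w.1, w.2 - r^-1 * (r + d) * w.2) = sc (- (d / r)) w.
  by rewrite /sc; congr (_, _); field; rewrite gt_eqF.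
have dr0 : 0 <= d / r by rewrite divr_ge0 // ltW.
rewrite nrm_sc normrN (ger0_norm dr0).
apply: (@le_lt_trans _ _ (d / r * M)); first by rewrite ler_wpM2l // HM.
have -> : d / r * M = e / 2 by rewrite /d; field; rewrite ?gt_eqF.
lra.
Qed.

Lemma gauge_le1 K p : convex_body2 K -> (gauge K p <= 1) <-> K p.
Proof.
move=> bK; split=> [/(gauge_mem bK ltr01)|Kp]; first by rewrite invr1 sc1.
by have := gauge_le ltr01 Kp; rewrite sc1.
Qed.

Lemma gauge_leP K p (r : R) : convex_body2 K -> 0 < r -> gauge K p <= r <-> K (sc r^-1 p).
Proof.
move=> bK r0; split; first exact: gauge_mem.
by move=> /(gauge_le r0); rewrite scK // gt_eqF.
Qed.

Lemma gauge_sc K p (c : R) : convex_body2 K -> 0 <= c -> gauge K (sc c p) = c * gauge K p.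
Proof.
move=> bK; rewrite le_eqVlt => /orP[/eqP<-|c0].
  rewrite mul0r /sc !mul0r; apply/eqP; rewrite eq_le gauge_ge0 // andbT.
  apply/ler_addgt0Pr => e e0; rewrite add0r.
  by have := gauge_le e0 (body0 bK); rewrite /sc /= mulr0.
have H (a : R) u : 0 < a -> gauge K (sc a u) <= a * gauge K u.
  move=> a0; apply/ler_addgt0Pr => e e0.
  have [|w Kw uE] := @gauge_lt K u (gauge K u + e / a) bK; first by rewrite ltrDl divr_gt0.
  have gu := gauge_ge0 u bK.
  have r0 : 0 < gauge K u + e / a by rewrite ltr_wpDl // divr_gt0.
  rewrite {1}uE sc_sc; have := @gauge_le K w (a * (gauge K u + e / a)).
  rewrite mulrDr mulrCA divff ?gt_eqF // mulr1; apply => //.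
  by rewrite ltr_wpDl // mulr_ge0 // ltW.
apply/eqP; rewrite eq_le H //=.
have := H c^-1 (sc c p); rewrite invr_gt0 => /(_ c0).
by rewrite sc_sc mulVf ?gt_eqF // sc1 mulrC ler_pdivlMr // mulrC.
Qed.

Lemma gaugeD K p q : convex_body2 K -> gauge K (add2 p q) <= gauge K p + gauge K q.
Proof.
move=> bK; apply/ler_addgt0Pr => e e0.
have gp := gauge_ge0 p bK; have gq := gauge_ge0 q bK.
pose r := gauge K p + e / 2; pose s := gauge K q + e / 2.
have [w Kw pE] := @gauge_lt K p r bK (ltac:(rewrite /r; lra)).
have [w' Kw' qE] := @gauge_lt K q s bK (ltac:(rewrite /s; lra)).
have r0 : 0 < r by rewrite /r; lra.
have s0 : 0 < s by rewrite /s; lra.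
have rs0 : 0 < r + s by lra.
have -> : gauge K p + gauge K q + e = r + s by rewrite /r /s; field.
have [_ cK _] := bK.
have := cK w w' (r / (r + s)) Kw Kw'.
rewrite ler_pdivrMr // mul1r lerDl (ltW s0) andbT divr_ge0 ?(ltW r0) ?(ltW rs0) // => /(_ isT) Kc.
have := gauge_le rs0 Kc; congr (gauge K _ <= _).
by rewrite pE qE /sc /add2 /=; congr (_, _); field; rewrite gt_eqF.
Qed.

Lemma gauge_ub K : convex_body2 K -> exists2 L : R, 0 < L & forall p, gauge K p <= L * nrm p.
Proof.
move=> bK; have [m m0 Hm] := body_ball bK; exists m^-1; first by rewrite invr_gt0.
move=> p; apply/ler_addgt0Pr => e e0; rewrite mulrC; apply: ge_inf; last exact: gset_ball.
by exists 0; exact: gset_lb.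
Qed.

Lemma gauge_lb K : convex_body2 K -> exists2 M : R, 0 < M & forall p, nrm p <= M * gauge K p.
Proof.
move=> bK; have [M M0 HM] := body_bounded bK; exists M => // p.
apply/ler_addgt0Pr => e e0.
have [|w Kw pE] := @gauge_lt K p (gauge K p + e / M) bK; first by rewrite ltrDl divr_gt0.
have gp := gauge_ge0 p bK.
have r0 : 0 < gauge K p + e / M by rewrite ltr_wpDl // divr_gt0.
rewrite {1}pE nrm_sc (ger0_norm (ltW r0)).
apply: (@le_trans _ _ ((gauge K p + e / M) * M)); first by rewrite ler_wpM2l // ?(ltW r0) // HM.
by rewrite mulrDl divfK ?gt_eqF // mulrC.
Qed.

Lemma gauge_lip K : convex_body2 K -> exists2 L : R, 0 < L &
  forall p q, `|gauge K p - gauge K q| <= L * nrm (sub2 p q).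
Proof.
move=> bK; have [L L0 HL] := gauge_ub bK; exists L => //.
have H p q : gauge K p - gauge K q <= L * nrm (sub2 p q).
  rewrite lerBlDr; have := gaugeD (sub2 p q) q bK.
  rewrite {1}/add2 /sub2 /= !subrK -surjective_pairing => /le_trans; apply.
  by rewrite lerD2r; exact: HL.
move=> p q; rewrite ler_norml H andbT lerNl opprB.
by apply: (le_trans (H q p)); rewrite /nrm /sub2 /= distrC (distrC p.2).
Qed.

(** Where the gauge is below 1, its Lipschitz bound leaves a whole neighbourhood inside [K]; where
    it is 1, the points [sc (1 + d) p] are outside [K] and arbitrarily close. *)
Lemma boundary_gauge K p : convex_body2 K -> boundary2 K p <-> gauge K p = 1.
Proof.
move=> bK; rewrite /boundary2 -(closure_id K).1; last exact: body_closed.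
split=> [[Kp nKp]|g1].
  apply/eqP; rewrite eq_le; apply/andP; split; first exact/gauge_le1.
  rewrite leNgt; apply/negP => g1; apply: nKp; apply/nbhs_plane.
  have [L L0 HL] := gauge_lip bK.
  exists ((1 - gauge K p) / L); first by rewrite divr_gt0 // subr_gt0.
  move=> q; rewrite ltr_pdivlMr // mulrC => qp; apply/gauge_le1 => //.
  by have := HL q p; rewrite ler_norml => /andP[_ ?]; lra.
split; first by apply/gauge_le1 => //; rewrite g1.
move=> /nbhs_plane[e e0 He].
have n0 := nrm_ge0 p.
pose d := e / (2 * (nrm p + 1)).
have d0 : 0 < d by rewrite divr_gt0 // mulr_gt0 // ltr_wpDl.
have : K (sc (1 + d) p).
  apply: He; have -> : sub2 (sc (1 + d) p) p = sc d p by rewrite /sub2 /sc /=; congr (_, _); ring.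
  rewrite nrm_sc gtr0_norm // /d mulrAC ltr_pdivrMr ?mulr_gt0 ?ltr_wpDl //; nra.
have d1 : 0 <= 1 + d by lra.
by move/(gauge_le1 _ bK); rewrite (gauge_sc _ bK d1) g1; lra.
Qed.

Lemma dotC p q : dot p q = dot q p.
Proof. by rewrite /dot; ring. Qed.

Lemma dot_scl (a : R) p q : dot (sc a p) q = a * dot p q.
Proof. by rewrite /dot /=; ring. Qed.

Lemma dot_scr (a : R) p q : dot p (sc a q) = a * dot p q.
Proof. by rewrite /dot /=; ring. Qed.

Lemma dot_le_nrm p q : `|dot p q| <= nrm p * nrm q.
Proof.
rewrite /dot /nrm; apply: (le_trans (ler_normD _ _)); rewrite !normrM.
have := normr_ge0 p.1; have := normr_ge0 p.2; have := normr_ge0 q.1; have := normr_ge0 q.2; nra.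
Qed.

(** A ball inside [K] bounds the polar, and a bound for [K] puts a ball inside the polar. *)
Lemma polar_body K : convex_body2 K -> convex_body2 (polar K).
Proof.
move=> bK; have [m m0 Hm] := body_ball bK; have [M M0 HM] := body_bounded bK.
split.
- have pb p : polar K p -> `|p.1| <= m^-1 /\ `|p.2| <= m^-1.
    move=> Kp.
    have H (a b : R) : `|a| + `|b| <= m -> p.1 * a + p.2 * b <= 1.
      by move=> ab; apply: (Kp (a, b)); exact: Hm.
    have := H m 0; have := H (- m) 0; have := H 0 m; have := H 0 (- m).
    rewrite !normrN normr0 addr0 add0r gtr0_norm // lexx => /(_ isT) h1 /(_ isT) h2 /(_ isT) h3 /(_ isT) h4.
    have mm : m^-1 * m = 1 by rewrite mulVf // gt_eqF.
    by rewrite !ler_norml; split; apply/andP; split; nra.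
  apply: (@subclosed_compact _ _ (`[- m^-1, m^-1]%classic `*` `[- m^-1, m^-1]%classic)).
  + move=> p Hp uv Kuv; rewrite -/(dot p uv) leNgt; apply/negP => d1.
    have n0 := nrm_ge0 uv.
    have e0 : 0 < (dot p uv - 1) / (nrm uv + 1) by rewrite divr_gt0 ?subr_gt0 // ltr_wpDl.
    have [|q [Kq qp]] := Hp [set q | nrm (sub2 q p) < (dot p uv - 1) / (nrm uv + 1)].
      by apply/nbhs_plane; exists ((dot p uv - 1) / (nrm uv + 1)).
    have := Kq uv Kuv; rewrite -/(dot q uv) => d2.
    have E : dot p uv = dot q uv - dot (sub2 q p) uv by rewrite /dot /sub2 /=; ring.
    have := dot_le_nrm (sub2 q p) uv; rewrite ler_norml => /andP[d3 _].
    have n1 : 0 < nrm uv + 1 by lra.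
    move: qp => /=; rewrite ltr_pdivlMr // => qp.
    have := nrm_ge0 (sub2 q p); nra.
  + by apply: compact_setX; exact: segment_compact.
  + by move=> p /pb[]; rewrite !ler_norml => h1 h2; split; rewrite /= in_itv.
- move=> p q s Kp Kq /andP[s0 s1] uv Kuv /=.
  by have := Kp uv Kuv; have := Kq uv Kuv; nra.
- apply/nbhs_plane; exists M^-1; first by rewrite invr_gt0.
  move=> q; rewrite /sub2 /= !subr0 -surjective_pairing => qM uv Kuv.
  rewrite -/(dot q uv); apply: (le_trans (ler_norm _)); apply: (le_trans (dot_le_nrm _ _)).
  have <- : M^-1 * M = 1 by rewrite mulVf // gt_eqF.
  apply: ler_pM; rewrite ?nrm_ge0 //; [exact: ltW|exact: HM].
Qed.

(** The polar inequality, obtained by homogeneity from points of the two bodies with slightly larger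
    radii. Equality in it is the duality relation between angles. *)
Lemma dot_le_gauge K p w : convex_body2 K -> dot p w <= gauge (polar K) p * gauge K w.
Proof.
move=> bK; have bP := polar_body bK.
have gp := gauge_ge0 p bP; have gw := gauge_ge0 w bK.
apply/ler_addgt0Pr => e e0.
pose d := Num.min 1 (e / (gauge (polar K) p + gauge K w + 1)).
have s0 : 0 < gauge (polar K) p + gauge K w + 1 by rewrite ltr_wpDl // addr_ge0.
have d0 : 0 < d by rewrite lt_min ltr01 divr_gt0.
have d1 : d <= 1 by rewrite ge_min lexx.
have de : d * (gauge (polar K) p + gauge K w + 1) <= e.
  by rewrite -ler_pdivlMr // ge_min lexx orbT.
have [|p' Pp' pE] := @gauge_lt _ p (gauge (polar K) p + d) bP; first by rewrite ltrDl.
have [|w' Kw' wE] := @gauge_lt _ w (gauge K w + d) bK; first by rewrite ltrDl.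
rewrite {1}pE {1}wE dot_scl dot_scr mulrA.
apply: (@le_trans _ _ ((gauge (polar K) p + d) * (gauge K w + d))).
  rewrite -[leRHS]mulr1 ler_wpM2l //; last exact: Pp'.
  by rewrite mulr_ge0 // addr_ge0 // ltW.
nra.
Qed.

Lemma continuous_dot p : continuous (dot p).
Proof.
move=> w; apply: cvgD; apply: cvgM; do ?exact: cvg_cst.
- exact: cvg_fst.
- exact: cvg_snd.
Qed.

(** The gauge of the polar is the support function of [K]. Compactness gives a maximizer of [dot p],
    and [p] divided by anything above the maximum belongs to the polar. *)
Lemma support_attained K p : convex_body2 K ->
  exists2 w, K w & dot p w = gauge (polar K) p.
Proof.
move=> bK; have bP := polar_body bK; have [cK _ _] := bK.
have [w Kw wmax] := @compact_EVT_max _ R (dot p) K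
  (ex_intro _ _ (body0 bK)) cK (continuous_subspaceT (@continuous_dot p)).
exists w; first exact: set_mem.
apply/eqP; rewrite eq_le; apply/andP; split.
  apply: (le_trans (dot_le_gauge p w bK)); rewrite -[leRHS]mulr1 ler_wpM2l ?gauge_ge0 //.
  by apply/gauge_le1 => //; exact: set_mem.
have dw0 : 0 <= dot p w.
  have := wmax (0, 0) (mem_set (body0 bK)).
  by rewrite {1}/dot /= !mulr0 addr0.
apply/ler_addgt0Pr => e e0; have r0 : 0 < dot p w + e by rewrite ltr_wpDl.
apply/gauge_leP => // uv Kuv; rewrite -/(dot (sc (dot p w + e)^-1 p) uv) dot_scl mulrC ler_pdivrMr // mul1r.
by have := wmax uv (mem_set Kuv); lra.
Qed.

End ConvexBody.

(** * Triangles *)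

Section Sector.
Context {R : realType}.
Implicit Types (K : set (R * R)) (p q w : R * R).
Local Notation leb2 := ((@lebesgue_measure R) \x (@lebesgue_measure R))%E.

Lemma sin_lip (a b : R) : `|sin a - sin b| <= `|a - b|.
Proof.
wlog ab : a b / b <= a.
  by move=> H; have [ab|/ltW ba] := leP b a; [exact: H|rewrite distrC (distrC a); exact: H].
have [c _ ->] := @MVT_segment R sin cos _ _ ab (fun x _ => is_derive_sin x)
  (continuous_subspaceT (@continuous_sin R)).
by rewrite normrM ler_piMl // ler_norml cos_geN1 cos_le1.
Qed.

Lemma cos_lip (a b : R) : `|cos a - cos b| <= `|a - b|.
Proof.
wlog ab : a b / b <= a.
  by move=> H; have [ab|/ltW ba] := leP b a; [exact: H|rewrite distrC (distrC a); exact: H].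
have [c _ ->] := @MVT_segment R cos (fun x => - sin x) _ _ ab (fun x _ => is_derive_cos x)
  (continuous_subspaceT (@continuous_cos R)).
by rewrite normrM ler_piMl // normrN ler_norml sin_geN1 sin_le1.
Qed.

Lemma cos_lb (d : R) : 0 <= d -> 1 - d <= cos d.
Proof.
by move=> d0; have := cos_lip d 0; rewrite cos0 subr0 (ger0_norm d0) ler_norml => /andP[? _]; lra.
Qed.

Lemma sin_ub (d : R) : 0 <= d -> sin d <= d.
Proof.
by move=> d0; have := sin_lip d 0; rewrite sin0 !subr0 (ger0_norm d0) ler_norml => /andP[].
Qed.

Lemma sin_lb (d : R) : 0 <= d -> d * (1 - d) <= sin d.
Proof.
move=> d0; have [c] := @MVT_segment R sin cos _ _ d0 (fun x _ => is_derive_sin x)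
  (continuous_subspaceT (@continuous_sin R)).
rewrite in_itv /= => /andP[c0 cd]; rewrite sin0 !subr0 => ->.
rewrite mulrC ler_wpM2r //; apply: (le_trans _ (cos_lb c0)); lra.
Qed.

Definition ev (a : R) : R * R := (cos a, sin a).

Lemma nrm_ev_ge1 a : 1 <= nrm (ev a).
Proof.
rewrite /nrm /=; have := cos2Dsin2 a; rewrite -(real_normK (num_real (cos a))) -(real_normK (num_real (sin a))).
have : `|cos a| <= 1 by rewrite ler_norml cos_geN1 cos_le1.
have : `|sin a| <= 1 by rewrite ler_norml sin_geN1 sin_le1.
have := normr_ge0 (cos a); have := normr_ge0 (sin a); nra.
Qed.

Lemma nrm_ev_le2 a : nrm (ev a) <= 2.
Proof.
rewrite /nrm /=.
have : `|cos a| <= 1 by rewrite ler_norml cos_geN1 cos_le1.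
have : `|sin a| <= 1 by rewrite ler_norml sin_geN1 sin_le1.
lra.
Qed.

Lemma nrm_ev_lip a b : nrm (sub2 (ev a) (ev b)) <= 2 * `|a - b|.
Proof. by rewrite /nrm /sub2 /=; have := cos_lip a b; have := sin_lip a b; lra. Qed.

Lemma polar_coord p : exists rho a : R, [/\ 0 <= rho, 0 <= a < 2 * pi & p = sc rho (ev a)].
Proof.
pose rho := Num.sqrt (p.1 ^+ 2 + p.2 ^+ 2).
have s0 : 0 <= p.1 ^+ 2 + p.2 ^+ 2 by rewrite addr_ge0 // sqr_ge0.
have rho2 : rho ^+ 2 = p.1 ^+ 2 + p.2 ^+ 2 by rewrite sqr_sqrtr.
have rho0 : 0 <= rho by exact: sqrtr_ge0.
have pi0 : 0 < pi :> R := pi_gt0 R.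
have [rE|rN] := eqVneq rho 0.
  exists 0, 0; split => //; first by rewrite lexx /=; lra.
  have [h1 h2] : p.1 = 0 /\ p.2 = 0.
    by move: rho2; rewrite rE expr0n /= => /esym/eqP; rewrite paddr_eq0 ?sqr_ge0 // !sqrf_eq0 => /andP[/eqP ? /eqP ?].
  by rewrite [p]surjective_pairing h1 h2 /sc !mul0r.
have rp : 0 < rho by rewrite lt_neqAle eq_sym rN.
pose c := p.1 / rho.
have c2 : c ^+ 2 <= 1 by rewrite /c expr_div_n ler_pdivrMr ?exprn_gt0 // mul1r rho2 lerDl sqr_ge0.
have cb : -1 <= c <= 1 by apply/andP; split; nra.
have c1 : rho * c = p.1 by rewrite /c mulrCA divff // mulr1.
have cK : cos (acos c) = c by apply: acosK; rewrite in_itv.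
have sK : rho * sin (acos c) = `|p.2|.
  have E : rho = Num.sqrt (rho ^+ 2) by rewrite sqrtr_sqr ger0_norm.
  rewrite sin_acos // [X in X * _]E -sqrtrM ?sqr_ge0 // -sqrtr_sqr; congr Num.sqrt; rewrite mulrBr mulr1 -exprMn c1 rho2; ring.
have [p20|p20] := leP 0 p.2.
  exists rho, (acos c); split => //.
    by rewrite acos_ge0 //= (le_lt_trans (acos_lepi cb)) //; lra.
  by rewrite /sc /= cK c1 sK ger0_norm // -surjective_pairing.
exists rho, (2 * pi - acos c); split => //.
  have s1 : 0 < acos c.
    rewrite lt_neqAle acos_ge0 // andbT; apply/eqP => a0.
    by move: sK; rewrite -a0 sin0 mulr0 => /esym/eqP; rewrite normr_eq0 => /eqP; lra.
  by have := acos_lepi cb => ?; apply/andP; split; lra.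
have E2 : (2 * pi : R) = pi *+ 2 by rewrite mulr2n; ring.
rewrite /sc /= addrC E2 cosD2pi sinD2pi cosN sinN mulrN cK c1 sK ltr0_norm // opprK.
by rewrite -surjective_pairing.
Qed.

Lemma cos_eq1_small (x : R) : `|x| < 2 * pi -> cos x = 1 -> x = 0.
Proof.
move=> xp cx; apply: contrapT => /eqP x0.
have : cos `|x| = 1 by rewrite cos_norm.
have y0 : 0 < `|x| by rewrite normr_gt0.
move: `|x| xp y0 => y yp y0.
have -> : y = (y / 2) *+ 2 by rewrite mulr2n; field.
rewrite cos_mulr2n => c1.
have : 0 < sin (y / 2) by apply: sin_gt0_pi; apply/andP; split; lra.
have := cos2Dsin2 (y / 2); nra.
Qed.

Lemma dot_ev a b : dot (ev a) (ev b) = cos (b - a).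
Proof. by rewrite /dot /= cosB; ring. Qed.

Lemma sc_ev_inj (r s a b : R) : 0 < r -> 0 <= s -> sc r (ev a) = sc s (ev b) -> cos (b - a) = 1.
Proof.
move=> r0 s0 E.
have H1 : dot (sc r (ev a)) (sc r (ev a)) = dot (sc s (ev b)) (sc s (ev b)) by rewrite E.
rewrite !dot_scl !dot_scr !dot_ev !subrr cos0 !mulr1 in H1.
have rs : r = s by nra.
have H2 : dot (sc r (ev a)) (sc r (ev a)) = dot (sc r (ev a)) (sc s (ev b)) by rewrite E.
rewrite !dot_scl !dot_scr !dot_ev subrr cos0 -rs mulr1 in H2.
by apply/esym; apply: (mulfI (lt0r_neq0 r0)); apply: (mulfI (lt0r_neq0 r0)); rewrite mulr1.
Qed.

Definition bounded2 K := exists M : R, forall p, K p -> nrm p <= M.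

Lemma bounded2_fin K : bounded2 K -> measurable K -> (leb2 K \is a fin_num)%E.
Proof.
move=> [M HM] mK; rewrite ge0_fin_numE //.
apply: (@le_lt_trans _ _ (leb2 (`[- M, M]%classic `*` `[- M, M]%classic))).
  apply: le_measure; rewrite ?inE //; first by apply: measurableX; exact: measurable_itv.
  move=> p /HM; rewrite /nrm => pM.
  have h1 : `|p.1| <= M by apply: le_trans pM; rewrite lerDl.
  have h2 : `|p.2| <= M by apply: le_trans pM; rewrite lerDr.
  by split; rewrite /= in_itv /= -ler_norml.
rewrite product_measure1E; [|exact: measurable_itv|exact: measurable_itv].
have h : (lebesgue_measure (`[(- M)%R, M]%classic : set R) < +oo)%E.
  by rewrite lebesgue_measure_itv /=; case: ifP => _; rewrite ?ltry.
by apply: lte_mul_pinfty => //; rewrite ge0_fin_numE.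
Qed.

Lemma areaE K : bounded2 K -> measurable K -> (area K)%:E = leb2 K.
Proof. by move=> bK mK; rewrite /area fineK //; exact: bounded2_fin. Qed.

Lemma area_ge0 K : 0 <= area K.
Proof. by rewrite /area fine_ge0. Qed.

Lemma bounded2S K K' : K `<=` K' -> bounded2 K' -> bounded2 K.
Proof. by move=> KK [M HM]; exists M => p /KK /HM. Qed.

Lemma area_le K K' : measurable K -> measurable K' -> bounded2 K' -> K `<=` K' -> area K <= area K'.
Proof.
move=> mK mK' bK' KK; rewrite -lee_fin !areaE //; last exact: bounded2S bK'.
by apply: le_measure; rewrite ?inE.
Qed.

Lemma area_disj K1 K2 K : measurable K1 -> measurable K2 -> measurable K -> bounded2 K ->
  K1 `<=` K -> K2 `<=` K -> K1 `&` K2 = set0 -> area K1 + area K2 <= area K.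
Proof.
move=> m1 m2 m b s1 s2 d; rewrite -lee_fin EFinD !areaE //; try exact: bounded2S b.
rewrite -measureU //; apply: le_measure; rewrite ?inE //; first exact: measurableU.
by rewrite subUset.
Qed.

Lemma area_cover K1 K2 K : measurable K1 -> measurable K2 -> measurable K -> bounded2 K1 -> bounded2 K2 ->
  K `<=` K1 `|` K2 -> area K <= area K1 + area K2.
Proof.
move=> m1 m2 m [M1 b1] [M2 b2] s; rewrite -lee_fin EFinD !areaE //; last 3 first.
- by exists M2.
- by exists M1.
- exists (Num.max M1 M2) => p /s[/b1|/b2] h; rewrite le_max h ?orbT //.
apply: (@le_trans _ _ (leb2 (K1 `|` K2))); last exact: measureU2.
by apply: le_measure; rewrite ?inE //; exact: measurableU.
Qed.

(** The right triangle with vertices 0, [(r, 0)] and [(r, k * r)]. With [b] true it is closed and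
    serves to cover a sector; with [b] false the two sides through 0 are removed, so that it is
    disjoint from the neighbouring sector. *)
Definition tri (b : bool) (r k : R) : set (R * R) :=
  [set p | 0 <= p.1 <= r /\ (if b then 0 <= p.2 <= k * p.1 else 0 < p.2 < k * p.1)].

Lemma tri_measurable b r k : measurable (tri b r k).
Proof.
have m1 : measurable_fun setT (fun p : R * R => p.1) by exact: measurable_fst.
have m2 : measurable_fun setT (fun p : R * R => p.2) by exact: measurable_snd.
have m3 : measurable_fun setT (fun p : R * R => k * p.1) by apply: measurable_funM => //; exact: measurable_cst.
have -> : tri b r k = (fun p : R * R => (0 <= p.1) && (p.1 <= r) &&
   (if b then (0 <= p.2) && (p.2 <= k * p.1) else (0 < p.2) && (p.2 < k * p.1))) @^-1` [set true].
  apply/seteqP; split => p /=; rewrite /tri /=.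
    by move=> [-> H]; case: b H => ->.
  by move=> /andP[-> H]; split => //; case: b H.
rewrite -[X in measurable X]setTI.
suff : measurable_fun setT (fun p : R * R => (0 <= p.1) && (p.1 <= r) &&
   (if b then (0 <= p.2) && (p.2 <= k * p.1) else (0 < p.2) && (p.2 < k * p.1))).
  by apply => //.
case: b; do ! apply: measurable_and; do ?[apply: measurable_fun_ler | apply: measurable_fun_ltr];
  by [|exact: measurable_cst].
Qed.

Lemma tri_bounded b r k : 0 <= k -> bounded2 (tri b r k).
Proof.
move=> k0; exists (r + k * r) => p [/andP[h1 h2] h3]; rewrite /nrm (ger0_norm h1).
have [h4 h5] : 0 <= p.2 /\ p.2 <= k * p.1.
  by case: b h3 => /andP[h4 h5]; split => //; exact: ltW.
rewrite (ger0_norm h4) lerD //; apply: (le_trans h5); exact: ler_wpM2l.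
Qed.

Lemma tri_leb2 b r k : 0 < r -> 0 <= k -> leb2 (tri b r k) = (k * r ^+ 2 / 2)%:E.
Proof.
move=> r0 k0; apply: leb2_triangle => // x.
  move=> xr; have -> : xsection (tri b r k) x = [set` Interval (BSide b 0) (BSide (~~ b) (k * x))].
    apply/seteqP; split => y; rewrite /xsection /= inE /tri /= in_itv /=.
      by case: b => -[_]; rewrite /= ?subr0.
    by case: b => H; split.
  have kx : 0 <= k * x by rewrite mulr_ge0 //; case/andP: xr.
  rewrite lebesgue_measure_itv /= lte_fin -EFinB subr0; case: ifP => // /negbT; rewrite -leNgt => H.
  by congr EFin; apply/eqP; rewrite eq_le kx H.
move=> /negP xr; apply/seteqP; split => // y; rewrite /xsection /= inE /tri /= => -[H _].
exact: xr.
Qed.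

Definition rtri b (a r k : R) := lin2 (cos a) (sin a) (- sin a) (cos a) @^-1` tri b r k.

Lemma rtri_measurable b a r k : measurable (rtri b a r k).
Proof. by apply: measurable_preimage_lin2; exact: tri_measurable. Qed.

Lemma rtri_bounded b a r k : 0 <= k -> bounded2 (rtri b a r k).
Proof.
move=> k0; have [M HM] := @tri_bounded b r k k0; exists (2 * M) => p /HM.
set q := lin2 _ _ _ _ p => qM.
have -> : p = lin2 (cos a) (- sin a) (sin a) (cos a) q.
  rewrite /q lin2_comp /lin2 [p]surjective_pairing /=; have := cos2Dsin2 a => E.
  by congr (_, _); rewrite -[LHS]mul1r -E; ring.
have c1 : `|cos a| <= 1 by rewrite ler_norml cos_geN1 cos_le1.
have s1 : `|sin a| <= 1 by rewrite ler_norml sin_geN1 sin_le1.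
move: qM; rewrite /nrm /lin2 /= => qM.
apply: (le_trans (lerD (ler_normD _ _) (ler_normD _ _))); rewrite !normrM normrN.
have := normr_ge0 q.1; have := normr_ge0 q.2; nra.
Qed.

Lemma rtri_area b a r k : 0 < r -> 0 <= k -> area (rtri b a r k) = k * r ^+ 2 / 2.
Proof.
move=> r0 k0; apply: EFin_inj; rewrite areaE; [|exact: rtri_bounded|exact: rtri_measurable].
rewrite leb2_lin2 ?tri_leb2 //; last exact: tri_measurable.
by rewrite mulrN opprK -!expr2 cos2Dsin2.
Qed.

Lemma lin2_rot_ev a (rho b : R) : lin2 (cos a) (sin a) (- sin a) (cos a) (sc rho (ev b)) = sc rho (ev (b - a)).
Proof. by rewrite /lin2 /sc /ev /= cosB sinB; congr (_, _); ring. Qed.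

Lemma rotlin_inj a p q : lin2 (cos a) (sin a) (- sin a) (cos a) p = lin2 (cos a) (sin a) (- sin a) (cos a) q -> p = q.
Proof.
rewrite /lin2 => -[E1 E2]; have E := cos2Dsin2 a.
have H1 : p.1 * (cos a ^+ 2 + sin a ^+ 2) = q.1 * (cos a ^+ 2 + sin a ^+ 2).
  transitivity (cos a * (cos a * p.1 + sin a * p.2) - sin a * (- sin a * p.1 + cos a * p.2)); first by ring.
  by rewrite E1 E2; ring.
have H2 : p.2 * (cos a ^+ 2 + sin a ^+ 2) = q.2 * (cos a ^+ 2 + sin a ^+ 2).
  transitivity (sin a * (cos a * p.1 + sin a * p.2) + cos a * (- sin a * p.1 + cos a * p.2)); first by ring.
  by rewrite E1 E2; ring.
by rewrite [p]surjective_pairing [q]surjective_pairing; rewrite E !mulr1 in H1 H2; rewrite H1 H2.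
Qed.

End Sector.

(** * Sector areas and convex trigonometry *)

Arguments lin2 : simpl never.

(* locked so that lra does not compare these atoms up to conversion *)
HB.lock Definition radial {R : realType} (K : set (R * R)) (a : R) : R := (gauge K (ev a))^-1.
HB.lock Definition twoS {R : realType} (K : set (R * R)) (a : R) : R := 2 * area (sector K a).
HB.lock Definition period {R : realType} (K : set (R * R)) : R := 2 * area K.

Section SectorArea.
Context {R : realType}.
Implicit Types (K : set (R * R)) (p q w : R * R).

Definition bpt K (a : R) : R * R := sc (radial K a) (ev a).

Lemma twoSE K a : twoS K a = 2 * area (sector K a).
Proof. by rewrite twoS.unlock. Qed.

Lemma radialE K a : radial K a = (gauge K (ev a))^-1.
Proof. by rewrite radial.unlock. Qed.

Lemma periodE K : period K = 2 * area K.
Proof. by rewrite period.unlock. Qed.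

Lemma gauge_ev_gt0 K a : convex_body2 K -> 0 < gauge K (ev a).
Proof.
move=> bK; have [M M0 HM] := gauge_lb bK.
have := HM (ev a); have := nrm_ev_ge1 a => h1 h2.
by rewrite -(pmulr_rgt0 _ M0); apply: (lt_le_trans ltr01); exact: le_trans h2.
Qed.

Lemma rad_gt0 K a : convex_body2 K -> 0 < radial K a.
Proof. by move=> bK; rewrite radialE invr_gt0; exact: gauge_ev_gt0. Qed.

Lemma rad_bounds K : convex_body2 K -> exists m M : R, [/\ 0 < m, m <= M & forall a, m <= radial K a <= M].
Proof.
move=> bK; have [M M0 HM] := gauge_lb bK; have [L L0 HL] := gauge_ub bK.
have H a : (L * 2)^-1 <= radial K a <= M.
  have g0 := gauge_ev_gt0 a bK; rewrite !radialE; apply/andP; split.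
    rewrite lef_pV2 ?posrE ?mulr_gt0 //; apply: (le_trans (HL _)).
    by rewrite ler_wpM2l ?nrm_ev_le2 // ltW.
  rewrite -[X in X <= _]mul1r ler_pdivrMr //.
  exact: le_trans (nrm_ev_ge1 a) (HM _).
exists (L * 2)^-1, M; split => //; first by rewrite invr_gt0 mulr_gt0.
by have /andP[h1 h2] := H 0; exact: le_trans h2.
Qed.

Lemma rad_lip K : convex_body2 K -> exists2 L : R, 0 < L & forall a b, `|radial K a - radial K b| <= L * `|a - b|.
Proof.
move=> bK; have [m [M [m0 mM Hm]]] := rad_bounds bK; have [L L0 HL] := gauge_lip bK.
have M0 : 0 < M by exact: lt_le_trans mM.
exists (M * M * (L * 2)); first by rewrite !mulr_gt0.
move=> a b; have ga := gauge_ev_gt0 a bK; have gb := gauge_ev_gt0 b bK.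
have -> : radial K a - radial K b = radial K a * radial K b * (gauge K (ev b) - gauge K (ev a)).
  by rewrite !radialE; field; rewrite !gt_eqF.
have /andP[a1 a2] := Hm a; have /andP[b1 b2] := Hm b.
have ra := rad_gt0 a bK; have rb := rad_gt0 b bK.
rewrite normrM (ger0_norm (mulr_ge0 (ltW ra) (ltW rb))) -mulrA.
apply: (@le_trans _ _ (M * (M * (L * (2 * `|a - b|))))); last by rewrite !mulrA.
apply: ler_pM => //; [exact: ltW|by rewrite mulr_ge0 // ltW|].
apply: ler_pM => //; first exact: ltW.
apply: (le_trans (HL _ _)); rewrite ler_wpM2l //; first exact: ltW.
by rewrite distrC; exact: nrm_ev_lip.
Qed.

Lemma body_ev K (r a : R) : convex_body2 K -> 0 <= r -> K (sc r (ev a)) <-> r <= radial K a.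
Proof.
move=> bK r0; rewrite -(gauge_le1 _ bK) gauge_sc // !radialE.
by rewrite -[X in _ <-> _ <= X]mul1r ler_pdivlMr ?gauge_ev_gt0.
Qed.

Lemma gauge_bpt K a : convex_body2 K -> gauge K (bpt K a) = 1.
Proof.
by move=> bK; rewrite gauge_sc ?(ltW (rad_gt0 _ _)) // radialE mulVf // gt_eqF // gauge_ev_gt0.
Qed.

Lemma sector_sub K a : sector K a `<=` K. Proof. by move=> p []. Qed.

Lemma sector_bounded K a : convex_body2 K -> bounded2 (sector K a).
Proof. by move=> /body_bounded[M _ HM]; exists M => p [/HM]. Qed.

Lemma body_bounded2 K : convex_body2 K -> bounded2 K.
Proof. by move=> /body_bounded[M _ HM]; exists M. Qed.

Lemma body_measurable K : convex_body2 K -> measurable K.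
Proof. by move=> bK; apply: closed_measurable2; exact: body_closed. Qed.

Lemma sector_measurable K a : convex_body2 K -> measurable (sector K a).
Proof.
move=> bK; have [M M0 HM] := body_bounded bK.
pose f (ra : R * R) : R * R := sc ra.1 (ev ra.2).
have cf : continuous f.
  move=> x.
  apply: (@cvg_pair _ _ _ (nbhs x) (nbhs (x.1 * cos x.2)) (nbhs (x.1 * sin x.2)) _ _ _
    (fun ra : R * R => ra.1 * cos ra.2) (fun ra => ra.1 * sin ra.2)).
    apply: cvgM; first exact: cvg_fst.
    by apply: continuous_comp; [exact: cvg_snd|exact: continuous_cos].
  apply: cvgM; first exact: cvg_fst.
  by apply: continuous_comp; [exact: cvg_snd|exact: continuous_sin].
have -> : sector K a = K `&` f @` (`[0, M]%classic `*` `[0, a]%classic).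
  apply/seteqP; split => p.
    move=> [Kp [r [b [r0 ba pE]]]]; split => //; exists (r, b) => //; split; rewrite /= in_itv //= r0 /=.
    have := HM p Kp; rewrite pE -/(ev b) -/(sc r (ev b)) nrm_sc (ger0_norm r0) => /(le_trans _); apply.
    by rewrite ler_peMr // nrm_ev_ge1.
  move=> [Kp [[r b] [/= ]]]; rewrite !in_itv /= => /andP[r0 _] ba pE; split => //.
  by exists r, b.
apply: measurableI; first exact: body_measurable.
apply: closed_measurable2; apply: compact_closed; first exact: (@norm_hausdorff _ (R * R)%type).
apply: continuous_compact; first exact: continuous_subspaceT.
by apply: compact_setX; exact: segment_compact.
Qed.

Lemma twoS_ge0 K a : 0 <= twoS K a.
Proof. by rewrite twoSE mulr_ge0 // area_ge0. Qed.

Lemma twoS_mono K a b : convex_body2 K -> a <= b -> twoS K a <= twoS K b.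
Proof.
move=> bK ab; rewrite !twoSE ler_pM2l //; apply: area_le; try exact: sector_measurable; first exact: sector_bounded.
move=> p [Kp [r [c [r0 /andP[c0 ca] pE]]]]; split => //; exists r, c; split => //.
by rewrite c0 (le_trans ca).
Qed.

Lemma twoS_le K a : convex_body2 K -> twoS K a <= period K.
Proof.
move=> bK; rewrite twoSE periodE ler_pM2l //; apply: area_le; [exact: sector_measurable|exact: body_measurable|
  exact: body_bounded2|exact: sector_sub].
Qed.

Lemma twoS_2pi K : convex_body2 K -> twoS K (2 * pi) = period K.
Proof.
move=> bK; rewrite twoSE periodE; congr (2 * area _); apply/seteqP; split; first exact: sector_sub.
move=> p Kp; split => //; have [r [a [r0 /andP[a0 a1] pE]]] := polar_coord p.
by exists r, a; split => //; rewrite a0 ltW.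
Qed.

(** The triangle has its leg [r * cos (b - a)] on the ray at angle [a] and its hypotenuse, of length
    [r], on the ray at angle [b]. Hence its points are at distance at most [r] from 0, and their
    angles lie strictly between [a] and [b]; as [b <= 2 * pi], no such point recurs in the sector up
    to [a]. *)
Lemma rtri_sector_lower K (a b r : R) : convex_body2 K -> 0 <= a -> a < b -> b <= 2 * pi -> b - a <= 1 ->
  0 < r -> (forall c, a <= c <= b -> r <= radial K c) ->
  rtri false a (r * cos (b - a)) (tan (b - a)) `<=` sector K b /\
  sector K a `&` rtri false a (r * cos (b - a)) (tan (b - a)) = set0.
Proof.
move=> bK a0 ab b2 d1 r0 Hr; set d := b - a.
have d0 : 0 < d by rewrite subr_gt0.
have pi1 := pihalf_ge1 R.
have dlt : d < pi / 2.
  rewrite lt_neqAle (le_trans d1 pi1) andbT; apply/eqP => dE.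
  have E1 : pi / 2 = 1 :> R by apply/eqP; rewrite eq_le pi1 andbT -dE.
  by have := cos1_gt0 R; rewrite -E1 cos_pihalf ltxx.
have cd : 0 < cos d by apply: cos_gt0_pihalf; apply/andP; split; lra.
have sd : 0 < sin d by apply: sin_gt0_pihalf; rewrite d0.
have td : 0 < tan d by rewrite /tan divr_gt0.
have key p : rtri false a (r * cos d) (tan d) p -> exists rho c, [/\ 0 < rho, a < c < b, rho <= r & p = sc rho (ev c)].
  pose q := lin2 (cos a) (sin a) (- sin a) (cos a) p.
  change (tri false (r * cos d) (tan d) q -> exists rho c, [/\ 0 < rho, a < c < b, rho <= r & p = sc rho (ev c)]) =>
    -[/andP[q1 q1r] /andP[q2 q2t]].
  have q1p : 0 < q.1 by rewrite -(pmulr_rgt0 _ td); exact: lt_trans q2t.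
  pose c := atan (q.2 / q.1).
  have tc : tan c = q.2 / q.1 by exact: atanK.
  have c1 : - (pi / 2) < c := atan_gtNpi2 _.
  have c2 : c < pi / 2 := atan_ltpi2 _.
  have cc : 0 < cos c by apply: cos_gt0_pihalf; rewrite c1.
  have c0 : 0 < c.
    have : tan 0 < tan c by rewrite tan0 tc divr_gt0.
    by rewrite ltr_tan // in_itv /= ?c1 //; apply/andP; split; lra.
  have cd' : c < d.
    have : tan c < tan d by rewrite tc ltr_pdivrMr.
    by rewrite ltr_tan // in_itv /= ?c1 //; apply/andP; split; lra.
  have qE : q = sc (q.1 / cos c) (ev c).
    rewrite [LHS]surjective_pairing /sc /= divfK ?gt_eqF //; congr (_, _).
    by rewrite mulrAC -mulrA -/(tan c) tc mulrCA divff ?gt_eqF // mulr1.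
  exists (q.1 / cos c), (a + c); split.
  - by rewrite divr_gt0.
  - by apply/andP; split; [lra|rewrite -(subrK a b) addrC ltrD2r].
  - rewrite ler_pdivrMr //; apply: (le_trans q1r); rewrite ler_wpM2l ?(ltW r0) //.
    by apply: ltW; rewrite ltr_cos // in_itv /=; apply/andP; split; lra.
  - apply: (rotlin_inj (a := a)); rewrite lin2_rot_ev -/q {1}qE; congr (sc _ (ev _)); ring.
split.
  move=> p /key[rho [c [rho0 /andP[ac cb] rr pE]]]; split.
    rewrite pE; apply/body_ev => //; first exact: ltW.
    by apply: (le_trans rr); apply: Hr; rewrite !ltW.
  by exists rho, c; split => //; [exact: ltW|rewrite (ltW cb) andbT (le_trans a0) // ltW].
apply/seteqP; split => // p [[_ [r' [c' [r'0 /andP[c'0 c'a] pE]]]] /key[rho [c [rho0 /andP[ac cb] rr pE']]]].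
have := @sc_ev_inj R rho r' c c' rho0 r'0; rewrite -pE' => /(_ pE) /cos_eq1_small.
have : `|c' - c| < 2 * pi by rewrite ltr_norml; apply/andP; split; lra.
by move=> H /(_ H); lra.
Qed.

Lemma twoS_lower K (a b r : R) : convex_body2 K -> 0 <= a -> a < b -> b <= 2 * pi -> b - a <= 1 ->
  0 < r -> (forall c, a <= c <= b -> r <= radial K c) ->
  twoS K a + r ^+ 2 * sin (b - a) * cos (b - a) <= twoS K b.
Proof.
move=> bK a0 ab b2 d1 r0 Hr; have [H1 H2] := rtri_sector_lower bK a0 ab b2 d1 r0 Hr.
set d := b - a in d1 H1 H2 *.
have d0 : 0 < d by rewrite subr_gt0.
have cd : 0 < cos d.
  have := cos1_gt0 R; move/lt_le_trans; apply; have pi2 := pi_ge2 R.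
  have [->|dN] := eqVneq d 1; first exact: lexx.
  by apply: ltW; rewrite ltr_cos ?in_itv /= ?lt_neqAle ?dN ?d1 //; apply/andP; split; lra.
have sd : 0 <= sin d by apply: sin_ge0_pi; have := pi_ge2 R; move=> ?; apply/andP; split; lra.
have td : 0 <= tan d by rewrite /tan divr_ge0 // ltW.
have rc : 0 < r * cos d by exact: mulr_gt0.
have := area_disj (sector_measurable a bK) (rtri_measurable false a (r * cos d) (tan d))
  (sector_measurable b bK) (sector_bounded b bK) _ H1 H2.
rewrite rtri_area // => /(_ _) H.
have {}H : area (sector K a) + tan d * (r * cos d) ^+ 2 / 2 <= area (sector K b).
  apply: H => p [Kp [r' [c [r'0 /andP[c0 ca] pE]]]]; split => //; exists r', c; split => //.
  by rewrite c0 (le_trans ca) // ltW.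
have E : tan d * (r * cos d) ^+ 2 = r ^+ 2 * sin d * cos d.
  by rewrite /tan; field; rewrite gt_eqF.
by rewrite !twoSE -E; move: H; clear; move: (area _) (area _) => X Y; lra.
Qed.

(** Here the leg of length [r] lies on the ray at angle [a]. The triangle sticks out of the disc of
    radius [r], so it covers what the sector gains between [a] and [b]. *)
Lemma twoS_upper K (a b r : R) : convex_body2 K -> 0 <= a -> a <= b -> b - a <= 1 ->
  0 < r -> (forall c, a <= c <= b -> radial K c <= r) ->
  twoS K b <= twoS K a + r ^+ 2 * tan (b - a).
Proof.
move=> bK a0 ab d1 r0 Hr.
set d := b - a in d1 *.
have d0 : 0 <= d by rewrite subr_ge0.
have pi2 := pi_ge2 R.
have cle (c : R) : 0 <= c <= 1 -> 0 < cos c.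
  move=> /andP[c0 c1]; have := cos1_gt0 R; move/lt_le_trans; apply.
  have [->|dN] := eqVneq c 1; first exact: lexx.
  by apply: ltW; rewrite ltr_cos ?in_itv /= ?lt_neqAle ?dN ?c1 //; apply/andP; split; lra.
have cd : 0 < cos d by apply: cle; rewrite d0.
have sd : 0 <= sin d by apply: sin_ge0_pi; apply/andP; split; lra.
have td : 0 <= tan d by rewrite /tan divr_ge0 // ltW.
have := area_cover (sector_measurable a bK) (rtri_measurable true a r (tan d))
  (sector_measurable b bK) (sector_bounded a bK) (rtri_bounded true a r td).
rewrite rtri_area // => H.
suff : area (sector K b) <= area (sector K a) + tan d * r ^+ 2 / 2 by rewrite !twoSE; clear; move: (area _) (area _) => X Y; lra.
apply: H => p [Kp [rho [c [rho0 /andP[c0 cb] pE]]]].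
have [ca|ac] := leP c a; first by left; split => //; exists rho, c; split => //; rewrite c0.
right; rewrite /rtri /= pE -/(ev c) -/(sc rho (ev c)) lin2_rot_ev /tri /=.
have e0 : 0 <= c - a by rewrite subr_ge0 ltW.
have e1 : c - a <= d by rewrite lerD2r.
have ce : 0 < cos (c - a) by apply: cle; apply/andP; split; lra.
have se : 0 <= sin (c - a) by apply: sin_ge0_pi; apply/andP; split; lra.
have rr : rho <= r.
  apply: le_trans (Hr c _); last by rewrite ltW.
  by apply/body_ev => //; rewrite pE in Kp.
split.
  rewrite mulr_ge0 ?(ltW ce) //= ; apply: le_trans rr; rewrite ler_piMr // cos_le1.
rewrite mulr_ge0 //= mulrCA ler_wpM2l // /tan mulrAC ler_pdivlMr //.
have : 0 <= sin (d - (c - a)) by apply: sin_ge0_pi; apply/andP; split; lra.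
by rewrite sinB; lra.
Qed.

(** The sector of angle 0 is a segment, which lies in arbitrarily thin triangles. *)
Lemma twoS0 K : convex_body2 K -> twoS K 0 = 0.
Proof.
move=> bK; have [m [M [m0 mM Hm]]] := rad_bounds bK.
have M0 : 0 < M by exact: lt_le_trans mM.
have pi2 := pi_ge2 R.
have := area_le (sector_measurable 0 bK).
move=> H; apply/eqP; rewrite eq_le twoS_ge0 andbT.
apply/ler_addgt0Pr => e e0; rewrite add0r.
pose k := e / M ^+ 2.
have k0 : 0 <= k by rewrite divr_ge0 ?sqr_ge0 ?(ltW e0).
have := H (rtri true 0 M k) (rtri_measurable true 0 M k) (rtri_bounded true 0 M k0).
rewrite rtri_area // /k divfK ?gt_eqF ?exprn_gt0 // => {}H.
suff : area (sector K 0) <= e / 2 by rewrite !twoSE; clear; move: (area _) => X; lra.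
apply: H => p [Kp [rho [c [rho0 /andP[c0 cb] pE]]]].
have {cb}cE : c = 0 by apply/eqP; rewrite eq_le cb c0.
rewrite /rtri /= pE -/(ev c) -/(sc rho (ev c)) lin2_rot_ev /tri /= cE subr0 sin0 cos0 mulr0 mulr1 lexx rho0 /=.
rewrite mulr_ge0 //; split => //; have /andP[_ h2] := Hm c; apply: le_trans h2.
by apply/body_ev => //; rewrite pE in Kp.
Qed.

End SectorArea.

(** * First-order expansion of the sector area *)

Section SectorAreaGrowth.
Context {R : realType}.
Implicit Types (K : set (R * R)) (p q w : R * R).

Lemma int_ltz0 (z : int) : z < 0 -> z%:~R <= -1 :> R.
Proof. by move=> z0; rewrite -[-1]/((-1)%:~R) ler_int; lia. Qed.

Lemma int_gtz1 (z : int) : 0 < z -> z != 1 -> 2%:~R <= z%:~R :> R.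
Proof. by move=> z0 z1; rewrite ler_int; lia. Qed.

Lemma int_small0 (z : int) : -1 < z%:~R :> R -> z%:~R < 1 :> R -> z = 0.
Proof. by rewrite -[1]/(1%:~R) -[-1]/((-1)%:~R) !ltr_int; lia. Qed.

Lemma cross_le_nrm p q : `|cross p q| <= nrm p * nrm q.
Proof.
rewrite /cross /nrm; apply: (le_trans (ler_normB _ _)); rewrite !normrM.
have := normr_ge0 p.1; have := normr_ge0 p.2; have := normr_ge0 q.1; have := normr_ge0 q.2; nra.
Qed.

Lemma nrm_bpt_ub K : convex_body2 K -> exists2 M : R, 0 < M & forall a : R, nrm (bpt K a) <= M.
Proof.
move=> bK; have [m [M [m0 mM Hm]]] := rad_bounds bK; have M0 : 0 < M by exact: lt_le_trans mM.
exists (M * 2); first by rewrite mulr_gt0.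
move=> a; have /andP[h1 h2] := Hm a; have r0 := rad_gt0 a bK.
rewrite nrm_sc (ger0_norm (ltW r0)); apply: ler_pM => //; [exact: ltW|exact: nrm_ge0|exact: nrm_ev_le2].
Qed.

Lemma sincos_lb (d : R) : 0 <= d <= 1 / 2 -> d * (1 - d) * (1 - d) <= sin d * cos d.
Proof.
move=> /andP[d0 d1]; have h : 0 <= 1 - d by lra.
by apply: ler_pM (sin_lb d0) (cos_lb d0) => //; rewrite mulr_ge0.
Qed.

(** The radial function varies by at most [L * d] over the sector, so inner and outer triangles with
    radii changed by that amount enclose the increment; [sin d * cos d] and [tan d] differ from [d]
    by a multiple of [d ^+ 2] for [d] at most 1/2. *)
Lemma twoS_asymp K : convex_body2 K -> exists2 C : R, 0 < C & forall a b : R, 0 <= a -> a <= b -> b <= 2 * pi ->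
  b - a <= 1 / 2 -> `|twoS K b - twoS K a - radial K a ^+ 2 * (b - a)| <= C * (b - a) ^+ 2.
Proof.
move=> bK; have [m [M [m0 mM Hm]]] := rad_bounds bK; have M0 : 0 < M by exact: lt_le_trans mM.
have [L L0 HL] := rad_lip bK.
exists (2 * M ^+ 2 + 4 * M * L + 2 * L ^+ 2).
  by rewrite !addr_gt0 ?mulr_gt0 ?exprn_gt0.
move=> a b a0; rewrite le_eqVlt => /orP[/eqP<- _ _|ab b2 d1].
  by rewrite !subrr mulr0 subrr normr0 expr0n mulr0.
set d := b - a in d1 *; have d0 : 0 < d by rewrite subr_gt0.
have d11 : b - a <= 1 by rewrite -/d; lra.
set r := radial K a; have /andP[r1 r2] : m <= r <= M by exact: Hm.
have Hc c : a <= c <= b -> r - L * d <= radial K c <= r + L * d.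
  move=> /andP[ac cb]; have := HL c a; rewrite (ger0_norm (x := c - a)) ?subr_ge0 // ler_norml => /andP[h1 h2].
  have : L * (c - a) <= L * d by rewrite ler_wpM2l ?(ltW L0) // lerD2r.
  by move=> h3; apply/andP; split; rewrite /r; lra.
have c1 := cos_lb (ltW d0); have s1 := sin_lb (ltW d0); have s2 := sin_ub (ltW d0).
have Ld : 0 < L * d by rewrite mulr_gt0.
have U := @twoS_upper R K a b (r + L * d) bK a0 (ltW ab) d11.
have {}U : twoS K b <= twoS K a + (r + L * d) ^+ 2 * tan d.
  by apply: U => [|c /Hc /andP[]//]; lra.
(* The maximum with [m] keeps the inner radius positive, as [twoS_lower] demands. *)
have Lw := @twoS_lower R K a b (Num.max (r - L * d) m) bK a0 ab b2 d11.
have {}Lw : twoS K a + (Num.max (r - L * d) m) ^+ 2 * sin d * cos d <= twoS K b.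
  apply: Lw => [|c /Hc /andP[h1 _]]; first by rewrite lt_max m0 orbT.
  by rewrite ge_max h1; have /andP[-> _] := Hm c.
have td : tan d <= d + 2 * d ^+ 2.
  rewrite /tan ler_pdivrMr; last lra.
  apply: (le_trans s2); apply: (@le_trans _ _ ((d + 2 * d ^+ 2) * (1 - d))); first nra.
  by rewrite ler_wpM2l // addr_ge0 ?mulr_ge0 ?exprn_ge0 // ltW.
have rmax : r ^+ 2 - 2 * r * (L * d) <= (Num.max (r - L * d) m) ^+ 2.
  have [h|h] := leP (r - L * d) m; last by nra.
  have [h'|h'] := leP 0 (r - L * d).
    apply: (@le_trans _ _ ((r - L * d) ^+ 2)); last by rewrite ler_sqr ?nnegrE // ltW.
    by have := sqr_ge0 (L * d); clear; lra.
  by apply: (@le_trans _ _ 0); [nra|rewrite exprn_ge0 // ltW].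
have sc1 : d * (1 - 2 * d) <= sin d * cos d.
  apply: (@le_trans _ _ (d * (1 - d) * (1 - d))); last by apply: sincos_lb; rewrite (ltW d0).
  by rewrite -mulrA; apply: ler_wpM2l; [exact: ltW|clear; nra].
set X := Num.max _ _ in Lw rmax.
have X0 : 0 <= X ^+ 2 by exact: sqr_ge0.
have Lw' : twoS K a + (r ^+ 2 - 2 * r * (L * d)) * (d * (1 - 2 * d)) <= twoS K b.
  apply: le_trans Lw; rewrite lerD2l.
  apply: (@le_trans _ _ (X ^+ 2 * (d * (1 - 2 * d)))).
    have dd : 0 <= d * (1 - 2 * d) by rewrite mulr_ge0 ?(ltW d0) //; lra.
    by rewrite ler_wpM2r.
  by rewrite -mulrA ler_wpM2l.
have U' : twoS K b <= twoS K a + (r + L * d) ^+ 2 * (d + 2 * d ^+ 2).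
  by apply: (le_trans U); rewrite lerD2l ler_wpM2l // sqr_ge0.
move: U' Lw'; set Fb := twoS K b; set Fa := twoS K a => U' Lw'.
rewrite ler_norml; clear U Lw td rmax sc1 X0 X HL Hm Hc; apply/andP; split.
  have : (r ^+ 2 - 2 * r * (L * d)) * (d * (1 - 2 * d)) = r ^+ 2 * d - d ^+ 2 * (2 * r ^+ 2 + 2 * r * L) + 4 * r * L * d ^+ 3 by ring.
  have : 0 <= 4 * r * L * d ^+ 3 by rewrite !mulr_ge0 ?exprn_ge0 ?ltW //; lra.
  have : d ^+ 2 * (2 * r ^+ 2 + 2 * r * L) <= d ^+ 2 * (2 * M ^+ 2 + 4 * M * L + 2 * L ^+ 2).
    by rewrite ler_wpM2l ?sqr_ge0 //; nra.
  by lra.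
have : (r + L * d) ^+ 2 * (d + 2 * d ^+ 2) = r ^+ 2 * d + d ^+ 2 * (2 * r ^+ 2 + (2 * r * L + L ^+ 2 * d) * (1 + 2 * d)) by ring.
have : d ^+ 2 * (2 * r ^+ 2 + (2 * r * L + L ^+ 2 * d) * (1 + 2 * d)) <= d ^+ 2 * (2 * M ^+ 2 + 4 * M * L + 2 * L ^+ 2).
  rewrite ler_wpM2l ?sqr_ge0 //.
  have : r ^+ 2 <= M ^+ 2 by rewrite ler_sqr ?nnegrE //; lra.
  have : r * L <= M * L by rewrite ler_wpM2r // ltW.
  have : (2 * r * L + L ^+ 2 * d) * (1 + 2 * d) <= (2 * r * L + L ^+ 2) * 2.
    have rL : 0 <= r * L by rewrite mulr_ge0 // ?ltW //; lra.
    have L2 : 0 <= L ^+ 2 by exact: sqr_ge0.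
    by apply: ler_pM; [nra|lra|nra|lra].
  by lra.
by lra.
Qed.

(** The lower bound makes the angle a Lipschitz function of the swept area, so estimates in terms of
    angles turn into estimates in terms of areas. *)
Lemma twoS_growth K : convex_body2 K -> exists2 c : R, 0 < c & forall a b : R, 0 <= a -> a <= b -> b <= 2 * pi ->
  c * (b - a) <= twoS K b - twoS K a.
Proof.
move=> bK; have [m [M [m0 mM Hm]]] := rad_bounds bK.
exists (m ^+ 2 / 64); first by rewrite divr_gt0 ?exprn_gt0.
move=> a b a0; rewrite le_eqVlt => /orP[/eqP<- _|ab b2]; first by rewrite !subrr mulr0.
(* Already the first sixteenth of the interval sweeps enough area. Since [2 * pi] is below 8, its
   length [d] is at most 1/2, and then [sin d * cos d] is at least [d / 4]; this gives the factor
   64. *)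
pose d := (b - a) / 16; have d0 : 0 < d by rewrite divr_gt0 // subr_gt0.
have pi4 := pihalf_lt2 R.
have d1 : d <= 1 / 2 by rewrite /d; lra.
have bE : b = a + 16 * d by rewrite /d; field.
have := @twoS_lower R K a (a + d) m bK a0.
rewrite ltrDl addrAC subrr add0r => /(_ d0) H.
have {}H : twoS K a + m ^+ 2 * sin d * cos d <= twoS K (a + d).
  by apply: H => //; [lra|lra|move=> c _; have /andP[] := Hm c].
have := twoS_mono bK (_ : a + d <= b); have -> : a + d <= b by lra.
move=> /(_ isT) H2.
have c1 := cos_lb (ltW d0); have s1 := sin_lb (ltW d0).
have : d / 4 <= sin d * cos d.
  apply: (@le_trans _ _ (d * (1 - d) * (1 - d))); last by apply: sincos_lb; rewrite (ltW d0).
  by rewrite -mulrA; apply: ler_wpM2l; [exact: ltW|clear - d1 d0; nra].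
have m2 : 0 < m ^+ 2 by rewrite exprn_gt0.
move=> sc; have := ler_wpM2l (ltW m2) sc.
have -> : m ^+ 2 / 64 * (b - a) = m ^+ 2 * (d / 4) by rewrite /d; field.
move=> h; rewrite lerBrDl; apply: le_trans H2; apply: le_trans H.
by rewrite lerD2l -mulrA.
Qed.

Lemma period_gt0 K : convex_body2 K -> 0 < period K.
Proof.
move=> bK; have [c c0 Hc] := twoS_growth bK; have pi0 := pi_gt0 R.
have := Hc 0 (2 * pi); rewrite twoS0 // twoS_2pi // lexx !subr0 => H.
have {}H : c * (2 * pi) <= period K by apply: H => //; lra.
have : 0 < c * (2 * pi) by rewrite !mulr_gt0.
lra.
Qed.

Lemma bpt_lip K : convex_body2 K -> exists2 C : R, 0 < C & forall a b : R, nrm (sub2 (bpt K a) (bpt K b)) <= C * `|a - b|.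
Proof.
move=> bK; have [m [M [m0 mM Hm]]] := rad_bounds bK; have M0 : 0 < M by exact: lt_le_trans mM.
have [L L0 HL] := rad_lip bK.
exists (L * 2 + M * 2); first by rewrite addr_gt0 ?mulr_gt0.
move=> a b.
have -> : sub2 (bpt K a) (bpt K b) = add2 (sc (radial K a - radial K b) (ev a)) (sc (radial K b) (sub2 (ev a) (ev b))).
  by rewrite /sub2 /add2 /sc /=; congr (_, _); ring.
have nrmD p q : nrm (add2 p q) <= nrm p + nrm q.
  by rewrite /nrm /=; have := ler_normD p.1 q.1; have := ler_normD p.2 q.2; lra.
apply: (le_trans (nrmD _ _)); rewrite !nrm_sc mulrDl; apply: lerD.
  rewrite mulrAC; apply: ler_pM => //; [exact: nrm_ge0|exact: nrm_ev_le2].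
rewrite -mulrA; apply: ler_pM => //; [exact: nrm_ge0| |exact: nrm_ev_lip].
by have /andP[_ h] := Hm b; rewrite ger0_norm // ltW // rad_gt0.
Qed.

Lemma bpt_twoS_lip K : convex_body2 K -> exists2 C : R, 0 < C & forall a b : R, 0 <= a -> a <= b -> b <= 2 * pi ->
  nrm (sub2 (bpt K a) (bpt K b)) <= C * (twoS K b - twoS K a).
Proof.
move=> bK; have [C C0 HC] := bpt_lip bK; have [c c0 Hc] := twoS_growth bK.
exists (C / c); first by rewrite divr_gt0.
move=> a b a0 ab b2; apply: (le_trans (HC _ _)).
rewrite distrC ger0_norm ?subr_ge0 // -mulrA ler_wpM2l ?(ltW C0) // mulrC ler_pdivlMr // mulrC.
exact: Hc.
Qed.

(** The triangle spanned by the two boundary points has twice-area [radial a * radial b * sin d],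
    which agrees with the doubled sector area to first order. *)
Lemma bpt_cross K : convex_body2 K -> exists2 C : R, 0 < C & forall a b : R, 0 <= a -> a <= b -> b <= 2 * pi ->
  `|cross (bpt K a) (bpt K b) - (twoS K b - twoS K a)| <= C * (twoS K b - twoS K a) ^+ 2.
Proof.
move=> bK; have [m [M [m0 mM Hm]]] := rad_bounds bK; have M0 : 0 < M by exact: lt_le_trans mM.
have [L L0 HL] := rad_lip bK; have [C1 C10 HC1] := twoS_asymp bK.
have [c c0 Hc] := twoS_growth bK; have [B B0 HB] := nrm_bpt_ub bK.
have S0 := period_gt0 bK.
(* [C2] serves angles at most 1/2 apart, where the expansion applies and [d] is at most [D / c].
   [C3] serves the others, where both quantities are bounded and [D] is at least [c / 2]. *)
pose C2 := (C1 + M * L + M ^+ 2) / c ^+ 2.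
pose C3 := (B * B + period K) / (c / 2) ^+ 2.
have C20 : 0 < C2 by rewrite divr_gt0 ?exprn_gt0 // !addr_gt0 ?mulr_gt0.
have C30 : 0 < C3 by rewrite divr_gt0 ?exprn_gt0 ?divr_gt0 // !addr_gt0 ?mulr_gt0.
exists (C2 + C3); first by rewrite addr_gt0.
move=> a b a0 ab b2; have G := Hc a b a0 ab b2.
set D := twoS K b - twoS K a in G *.
set d := b - a in G; have d0 : 0 <= d by rewrite subr_ge0.
have cd0 : 0 <= c * d by rewrite mulr_ge0 // ltW.
have [d1|/ltW d1] := leP d (1 / 2).
  have H1 := HC1 a b a0 ab b2 d1; rewrite -/D -/d in H1.
  apply: (@le_trans _ _ ((C1 + M * L + M ^+ 2) * d ^+ 2)); last first.
    have : d ^+ 2 <= D ^+ 2 / c ^+ 2.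
      rewrite ler_pdivlMr ?exprn_gt0 // -exprMn mulrC ler_sqr ?nnegrE //; lra.
    move=> h; apply: (@le_trans _ _ (C2 * D ^+ 2)).
      by rewrite /C2 mulrAC -mulrA ler_wpM2l // !addr_ge0 ?mulr_ge0 // ltW.
    by rewrite ler_wpM2r ?sqr_ge0 // lerDl ltW.
  have -> : cross (bpt K a) (bpt K b) = radial K a * radial K b * sin d.
    by rewrite /cross /bpt /= /d sinB; ring.
  have s1 := sin_lb d0; have s2 := sin_ub d0.
  have rab : `|radial K b - radial K a| <= L * d by have := HL b a; rewrite (ger0_norm (x := b - a)).
  have /andP[a1 a2] := Hm a; have ra := rad_gt0 a bK.
  have -> : radial K a * radial K b * sin d - D = radial K a * ((radial K b - radial K a) * sin d)
     - radial K a ^+ 2 * (d - sin d) - (D - radial K a ^+ 2 * d) by ring.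
  have e1 : `|radial K a * ((radial K b - radial K a) * sin d)| <= M * (L * d * d).
    rewrite normrM (ger0_norm (ltW ra)); apply: ler_pM => //; first exact: ltW.
    rewrite normrM; apply: ler_pM => //; rewrite ger0_norm //; nra.
  have e2 : `|radial K a ^+ 2 * (d - sin d)| <= M ^+ 2 * d ^+ 2.
    rewrite normrM; apply: ler_pM => //.
      by rewrite ger0_norm ?sqr_ge0 // ler_sqr ?nnegrE //; lra.
    by rewrite ger0_norm; nra.
  apply: (le_trans (ler_normB _ _)); apply: (le_trans (lerD (ler_normB _ _) H1)).
  have -> : (C1 + M * L + M ^+ 2) * d ^+ 2 = M * (L * d * d) + M ^+ 2 * d ^+ 2 + C1 * d ^+ 2 by ring.
  by lra.
have Dc : c / 2 <= D by nra.
have c2 : 0 < c / 2 by rewrite divr_gt0.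
apply: (@le_trans _ _ (C3 * D ^+ 2)); last by rewrite ler_wpM2r ?sqr_ge0 // lerDr ltW.
apply: (@le_trans _ _ (B * B + period K)).
  apply: (le_trans (ler_normB _ _)); apply: lerD.
    apply: (le_trans (cross_le_nrm _ _)); apply: ler_pM => //; exact: nrm_ge0.
  have D0 : 0 <= D by lra.
  by rewrite (ger0_norm D0) /D; have := twoS_le b bK; have := twoS_ge0 K a; lra.
rewrite /C3 mulrAC ler_pdivlMr ?exprn_gt0 // ler_wpM2l //.
  by rewrite addr_ge0 ?mulr_ge0 // ltW.
by rewrite ler_sqr ?nnegrE //; lra.
Qed.

Lemma twoS_surj K (th : R) : convex_body2 K -> 0 <= th <= period K ->
  exists2 a, 0 <= a <= 2 * pi & twoS K a = th.
Proof.
move=> bK /andP[th0 thS].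
have [m [M [m0 mM Hm]]] := rad_bounds bK; have [C C0 HC] := twoS_asymp bK.
have S0 := period_gt0 bK; have pi0 := pi_gt0 R.
have Pi0 : 0 <= 2 * pi :> R by lra.
(* [M ^+ 2 + C] handles increments of the angle up to 1/2; for longer ones the whole period is at
   most [2 * period K] times the increment. *)
pose L := M ^+ 2 + C + 2 * period K.
have L0 : 0 < L by have ? := sqr_ge0 M; rewrite /L; lra.
have lipF a b : 0 <= a -> a <= b -> b <= 2 * pi -> twoS K b - twoS K a <= L * (b - a).
  move=> a0 ab b2; have d0 : 0 <= b - a by rewrite subr_ge0.
  have [d1|/ltW d1] := leP (b - a) (1 / 2).
    have := HC a b a0 ab b2 d1; rewrite ler_norml => /andP[_ h].
    have /andP[r1 r2] := Hm a.
    have : radial K a ^+ 2 * (b - a) <= M ^+ 2 * (b - a) by rewrite ler_wpM2r // ler_sqr ?nnegrE //; lra.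
    have : C * (b - a) ^+ 2 <= C * (b - a) by rewrite ler_wpM2l ?(ltW C0) //; nra.
    have : 0 <= period K * (b - a) by rewrite mulr_ge0 // ltW.
    by rewrite /L; lra.
  have := twoS_le b bK; have := twoS_ge0 K a.
  have : period K <= 2 * period K * (b - a) by nra.
  have : 0 <= M ^+ 2 * (b - a) by rewrite mulr_ge0 // sqr_ge0.
  have : 0 <= C * (b - a) by rewrite mulr_ge0 // ltW.
  by rewrite /L; lra.
pose G a := twoS K (clamp (2 * pi) a).
have Gc : continuous G.
  apply: (@lipschitz_continuous R G L L0).
  have H s t : s <= t -> `|G s - G t| <= L * `|s - t|.
    move=> st; rewrite distrC (distrC s) /G.
    have /andP[s1 s2] := clamp_in s Pi0; have /andP[t1 t2] := clamp_in t Pi0.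
    have st' := clamp_mono (2 * pi) st.
    rewrite !ger0_norm ?subr_ge0 ?twoS_mono //.
    by apply: (le_trans (lipF _ _ s1 st' t2)); rewrite ler_wpM2l ?(ltW L0) // clamp_le.
  move=> s t; have [st|/ltW ts] := leP s t; first exact: H.
  by rewrite distrC (distrC s); exact: H.
have [||a] := @IVT R G 0 (2 * pi) th Pi0.
- exact: continuous_subspaceT.
- have G0 : G 0 = 0 by rewrite /G clamp_id ?twoS0 // /in0T lexx.
  have G2 : G (2 * pi) = period K by rewrite /G clamp_id ?twoS_2pi // /in0T lexx Pi0.
  by rewrite G0 G2 ge_min le_max th0 thS orbT.
rewrite in_itv /= => a2 <-; exists a; first exact: a2.
by rewrite /G clamp_id.
Qed.

End SectorAreaGrowth.

(** * The boundary parametrized by doubled sector area *)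

Section ConvexTrigonometricFunctions.
Context {R : realType}.
Implicit Types (K : set (R * R)) (p q w : R * R).

Definition trig K (th : R) : R * R := (cosO K th, sinO K th).

(** The point selected by [xget] comes with some angle of the right sector area; lying on the
    boundary then fixes its radius. *)
Lemma trigP_spec K (th : R) : convex_body2 K -> 0 <= th < period K ->
  exists a, [/\ 0 <= a < 2 * pi, twoS K a = th & trigP K th = bpt K a].
Proof.
move=> bK /andP[th0 thS]; have pi0 := pi_gt0 R.
rewrite /trigP; set A := [set p | _].
have [] : exists p, A p.
  have [|a /andP[a0 a2] aE] := @twoS_surj R K th bK; first by rewrite th0 ltW.
  exists (bpt K a); split; first by apply/boundary_gauge => //; exact: gauge_bpt.
  exists a, (radial K a); split => //; last by rewrite -aE twoSE; field.
    rewrite a0 lt_neqAle a2 andbT; apply/eqP => aP.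
    by move: thS; rewrite -aE aP twoS_2pi // ltxx.
  exact: rad_gt0.
move=> p Ap; have [Bp [a [r [a2 r0 pE aE]]]] := xgetI (0, 0) Ap.
exists a; split => //; first by rewrite twoSE aE; field.
set w := xget _ _ in pE Bp *.
have := (boundary_gauge w bK).1 Bp.
have wE : w = sc r (ev a) by exact: pE.
rewrite wE gauge_sc ?(ltW r0) // => rg; rewrite /bpt; congr sc.
have g0 := gauge_ev_gt0 a bK; rewrite radialE -[RHS]mul1r -rg mulfK // gt_eqF //.
Qed.

Lemma trig_rep K (th : R) : convex_body2 K -> exists (a : R) (k : int),
  [/\ 0 <= a < 2 * pi, th = twoS K a + period K * k%:~R & trig K th = bpt K a].
Proof.
move=> bK; have S0 := period_gt0 bK; have S20 := S0.
pose k := Num.floor (th / (period K)).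
have [|a [a2 aE tE]] := @trigP_spec K (trig_reduce K th) bK.
  have := floor_itv (th / (period K)); rewrite -/k => /andP[h1 h2].
  rewrite /trig_reduce -periodE -/k; rewrite ler_pdivlMr // in h1; rewrite ltr_pdivrMr // intrD mulrDl mul1r in h2.
  by apply/andP; split; lra.
exists a, k; split => //; first by rewrite aE /trig_reduce -periodE -/k subrK.
by rewrite /trig /cosO /sinO tE.
Qed.

Lemma twoS_inj K a b : convex_body2 K -> 0 <= a <= 2 * pi -> 0 <= b <= 2 * pi -> twoS K a = twoS K b -> a = b.
Proof.
move=> bK /andP[a0 a2] /andP[b0 b2] E; have [c c0 Hc] := twoS_growth bK.
apply/eqP; rewrite eq_le; apply/andP; split; rewrite leNgt; apply/negP => h.
  have := Hc b a b0 (ltW h) a2; rewrite E subrr.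
  by have ? : 0 < c * (a - b) by [rewrite mulr_gt0 // subr_gt0]; lra.
have := Hc a b a0 (ltW h) b2; rewrite E subrr.
by have ? : 0 < c * (b - a) by [rewrite mulr_gt0 // subr_gt0]; lra.
Qed.

Lemma trig_gauge K th : convex_body2 K -> gauge K (trig K th) = 1.
Proof. by move=> bK; have [a [k [_ _ ->]]] := trig_rep th bK; exact: gauge_bpt. Qed.

Lemma twoS_lt K (c : R) : convex_body2 K -> 0 <= c < 2 * pi -> twoS K c < period K.
Proof.
move=> bK /andP[c0 c2]; rewrite -twoS_2pi // lt_neqAle twoS_mono ?(ltW c2) // andbT.
apply/eqP => E; have c2' : 0 <= c <= 2 * pi by rewrite c0 ltW.
have pp : (0 : R) <= 2 * pi <= 2 * (pi : R) by rewrite (le_trans c0 (ltW c2)) lexx.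
by move: c2; rewrite (twoS_inj bK c2' pp E) ltxx.
Qed.

Lemma trig_surj K p : convex_body2 K -> gauge K p = 1 -> exists2 th : R, 0 <= th <= period K & trig K th = p.
Proof.
move=> bK g1; have [r [a [r0 /andP[a0 a2] pE]]] := polar_coord p.
have S0 := period_gt0 bK.
have rE : r = radial K a.
  have g0 := gauge_ev_gt0 a bK.
  by move: g1; rewrite pE gauge_sc // radialE => rg; rewrite -[RHS]mul1r -rg mulfK // gt_eqF.
exists (twoS K a); first by rewrite twoS_ge0 twoS_le.
have [b [k [/andP[b0 b2] E ->]]] := trig_rep (twoS K a) bK.
have k0 : k = 0.
  have h1 : twoS K a < period K by apply: twoS_lt; rewrite ?a0.
  have h2 : twoS K b < period K by apply: twoS_lt; rewrite ?b0.
  have h3 := twoS_ge0 K a; have h4 := twoS_ge0 K b.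
  have S20 := S0.
  have l1 : -1 < k%:~R :> R by rewrite -(ltr_pM2l S20); clear - E h1 h2 h3 h4; lra.
  have l2 : k%:~R < 1 :> R by rewrite -(ltr_pM2l S20); clear - E h1 h2 h3 h4; lra.
  exact: int_small0 l1 l2.
rewrite k0 mulr0 addr0 in E.
have a2' : 0 <= a <= 2 * pi by rewrite a0 ltW.
have b2' : 0 <= b <= 2 * pi by rewrite b0 ltW.
rewrite -(twoS_inj bK a2' b2' E).
by rewrite pE rE.
Qed.

Lemma bpt_2pi K : bpt K (2 * pi) = bpt K 0.
Proof.
have E2 : (2 * pi : R) = pi *+ 2 by rewrite mulr2n; ring.
by rewrite /bpt !radialE /ev E2 cos2pi sin2pi cos0 sin0.
Qed.

Lemma cross_anti p q : cross p q = - cross q p.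
Proof. by rewrite /cross; ring. Qed.

Lemma nrmB p q : nrm (sub2 p q) <= nrm p + nrm q.
Proof. by rewrite /nrm /=; have := ler_normB p.1 q.1; have := ler_normB p.2 q.2; lra. Qed.

Lemma nrm_trans p q w : nrm (sub2 p q) <= nrm (sub2 p w) + nrm (sub2 w q).
Proof.
rewrite /nrm /=; have := ler_normD (p.1 - w.1) (w.1 - q.1); have := ler_normD (p.2 - w.2) (w.2 - q.2).
by rewrite !subrKA; lra.
Qed.

Lemma nrm_subC p q : nrm (sub2 p q) = nrm (sub2 q p).
Proof. by rewrite /nrm /= distrC (distrC p.2). Qed.

(** Estimates before and after a common point [o] combine: the cross product is additive up to
    [cross (sub2 p o) (sub2 q o)], which is of second order. It is applied with [o] on the positive
    x-axis, where the angle jumps from [2 * pi] to 0. *)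
Lemma cross_glue p q o (C1 C2 x y : R) : 0 < C1 -> 0 < C2 -> 0 <= x -> 0 <= y ->
  nrm (sub2 p o) <= C1 * x -> nrm (sub2 o q) <= C1 * y ->
  `|cross p o - x| <= C2 * x ^+ 2 -> `|cross o q - y| <= C2 * y ^+ 2 ->
  nrm (sub2 p q) <= C1 * (x + y) /\ `|cross p q - (x + y)| <= (2 * C2 + C1 * C1) * (x + y) ^+ 2.
Proof.
move=> C10 C20 x0 y0 U1 U2 W1 W2; split.
  by apply: (le_trans (nrm_trans _ _ o)); rewrite mulrDr lerD.
have E : cross p q - (x + y) = (cross p o - x) + (cross o q - y) + cross (sub2 p o) (sub2 q o).
  by rewrite /cross /=; ring.
have W3 : `|cross (sub2 p o) (sub2 q o)| <= C1 * x * (C1 * y).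
  by apply: (le_trans (cross_le_nrm _ _)); apply: ler_pM; rewrite ?nrm_ge0 // nrm_subC.
rewrite E; apply: (le_trans (ler_normD _ _)).
apply: (le_trans (lerD (le_trans (ler_normD _ _) (lerD W1 W2)) W3)).
have xy0 : 0 <= x * y by exact: mulr_ge0.
have -> : C1 * x * (C1 * y) = C1 * C1 * (x * y) by ring.
rewrite mulrDl; apply: lerD.
  rewrite -mulrDr (mulrC 2) -mulrA ler_wpM2l ?(ltW C20) //.
  by have := sqr_ge0 x; have := sqr_ge0 y; rewrite sqrrD mulr2n; clear - xy0; lra.
rewrite ler_wpM2l ?mulr_ge0 ?(ltW C10) //.
by have := sqr_ge0 x; have := sqr_ge0 y; rewrite sqrrD mulr2n; clear - xy0; lra.
Qed.

(** When [d] is at least the period [S], boundedness alone gives both estimates. *)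
Lemma cross_far p q (B S d : R) : 0 < B -> 0 < S -> S <= d -> nrm p <= B -> nrm q <= B ->
  nrm (sub2 p q) <= 2 * B / S * d /\ `|cross p q - d| <= (B * B / S ^+ 2 + 1 / S) * d ^+ 2.
Proof.
move=> B0 S0 Sd pB qB; have d0 : 0 <= d by exact: le_trans (ltW S0) Sd.
split.
  apply: (le_trans (nrmB _ _)); apply: (le_trans (lerD pB qB)).
  have -> : B + B = 2 * B by ring.
  by rewrite mulrAC ler_pdivlMr // ler_wpM2l // mulr_ge0 // ltW.
apply: (le_trans (ler_normB _ _)); rewrite (ger0_norm d0) mulrDl; apply: lerD.
  apply: (@le_trans _ _ (B * B)).
    by apply: (le_trans (cross_le_nrm _ _)); apply: ler_pM; rewrite ?nrm_ge0.
  rewrite mulrAC ler_pdivlMr ?exprn_gt0 // ler_wpM2l ?mulr_ge0 ?(ltW B0) //.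
  by rewrite ler_sqr ?nnegrE // ltW.
by rewrite mulrAC mul1r ler_pdivlMr // expr2 ler_wpM2l.
Qed.

(** The difference [l - k] of the turn numbers decides. For 0 the estimates on a single turn apply,
    for 1 two of them are glued on the positive x-axis, and from 2 on the parameters differ by at
    least a period; negative values contradict [s <= t]. *)
Lemma trig_local K : convex_body2 K -> exists2 C : R, 0 < C & forall s t : R, s <= t ->
  nrm (sub2 (trig K s) (trig K t)) <= C * (t - s) /\
  `|cross (trig K s) (trig K t) - (t - s)| <= C * (t - s) ^+ 2.
Proof.
move=> bK; have S0 : 0 < period K by exact: period_gt0.
have pi0 : 0 <= 2 * pi :> R by rewrite mulr_ge0 // pi_ge0.
have [C1 C10 HC1] := bpt_twoS_lip bK; have [C2 C20 HC2] := bpt_cross bK.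
have [B B0 HB] := nrm_bpt_ub bK.
pose S := period K.
pose D1 := 2 * B / S; pose D2 := B * B / S ^+ 2 + 1 / S; pose D3 := 2 * C2 + C1 * C1.
have D10 : 0 < D1 by rewrite divr_gt0 // mulr_gt0.
have D20 : 0 < D2 by rewrite addr_gt0 ?divr_gt0 ?mulr_gt0 ?exprn_gt0.
have D30 : 0 < D3 by rewrite addr_gt0 ?mulr_gt0.
pose C := C1 + C2 + D1 + D2 + D3.
have [CC1 [CC2 [CD1 [CD2 CD3]]]] : C1 <= C /\ C2 <= C /\ D1 <= C /\ D2 <= C /\ D3 <= C.
  by rewrite /C; clear - C10 C20 D10 D20 D30; move: D1 D2 D3 D10 D20 D30 => *; do ! split; lra.
have C0 : 0 < C by exact: lt_le_trans CC1.
clearbody C.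
exists C => // s t st; have d0 : 0 <= t - s by rewrite subr_ge0.
have wk (c1 c2 : R) p q : c1 <= C -> c2 <= C ->
  nrm (sub2 p q) <= c1 * (t - s) /\ `|cross p q - (t - s)| <= c2 * (t - s) ^+ 2 ->
  nrm (sub2 p q) <= C * (t - s) /\ `|cross p q - (t - s)| <= C * (t - s) ^+ 2.
  move=> h1 h2 [h3 h4]; split; first by apply: (le_trans h3); rewrite ler_wpM2r.
  by apply: (le_trans h4); rewrite ler_wpM2r // sqr_ge0.
have [a [k [a2 sE ->]]] := trig_rep s bK; have [b [l [b2 tE ->]]] := trig_rep t bK.
have fa := twoS_lt bK a2; have fb := twoS_lt bK b2.
move: a2 b2 => /andP[a0 /ltW a2] /andP[b0 /ltW b2].
have fa0 := twoS_ge0 K a; have fb0 := twoS_ge0 K b; rewrite -/S in S0 sE tE fa fb.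
have tsE : t - s = twoS K b - twoS K a + S * (l - k)%:~R.
  by rewrite tE sE intrD rmorphN /=; ring.
have [lk|lk|lk] := ltgtP (l - k) 0.
- have h := @int_ltz0 R _ lk; have := ler_wpM2l (ltW S0) h; lra.
- have [l1|l1] := eqVneq (l - k) 1.
    have {}tsE : t - s = (S - twoS K a) + twoS K b by rewrite tsE l1 mulr1; ring.
    have A1 : 0 <= S - twoS K a by rewrite subr_ge0 ltW.
    have U1 := HC1 a (2 * pi) a0 a2 (lexx _).
    have U2 := HC1 0 b (lexx _) b0 b2.
    have W1 := HC2 a (2 * pi) a0 a2 (lexx _).
    have W2 := HC2 0 b (lexx _) b0 b2.
    rewrite twoS_2pi // -/S bpt_2pi in U1 W1; rewrite twoS0 // subr0 in U2 W2.
    apply: (wk C1 D3) => //; rewrite tsE.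
    exact: cross_glue U1 U2 W1 W2.
  have l2 := @int_gtz1 R _ lk l1.
  apply: (wk D1 D2) => //; apply: cross_far => //.
  by have := ler_wpM2l (ltW S0) l2; lra.
rewrite lk mulr0 addr0 in tsE.
have ab : a <= b.
  rewrite leNgt; apply/negP => ba.
  have h := twoS_mono bK (ltW ba).
  have E : twoS K a = twoS K b by lra.
  have a2' : (0 : R) <= a <= 2 * pi by rewrite a0.
  have b2' : (0 : R) <= b <= 2 * pi by rewrite b0.
  by move: ba; rewrite (twoS_inj bK a2' b2' E) ltxx.
have U := HC1 a b a0 ab b2; have W := HC2 a b a0 ab b2.
by apply: (wk C1 C2) => //; rewrite tsE.
Qed.

Lemma trig_lip K : convex_body2 K -> exists2 L : R, 0 < L & forall s t : R,
  nrm (sub2 (trig K s) (trig K t)) <= L * `|s - t|.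
Proof.
move=> bK; have [C C0 HC] := trig_local bK; exists C => // s t.
have [st|/ltW ts] := leP s t.
  by rewrite distrC ger0_norm ?subr_ge0 //; have [] := HC s t st.
rewrite ger0_norm ?subr_ge0 //; have [h _] := HC t s ts; apply: le_trans h.
by rewrite /nrm /= distrC (distrC (trig K s).2).
Qed.

Lemma trig_cross K : convex_body2 K -> exists2 C : R, 0 < C & forall s t : R,
  `|cross (trig K s) (trig K t) - (t - s)| <= C * (t - s) ^+ 2.
Proof.
move=> bK; have [C C0 HC] := trig_local bK; exists C => // s t.
have [st|/ltW ts] := leP s t; first by have [] := HC s t st.
have [_ h] := HC t s ts; rewrite -(sqrrN (t - s)) opprB; apply: le_trans h.
by rewrite (cross_anti (trig K s)) -normrN opprD opprK opprB.
Qed.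

End ConvexTrigonometricFunctions.

(** * Measurable choice of the angle of a boundary point *)

Section BorelSection.
Context {R : realType}.
Implicit Types (K : set (R * R)) (p q w : R * R).

Lemma cosO_lip K : convex_body2 K -> exists2 L : R, 0 < L & forall s t : R, `|cosO K s - cosO K t| <= L * `|s - t|.
Proof.
move=> /trig_lip[L L0 HL]; exists L => // s t; apply: le_trans (HL s t).
by rewrite /nrm lerDl.
Qed.

Lemma sinO_lip K : convex_body2 K -> exists2 L : R, 0 < L & forall s t : R, `|sinO K s - sinO K t| <= L * `|s - t|.
Proof.
move=> /trig_lip[L L0 HL]; exists L => // s t; apply: le_trans (HL s t).
by rewrite /nrm lerDr.
Qed.

Lemma measurable_cosO K : convex_body2 K -> measurable_fun setT (cosO K : R -> R).
Proof. by move=> /cosO_lip[L L0 HL]; apply: continuous_measurable_fun; exact: lipschitz_continuous HL. Qed.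

Lemma measurable_sinO K : convex_body2 K -> measurable_fun setT (sinO K : R -> R).
Proof. by move=> /sinO_lip[L L0 HL]; apply: continuous_measurable_fun; exact: lipschitz_continuous HL. Qed.

Lemma trig_continuous K : convex_body2 K -> continuous (trig K).
Proof.
move=> bK th; have [L L0 HL] := cosO_lip bK; have [L' L'0 HL'] := sinO_lip bK.
apply: (@cvg_pair _ _ _ (nbhs th) (nbhs (cosO K th)) (nbhs (sinO K th)) _ _ _ (cosO K) (sinO K)).
  exact: (lipschitz_continuous L0 HL).
exact: (lipschitz_continuous L'0 HL').
Qed.

(* a Borel right inverse of [trig K] on the boundary of K *)
Definition trig_angle K p : R := inf [set th : R | 0 <= th <= period K /\ trig K th = p].

Lemma trig_angle_ge0 K p : 0 <= trig_angle K p.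
Proof. rewrite /trig_angle; set A := [set th | _]; have [->|A0] := eqVneq A set0; first by rewrite inf0.
by apply: lb_le_inf; [exact/set0P|move=> th [/andP[]]]. Qed.

Lemma trig_angle_le K th : 0 <= th <= period K -> trig_angle K (trig K th) <= th.
Proof. by move=> h; apply: ge_inf; [exists 0 => x [/andP[]]|]. Qed.

(** The infimum is attained, since [trig K] is continuous. *)
Lemma trig_angleK K p : convex_body2 K -> gauge K p = 1 -> trig K (trig_angle K p) = p.
Proof.
move=> bK /(trig_surj bK)[th0 th0S th0E]; have [L L0 HL] := trig_lip bK.
set a := trig_angle K p.
have H (e : R) : 0 < e -> nrm (sub2 (trig K a) p) <= e.
  move=> e0; have eL : 0 < e / L by rewrite divr_gt0.
  have [|th [thS thE] tha] := @inf_adherent _ [set th : R | 0 <= th <= period K /\ trig K th = p] _ eL.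
    by split; [exists th0|exists 0 => x [/andP[]]].
  have ath : a <= th by rewrite /a -thE; exact: trig_angle_le.
  rewrite -/(trig_angle K p) -/a in tha; rewrite -thE; apply: (le_trans (HL _ _)).
  by rewrite distrC ger0_norm ?subr_ge0 // mulrC -ler_pdivlMr // lerBlDl ltW.
have : nrm (sub2 (trig K a) p) <= 0 by apply/ler_addgt0Pr => e e0; rewrite add0r; exact: H.
rewrite /nrm /= => h; have := normr_ge0 ((trig K a).1 - p.1); have := normr_ge0 ((trig K a).2 - p.2) => h2 h1.
rewrite [LHS]surjective_pairing [RHS]surjective_pairing; congr (_, _); apply/eqP; rewrite -subr_eq0 -normr_le0.
  by clear - h h1 h2; lra.
by clear - h h1 h2; lra.
Qed.

(** Because the least angle is chosen, the points with angle at most [x] form the image of a compact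
    interval, up to the points off the boundary. *)
Lemma measurable_trig_angle K : convex_body2 K -> measurable_fun setT (trig_angle K).
Proof.
move=> bK; have S0 := period_gt0 bK.
have mI (x : R) : measurable (trig K @` `[0, x]%classic).
  apply: closed_measurable2; apply: compact_closed; first exact: (@norm_hausdorff _ (R * R)%type).
  apply: continuous_compact; last exact: segment_compact.
  by apply: continuous_subspaceT; exact: trig_continuous.
move=> _; apply: (measurability _ (RGenOInfty.measurableE R)) => //.
move=> _ [_ [x ->] <-]; rewrite setTI.
have [x0|x0] := ltP x 0.
  suff -> : trig_angle K @^-1` `]x, +oo[%classic = setT by [].
  by apply/seteqP; split => // p _; rewrite /= in_itv /= andbT; exact: lt_le_trans (trig_angle_ge0 _ _).
(* Off the boundary the set of angles is empty and its infimum is 0, so for [x >= 0] a larger value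
   occurs on the boundary only. *)
suff -> : trig_angle K @^-1` `]x, +oo[%classic = (trig K @` `[0, period K]%classic) `\` (trig K @` `[0, Num.min x (period K)]%classic).
  exact: measurableD.
apply/seteqP; split => p /=; rewrite in_itv /= andbT.
  move=> xp; have [[th thS thE]|np] := pselect ((trig K @` `[0, period K]%classic) p); last first.
    move: xp; rewrite /trig_angle (_ : [set th | _] = set0) ?inf0 1?ltNge ?x0 //.
    by rewrite -subset0 => th [h hE]; apply: np; exists th.
  split; first by exists th.
  move=> [th']; rewrite /= in_itv /= le_min => /andP[t0 /andP[tx tS]] tE.
  have := @trig_angle_le K th'; rewrite t0 tS tE => /(_ isT) h.
  by have := lt_le_trans xp (le_trans h tx); rewrite ltxx.
move=> [[th thS thE] np]; rewrite ltNge; apply/negP => px; apply: np.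
have gp : gauge K p = 1 by rewrite -thE; exact: trig_gauge.
exists (trig_angle K p); last exact: trig_angleK.
rewrite /= in_itv /= trig_angle_ge0 le_min px /=; apply: le_trans (_ : th <= _); last by move: thS; rewrite /= in_itv => /andP[].
by rewrite -thE; apply: trig_angle_le.
Qed.

Lemma trig_dualE K (a b : R) : trig_dual K a b <-> dot (trig K a) (trig (polar K) b) = 1.
Proof. by []. Qed.

End BorelSection.

(** * Curves with prescribed areal velocity *)

Section LipschitzCalculus.
Context {R : realType}.
Implicit Types (f g : R -> R) (T t s : R).

Lemma lipschitz_bounded T f : lipschitz0T T f -> exists2 M : R, 0 < M & forall t, in0T T t -> `|f t| <= M.
Proof.
move=> /lipschitz_pos[L L0 HL]; exists (`|f 0| + L * `|T| + 1).
  by have ? := normr_ge0 (f 0); have ? : 0 <= L * `|T| by [rewrite mulr_ge0 // ltW]; lra.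
move=> t /andP[t0 tT]; have := HL t 0; rewrite /in0T t0 tT lexx (le_trans t0 tT) subr0 => /(_ isT isT) H.
have : L * `|t| <= L * `|T| by rewrite ler_wpM2l ?(ltW L0) // !ger0_norm // (le_trans t0).
have := ler_normD (f t - f 0) (f 0); rewrite subrK; lra.
Qed.

Lemma lipschitzD T f g : lipschitz0T T f -> lipschitz0T T g -> lipschitz0T T (fun t => f t + g t).
Proof.
move=> [L HL] [L' HL']; exists (L + L') => s t hs ht.
have -> : f s + g s - (f t + g t) = (f s - f t) + (g s - g t) by ring.
by apply: (le_trans (ler_normD _ _)); rewrite mulrDl lerD ?HL ?HL'.
Qed.

Lemma lipschitz_cst T (a : R) : lipschitz0T T (fun=> a).
Proof. by exists 0 => s t _ _; rewrite subrr normr0 mul0r. Qed.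

Lemma lipschitz0T_id T : lipschitz0T T (fun t : R => t).
Proof. by exists 1 => s t _ _; rewrite mul1r. Qed.

Lemma lipschitzM T f g : lipschitz0T T f -> lipschitz0T T g -> lipschitz0T T (fun t => f t * g t).
Proof.
move=> lf lg; have [M M0 HM] := lipschitz_bounded lf; have [N N0 HN] := lipschitz_bounded lg.
have [L L0 HL] := lipschitz_pos lf; have [L' L'0 HL'] := lipschitz_pos lg.
exists (L * N + M * L') => s t hs ht.
have -> : f s * g s - f t * g t = (f s - f t) * g s + f t * (g s - g t) by ring.
apply: (le_trans (ler_normD _ _)); rewrite !normrM mulrDl; apply: lerD.
  by rewrite mulrAC ler_pM ?HL ?HN.
by rewrite -mulrA ler_pM ?HM ?HL'.
Qed.

Lemma lipschitzZ T (a : R) f : lipschitz0T T f -> lipschitz0T T (fun t => a * f t).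
Proof. by apply: lipschitzM; exact: lipschitz_cst. Qed.

Lemma lipschitzB T f g : lipschitz0T T f -> lipschitz0T T g -> lipschitz0T T (fun t => f t - g t).
Proof.
move=> lf lg; have [L HL] := lipschitzD lf (lipschitzZ (-1) lg); exists L => s t hs ht.
by have := HL s t hs ht; rewrite !mulN1r.
Qed.

Lemma lipschitz_sum T (I : Type) (r : seq I) (P : pred I) (F : I -> R -> R) :
  (forall i, lipschitz0T T (F i)) -> lipschitz0T T (fun t => \sum_(i <- r | P i) F i t).
Proof.
move=> H; elim: r => [|i r IH].
  by have [L HL] := lipschitz_cst T 0; exists L => s t hs ht; rewrite !big_nil; exact: HL.
have [L HL] : lipschitz0T T (fun t => if P i then F i t + \sum_(j <- r | P j) F j t else \sum_(j <- r | P j) F j t).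
  by case: (P i) => //; exact: lipschitzD.
by exists L => s t hs ht; rewrite !big_cons; exact: HL.
Qed.

Lemma lipschitzV T f (m : R) : 0 < m -> (forall t, in0T T t -> m <= f t) ->
  lipschitz0T T f -> lipschitz0T T (fun t => (f t)^-1).
Proof.
move=> m0 Hm /lipschitz_pos[L L0 HL]; exists (m^-1 * m^-1 * L) => s t hs ht.
have fs : 0 < f s by exact: lt_le_trans (Hm s hs).
have ft : 0 < f t by exact: lt_le_trans (Hm t ht).
have -> : (f s)^-1 - (f t)^-1 = (f s)^-1 * (f t)^-1 * (f t - f s) by field; rewrite !gt_eqF.
rewrite normrM (distrC (f t)) -[X in _ <= X]mulrA; apply: ler_pM => //; last exact: HL.
rewrite normrM.
by rewrite !ger0_norm ?invr_ge0 ?(ltW fs) ?(ltW ft) // ler_pM ?invr_ge0 ?(ltW fs) ?(ltW ft) // lef_pV2 ?posrE // Hm.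
Qed.

Lemma lipschitz_sqrt T f (m : R) : 0 < m -> (forall t, in0T T t -> m ^+ 2 <= f t) ->
  lipschitz0T T f -> lipschitz0T T (fun t => Num.sqrt (f t)).
Proof.
move=> m0 Hm /lipschitz_pos[L L0 HL]; exists (L / m) => s t hs ht.
have H r : in0T T r -> 0 <= f r /\ m <= Num.sqrt (f r).
  move=> hr; have h := Hm r hr; have f0 : 0 <= f r := le_trans (sqr_ge0 m) h.
  by split => //; rewrite -(ger0_norm (ltW m0)) -sqrtr_sqr ler_wsqrtr.
have [fs ms] := H s hs; have [ft mt] := H t ht.
have E : f s - f t = (Num.sqrt (f s) - Num.sqrt (f t)) * (Num.sqrt (f s) + Num.sqrt (f t)).
  by rewrite -{1}(sqr_sqrtr fs) -{1}(sqr_sqrtr ft); ring.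
have := HL s t hs ht; rewrite E normrM (ger0_norm (addr_ge0 (sqrtr_ge0 _) (sqrtr_ge0 _))) => h.
rewrite mulrAC ler_pdivlMr //; apply: le_trans h; rewrite ler_wpM2l //.
by have := sqrtr_ge0 (f t); lra.
Qed.

Lemma lipschitz_comp T f g (L : R) : 0 < L -> (forall s t, `|g s - g t| <= L * `|s - t|) ->
  lipschitz0T T f -> lipschitz0T T (fun t => g (f t)).
Proof.
move=> L0 HL [M HM]; exists (L * M) => s t hs ht; apply: (le_trans (HL _ _)).
by rewrite -mulrA ler_wpM2l ?(ltW L0) // HM.
Qed.

Lemma lipschitz_expNM T (C : R) : 0 <= C -> lipschitz0T T (fun t => expR (- (C * t))).
Proof.
move=> C0; exists C.
have H s t : 0 <= s -> s <= t -> `|expR (- (C * s)) - expR (- (C * t))| <= C * `|s - t|.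
  move=> s0 st.
  have -> : expR (- (C * s)) - expR (- (C * t)) = expR (- (C * s)) * (1 - expR (- (C * (t - s)))).
    by rewrite mulrBr mulr1 -expRD; congr (_ - expR _); ring.
  have h1 : expR (- (C * s)) <= 1 by rewrite expR_le1 oppr_le0 mulr_ge0.
  have h0 := expR_ge0 (- (C * s)).
  have h2 := expR_ge1Dx (- (C * (t - s))).
  have h3 : expR (- (C * (t - s))) <= 1 by rewrite expR_le1 oppr_le0 mulr_ge0 // subr_ge0.
  rewrite distrC (ger0_norm (x := t - s)) ?subr_ge0 // ger0_norm ?mulr_ge0 ?subr_ge0 //.
  rewrite -[X in _ <= X]mul1r; apply: ler_pM => //; first by rewrite subr_ge0.
  by lra.
move=> s t /andP[s0 _] /andP[t0 _]; have [st|/ltW ts] := leP s t; first exact: H.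
by rewrite distrC (distrC s); exact: H.
Qed.

Lemma gronwall_eq0 T g (C : R) : 0 <= C -> lipschitz0T T g -> (forall t, in0T T t -> 0 <= g t) ->
  ae0T T (fun t => exists2 d : R, is_derive t 1 g d & d <= C * g t) -> g 0 = 0 ->
  forall t, in0T T t -> g t = 0.
Proof.
move=> C0 lg g0 dg g00 t tT; have /andP[t0 tT'] := tT.
pose G s := g s * expR (- (C * s)).
have : G t <= G 0.
  apply: abscont_nonincr => //.
    by apply: (abscontS tT'); apply: lipschitz_abscont; apply: lipschitzM => //; exact: lipschitz_expNM.
  apply: (ae0TS tT'); apply: ae0T_imp dg => s sT [d dgs dC].
  have dE : is_derive s 1 (fun r : R => expR (- (C * r))) (- C * expR (- (C * s))).
    have h : is_derive s 1 (fun r : R => - (C * r)) (- C).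
      by have := derZ (- C) (der_id s); rewrite mulr1; under eq_fun do rewrite mulNr.
    by apply: derE (@is_derive1_comp _ expR (fun r : R => - (C * r)) s _ _ (is_derive_expR _) h) _; rewrite mulrC.
  exists (d * expR (- (C * s)) + g s * (- C * expR (- (C * s)))); first exact: derM.
  have -> : d * expR (- (C * s)) + g s * (- C * expR (- (C * s))) = (d - C * g s) * expR (- (C * s)) by ring.
  by rewrite mulr_le0_ge0 ?expR_ge0 // subr_le0.
rewrite /G g00 mul0r pmulr_lle0 ?expR_gt0 // => h.
by apply/eqP; rewrite eq_le h g0.
Qed.

End LipschitzCalculus.

Section AreaLawUniqueness.
Context {R : realType}.
Implicit Types (K : set (R * R)) (T t s : R).

Definition elen (c1 c2 : R -> R) t : R := Num.sqrt (c1 t ^+ 2 + c2 t ^+ 2).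

(** The unit vector in the direction of [c] turns with angular velocity [a], the cross product of
    position and velocity over the squared length. *)
Lemma is_derive_direction (c1 c2 : R -> R) t (d1 d2 : R) : 0 < c1 t ^+ 2 + c2 t ^+ 2 ->
  is_derive t 1 c1 d1 -> is_derive t 1 c2 d2 ->
  let a := (c1 t * d2 - c2 t * d1) * (elen c1 c2 t)^-1 ^+ 2 in
  is_derive t 1 (fun s => (elen c1 c2 s)^-1 * c1 s) (- a * ((elen c1 c2 t)^-1 * c2 t)) /\
  is_derive t 1 (fun s => (elen c1 c2 s)^-1 * c2 s) (a * ((elen c1 c2 t)^-1 * c1 t)).
Proof.
move=> N0 h1 h2 a.
have e0 : elen c1 c2 t != 0 by rewrite gt_eqF // sqrtr_gt0.
have eE : elen c1 c2 t ^+ 2 = c1 t ^+ 2 + c2 t ^+ 2 by rewrite sqr_sqrtr // ltW.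
have hN : is_derive t 1 (fun s => c1 s ^+ 2 + c2 s ^+ 2) (2 * (c1 t * d1 + c2 t * d2)).
  under eq_fun do rewrite !expr2.
  by apply: derE (derD (derM h1 h1) (derM h2 h2)) _; ring.
have hS : is_derive t 1 (elen c1 c2) ((elen c1 c2 t)^-1 * (c1 t * d1 + c2 t * d2)).
  have := @is_derive1_comp _ Num.sqrt (fun s => c1 s ^+ 2 + c2 s ^+ 2) t _ _ (is_derive1_sqrt N0) hN.
  by move/derE; apply; rewrite -/(elen c1 c2 t); field.
have hV : is_derive t 1 (fun s => (elen c1 c2 s)^-1) (- ((elen c1 c2 t)^-1 ^+ 3) * (c1 t * d1 + c2 t * d2)).
  have := @is_deriveV _ (elen c1 c2) t _ 1 e0 hS; move/derE; apply.
  by rewrite /GRing.scale /=; field.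
split.
  apply: derE (derM hV h1) _; rewrite /a.
  have -> : (elen c1 c2 t)^-1 * d1 = (elen c1 c2 t)^-1 ^+ 3 * (elen c1 c2 t ^+ 2) * d1 by field.
  by rewrite eE; ring.
apply: derE (derM hV h2) _; rewrite /a.
have -> : (elen c1 c2 t)^-1 * d2 = (elen c1 c2 t)^-1 ^+ 3 * (elen c1 c2 t ^+ 2) * d2 by field.
by rewrite eE; ring.
Qed.

Lemma nrm_sqr_le (p : R * R) : p.1 ^+ 2 + p.2 ^+ 2 <= nrm p ^+ 2 <= 2 * (p.1 ^+ 2 + p.2 ^+ 2).
Proof.
rewrite /nrm sqrrD !real_normK ?num_real // mulr2n.
have : 0 <= `|p.1| * `|p.2| by rewrite mulr_ge0.
have : (`|p.1| - `|p.2|) ^+ 2 >= 0 by exact: sqr_ge0.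
by rewrite sqrrB !real_normK ?num_real // mulr2n => h1 h2; apply/andP; split; lra.
Qed.

Lemma elen_bound K : convex_body2 K -> exists2 m : R, 0 < m & forall p : R * R, gauge K p = 1 ->
  m ^+ 2 <= p.1 ^+ 2 + p.2 ^+ 2.
Proof.
move=> bK; have [L L0 HL] := gauge_ub bK; exists ((2 * L)^-1); first by rewrite invr_gt0 mulr_gt0.
move=> p gp; have := HL p; rewrite gp => h.
have /andP[_ h2] := nrm_sqr_le p.
have h3 : L^-1 <= nrm p by rewrite -[L^-1]mul1r ler_pdivrMr // mulrC.
have h4 : L^-1 ^+ 2 <= nrm p ^+ 2 by rewrite ler_sqr ?nnegrE ?invr_ge0 ?nrm_ge0 // ltW.
by rewrite invfM exprMn; have := sqr_ge0 L^-1; lra.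
Qed.

(** [trig K] may have no derivative at [th t]; for the cross product with the point frozen at time
    [t] the quadratic error in [trig_cross] is enough. *)
Lemma is_derive_cross_trig K (th : R -> R) t (om : R) : convex_body2 K -> is_derive t 1 th om ->
  is_derive t 1 (fun s => cross (trig K (th t)) (trig K (th s))) om.
Proof.
move=> bK /is_derive_epsP H; have [C C0 HC] := trig_cross bK; apply/is_derive_epsP => e e0.
have cc p : cross p p = 0 :> R by rewrite /cross; ring.
have e20 : 0 < e / 2 by rewrite divr_gt0.
have [d1 d10 H1] := H 1 ltr01; have [d2 d20 H2] := H (e / 2) e20.
pose B := `|om| + 1; have B0 : 0 < B by rewrite ltr_wpDl.
(* [B] bounds the difference quotients of [th] near [t]; below [d3] the quadratic error
   [C * (B * |h|)^2] is at most [e / 2 * |h|]. *)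
pose d3 := e / 2 / (C * B ^+ 2); have d30 : 0 < d3 by rewrite divr_gt0 // mulr_gt0 // exprn_gt0.
exists (Num.min d1 (Num.min d2 d3)); first by rewrite !lt_min d10 d20.
move=> h; rewrite !lt_min => /andP[h1 /andP[h2 h3]]; rewrite cc subr0.
have {}H1 := H1 h h1; have {}H2 := H2 h h2; have {}HC := HC (th t) (th (t + h)).
move: (cross _ _) HC H1 H2 => X; set D := th (t + h) - th t => HC H1 H2.
have DB : `|D| <= B * `|h|.
  rewrite -[D](subrK (om * h)) /B mulrDl [X in _ <= X]addrC -normrM.
  exact: le_trans (ler_normD _ _) (lerD H1 (lexx _)).
have -> : X - om * h = (X - D) + (D - om * h) by ring.
have -> : e * `|h| = e / 2 * `|h| + e / 2 * `|h| by field.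
apply: (le_trans (ler_normD _ _)); apply: lerD => //; apply: (le_trans HC).
have D2 : D ^+ 2 <= (B * `|h|) ^+ 2 by rewrite -[D ^+ 2]real_normK ?num_real // ler_sqr ?nnegrE // mulr_ge0 // ltW.
apply: (@le_trans _ _ (C * (B * `|h|) ^+ 2)); first by rewrite ler_wpM2l // ltW.
have -> : C * (B * `|h|) ^+ 2 = (`|h| * (C * B ^+ 2)) * `|h| by ring.
by rewrite ler_wpM2r // -ler_pdivlMr ?mulr_gt0 ?exprn_gt0 // ltW.
Qed.

Section Uniqueness.
Variables (K : set (R * R)) (T : R) (om : R -> R).
Hypotheses (bK : convex_body2 K) (T0 : 0 <= T).

(* a curve on the boundary of K with areal velocity om / 2 *)
Definition area_law (c1 c2 : R -> R) :=
  [/\ lipschitz0T T c1, lipschitz0T T c2, forall t, in0T T t -> gauge K (c1 t, c2 t) = 1 &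
   ae0T T (fun t => exists d1 d2 : R, [/\ is_derive t 1 c1 d1, is_derive t 1 c2 d2 & c1 t * d2 - c2 t * d1 = om t])].

(** On the boundary the length of [c] is the inverse of the gauge of its direction [u]. So the area
    law becomes an equation for [u] alone, [u' = om * gauge(u)^2 * J u], with a right-hand side that
    is Lipschitz in [u], and [c] is recovered from [u]. *)
Lemma area_law_direction (c1 c2 : R -> R) : area_law c1 c2 ->
  exists u1 u2 : R -> R, (forall s, u1 s = (elen c1 c2 s)^-1 * c1 s /\ u2 s = (elen c1 c2 s)^-1 * c2 s) /\
  [/\ lipschitz0T T u1, lipschitz0T T u2,
   forall t, in0T T t -> [/\ u1 t ^+ 2 + u2 t ^+ 2 = 1, 0 < gauge K (u1 t, u2 t) &
     (c1 t, c2 t) = sc (gauge K (u1 t, u2 t))^-1 (u1 t, u2 t)] &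
   ae0T T (fun t => is_derive t 1 u1 (- (om t * gauge K (u1 t, u2 t) ^+ 2) * u2 t) /\
                    is_derive t 1 u2 (om t * gauge K (u1 t, u2 t) ^+ 2 * u1 t))].
Proof.
move=> [l1 l2 gc dc].
pose u1 s := (elen c1 c2 s)^-1 * c1 s; pose u2 s := (elen c1 c2 s)^-1 * c2 s.
have [m m0 Hm] := elen_bound bK.
have N0 t : in0T T t -> m ^+ 2 <= c1 t ^+ 2 + c2 t ^+ 2 by move=> /gc; exact: Hm.
have N1 t : in0T T t -> 0 < c1 t ^+ 2 + c2 t ^+ 2 by move=> /N0; apply: lt_le_trans; exact: exprn_gt0.
have e0 t : in0T T t -> 0 < elen c1 c2 t by move=> /N1; rewrite sqrtr_gt0.
have lV : lipschitz0T T (fun t => (elen c1 c2 t)^-1).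
  apply: (lipschitzV m0) => [t tT|].
    by rewrite -(ger0_norm (ltW m0)) -sqrtr_sqr ler_wsqrtr // N0.
  apply: (lipschitz_sqrt m0 N0); have := lipschitzD (lipschitzM l1 l1) (lipschitzM l2 l2).
  by move=> [L HL]; exists L => s t hs ht; rewrite !expr2; exact: HL.
have gE t : in0T T t -> gauge K (u1 t, u2 t) = (elen c1 c2 t)^-1.
  move=> tT; have := @gauge_sc _ K (c1 t, c2 t) (elen c1 c2 t)^-1 bK.
  by rewrite invr_ge0 (ltW (e0 t tT)) gc // mulr1 => <-.
exists u1, u2; split => //; split; [exact: lipschitzM|exact: lipschitzM| |].
- move=> t tT; have en := e0 t tT; rewrite gE //; split.
  + by rewrite !exprMn -mulrDr exprVn sqr_sqrtr ?(ltW (N1 t tT)) // mulVf // gt_eqF ?N1.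
  + by rewrite invr_gt0.
  + by rewrite invrK /sc /u1 /u2 /= !mulrA divff ?mul1r // gt_eqF.
- apply: ae0T_imp dc => t tT [d1 [d2 [h1 h2 omE]]]; rewrite gE // -omE.
  exact: is_derive_direction (N1 t tT) h1 h2.
Qed.

Lemma area_law_unique (c1 c2 d1 d2 : R -> R) : bounded_mfun T om -> area_law c1 c2 -> area_law d1 d2 ->
  c1 0 = d1 0 -> c2 0 = d2 0 -> forall t, in0T T t -> c1 t = d1 t /\ c2 t = d2 t.
Proof.
move=> [_ [M HM]] Hc Hd h01 h02 t tT.
have [u1 [u2 [uE [lu1 lu2 Hu du]]]] := area_law_direction Hc.
have [v1 [v2 [vE [lv1 lv2 Hv dv]]]] := area_law_direction Hd.
pose g s := (u1 s - v1 s) * (u1 s - v1 s) + (u2 s - v2 s) * (u2 s - v2 s).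
have [L L0 HL] := gauge_lip bK; have [L' L'0 HL'] := gauge_ub bK.
have M0 : 0 <= M by apply: le_trans (HM 0 _); rewrite ?normr_ge0 // /in0T lexx.
have dist0 : in0T T 0 by rewrite /in0T lexx.
have sq1 (a b : R) : a ^+ 2 + b ^+ 2 = 1 -> `|a| <= 1 /\ `|b| <= 1.
  move=> h; have := sqr_ge0 a; have := sqr_ge0 b => hb ha.
  have k (c : R) : c ^+ 2 <= 1 -> `|c| <= 1.
    by move=> hc; rewrite -ler_sqr ?nnegrE // real_normK ?num_real // expr1n.
  by split; apply: k; lra.
(* The bounds below are [|om| <= M], [|ru - rv| <= L * N], [ru + rv <= 4 * L'] and [2 * N] for the
   last factor; with the leading 2 they give [16 * M * L * L' * N^2], and [N^2] is at most twice
   [g]. *)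
pose C := 32 * M * L' * L.
have C0 : 0 <= C by rewrite !mulr_ge0 // ltW.
have : g t = 0.
  apply: (gronwall_eq0 C0) tT.
  - by apply: lipschitzD; apply: lipschitzM; apply: lipschitzB.
  - by move=> s _; rewrite addr_ge0 // -expr2 sqr_ge0.
  - apply: ae0T_imp (ae0T_and du dv) => s sT [[du1 du2] [dv1 dv2]].
    have [Nu _ _] := Hu s sT; have [Nv _ _] := Hv s sT.
    have ga := HL (u1 s, u2 s) (v1 s, v2 s).
    have gu := HL' (u1 s, u2 s); have gv := HL' (v1 s, v2 s).
    have gu0 := gauge_ge0 (u1 s, u2 s) bK; have gv0 := gauge_ge0 (v1 s, v2 s) bK.
    have Ms := HM s sT.
    have E1 := derB du1 dv1; have E2 := derB du2 dv2.
    have Dg := derD (derM E1 E1) (derM E2 E2).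
    eexists; first exact: Dg.
    have [a1 a2] := sq1 _ _ Nu; have [b1 b2] := sq1 _ _ Nv.
    have nv : nrm (u1 s, u2 s) <= 2 by rewrite /nrm /=; lra.
    have nv' : nrm (v1 s, v2 s) <= 2 by rewrite /nrm /=; lra.
    move: ga gu gv gu0 gv0 Ms nv nv'; rewrite /g.
    have /andP[_ n2] := nrm_sqr_le (sub2 (u1 s, u2 s) (v1 s, v2 s)).
    move: n2 a1 a2 b1 b2 Nu Nv.
    set w := sub2 _ _.
    have w1 : `|u1 s - v1 s| <= nrm w by rewrite /nrm lerDl.
    have w2 : `|u2 s - v2 s| <= nrm w by rewrite /nrm lerDr.
    rewrite -[w.1]/(u1 s - v1 s) -[w.2]/(u2 s - v2 s).
    move: (nrm w) (gauge K (u1 s, u2 s)) (gauge K (v1 s, v2 s)) (nrm (u1 s, u2 s)) (nrm (v1 s, v2 s)) w1 w2 => N ru rv nu nv w1 w2.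
    move: (u1 s) (u2 s) (v1 s) (v2 s) (om s) w1 w2 => U1 U2 V1 V2 o w1 w2 n2 a1 a2 b1 b2 Nu Nv ga gu gv gu0 gv0 Ms nu2 nv2.
    (* Rotations are skew, so equal angular velocities would leave the distance unchanged; only the
       difference [ru - rv] of the gauges survives, and it is again of the order of the distance. *)
    have -> : (- (o * ru ^+ 2) * U2 - - (o * rv ^+ 2) * V2) * (U1 - V1) + (U1 - V1) * (- (o * ru ^+ 2) * U2 - - (o * rv ^+ 2) * V2) +
      ((o * ru ^+ 2 * U1 - o * rv ^+ 2 * V1) * (U2 - V2) + (U2 - V2) * (o * ru ^+ 2 * U1 - o * rv ^+ 2 * V1))
      = 2 * (o * (ru - rv) * (ru + rv) * ((U2 - V2) * V1 - (U1 - V1) * V2)) by ring.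
    have N0 : 0 <= N by exact: le_trans w1.
    have h1 : `|(U2 - V2) * V1 - (U1 - V1) * V2| <= 2 * N.
      apply: (le_trans (ler_normB _ _)); rewrite !normrM.
      have -> : 2 * N = N * 1 + N * 1 by ring.
      by apply: lerD; apply: ler_pM.
    have h2 : `|ru + rv| <= 4 * L'.
      rewrite ger0_norm ?addr_ge0 //.
      have k1 : L' * nu <= L' * 2 by rewrite ler_wpM2l // ltW.
      have k2 : L' * nv <= L' * 2 by rewrite ler_wpM2l // ltW.
      clear - k1 k2 gu gv; lra.
    apply: (le_trans (ler_norm _)).
    rewrite 4!normrM (ger0_norm (x := 2)) //.
    apply: (@le_trans _ _ (2 * (M * (L * N) * (4 * L') * (2 * N)))).
      have m1 : `|o| * `|ru - rv| <= M * (L * N) by apply: ler_pM.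
      have m2 : `|o| * `|ru - rv| * `|ru + rv| <= M * (L * N) * (4 * L') by apply: ler_pM; rewrite ?mulr_ge0.
      by rewrite ler_wpM2l //; apply: ler_pM; rewrite ?mulr_ge0.
    have -> : 2 * (M * (L * N) * (4 * L') * (2 * N)) = C / 2 * N ^+ 2 by rewrite /C; field.
    have C2 : 0 <= C / 2 by rewrite divr_ge0.
    apply: (le_trans (ler_wpM2l C2 n2)).
    by rewrite mulrA divfK ?pnatr_eq0 // !expr2.
  - rewrite /g; have [-> ->] := uE 0; have [-> ->] := vE 0.
    by rewrite /elen h01 h02 !subrr mul0r addr0.
rewrite /g -!expr2 => /eqP; rewrite paddr_eq0 ?sqr_ge0 // !sqrf_eq0 !subr_eq0 => /andP[/eqP e1 /eqP e2].
have [_ _] := Hu t tT; have [_ _] := Hv t tT; rewrite e1 e2 => <- /(congr1 (fun p => (p.1, p.2)))/= [-> ->].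
by [].
Qed.

Lemma area_law_trig (th0 : R) : bounded_mfun T om ->
  area_law (fun t => cosO K (th0 + int0 t om)) (fun t => sinO K (th0 + int0 t om)).
Proof.
move=> bom; have lth : lipschitz0T T (fun t => th0 + int0 t om).
  by apply: lipschitzD; [exact: lipschitz_cst|exact: int0_lipschitz].
have [L L0 HL] := cosO_lip bK; have [L' L'0 HL'] := sinO_lip bK.
have l1 := lipschitz_comp L0 HL lth; have l2 := lipschitz_comp L'0 HL' lth.
split => //; first by move=> t _; exact: trig_gauge.
apply: ae0T_imp (ae0T_and (ae0T_and (lipschitz_ae_derive T0 l1) (lipschitz_ae_derive T0 l2)) (int0_derive bom)) => t tT [[D1 D2] D3].
have E1 := derivableP D1; have E2 := derivableP D2.
eexists; eexists; split; [exact: E1|exact: E2|].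
have Dth : is_derive t 1 (fun t => th0 + int0 t om) (om t).
  by have := derD (der_cst th0 t) D3; rewrite add0r.
exact: der_uniq (derB (derZ _ E2) (derZ _ E1)) (is_derive_cross_trig bK Dth).
Qed.

Lemma area_law_solve (c1 c2 : R -> R) (th0 : R) : bounded_mfun T om -> area_law c1 c2 ->
  (c1 0, c2 0) = trig K th0 -> forall t, in0T T t ->
  c1 t = cosO K (th0 + int0 t om) /\ c2 t = sinO K (th0 + int0 t om).
Proof.
move=> bom Hc [h1 h2]; apply: (area_law_unique bom Hc (area_law_trig th0 bom)).
  by rewrite int00 addr0.
by rewrite int00 addr0.
Qed.

End Uniqueness.

End AreaLawUniqueness.

(** * The direction set and the maximized Hamiltonian *)

Section Gauges.
Variables (R : realType) (n : nat) (Om : 'I_n -> set (R * R)) (mu : ('I_n -> R) -> R).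
Hypothesis MA : main_assumption Om mu.
Implicit Types (l A : 'I_n -> R).

Lemma mu0 : mu (fun=> 0) = 0.
Proof.
have [_ [_ _ [_ hom] _ _]] := MA.
have := hom (fun=> 0) 2 (fun _ => lexx _) (ltr0n _ 2).
have -> : (fun _ : 'I_n => 2 * 0) = (fun=> 0) :> ('I_n -> R) by apply/funext => i; rewrite mulr0.
lra.
Qed.

(** The assumption raises one coordinate at a time; [mix s] is the vector after the coordinates in
    [s] have been raised. *)
Lemma mu_mono l l' : nonneg_vec l -> (forall i, l i <= l' i) -> mu l <= mu l'.
Proof.
have [_ [_ _ _ mono _]] := MA; move=> l0 ll.
pose mix (s : seq 'I_n) i := if i \in s then l' i else l i.
have l'0 i : 0 <= l' i by exact: le_trans (l0 i) (ll i).
have mix0 s : nonneg_vec (mix s) by move=> i; rewrite /mix; case: ifP.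
have H s : mu l <= mu (mix s).
  elim: s => [|i s IH]; first by rewrite (_ : mix [::] = l).
  apply: (le_trans IH); have := mono (mix s) i (l' i) (mix0 s).
  have -> : (fun j => if j == i then l' i else mix s j) = mix (i :: s).
    by apply/funext => j; rewrite /mix inE; case: eqP => [->|].
  by apply; rewrite /mix; case: ifP.
suff <- : mix (enum 'I_n) = l' by exact: H.
by apply/funext => i; rewrite /mix mem_enum.
Qed.

Lemma Xi0 : Xi mu (fun=> 0).
Proof. by split=> [i //|]; rewrite mu0. Qed.

Lemma Xi_le l l' : nonneg_vec l -> (forall i, l i <= l' i) -> Xi mu l' -> Xi mu l.
Proof. by move=> l0 ll [_ h]; split => //; exact: le_trans (mu_mono l0 ll) h. Qed.

(** A vector [l] of [Xi] dominates [l i] times the unit vector [e], on which [mu] is positive. *)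
Lemma Xi_bounded i : exists2 B : R, 0 < B & forall l, Xi mu l -> l i <= B.
Proof.
have [_ [_ _ [_ hom] _ pos]] := MA.
pose e j : R := (j == i)%:R.
have e0 : nonneg_vec e by move=> j; rewrite /e ler0n.
have me : 0 < mu e by apply: pos => //; exists i; rewrite /e eqxx oner_neq0.
exists (mu e)^-1; rewrite ?invr_gt0 // => l [l0 l1].
have := l0 i; rewrite le_eqVlt => /orP[/eqP<-|li]; first by rewrite invr_ge0 ltW.
rewrite -[_^-1]mul1r ler_pdivlMr // -hom //; apply: le_trans l1; apply: mu_mono => j.
  by rewrite mulr_ge0.
by rewrite /e; case: eqP => [->|_]; rewrite ?mulr1 ?mulr0.
Qed.

Lemma sXi_ge A l : Xi mu l -> \sum_(i < n) A i * l i <= sXi mu A.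
Proof.
move=> Xl; apply: ub_le_sup; last by exists l.
have [B HB] : exists B : 'I_n -> R, forall i l', Xi mu l' -> l' i <= B i.
  have H i : exists b : R, forall l', Xi mu l' -> l' i <= b by have [b _ Hb] := Xi_bounded i; exists b.
  by have [B HB] := choice H; exists B.
exists (\sum_(i < n) `|A i| * B i) => _ [l' Xl' ->]; apply: ler_sum => i _.
have [l'0 _] := Xl'; apply: (@le_trans _ _ (`|A i| * l' i)).
  by rewrite ler_wpM2r // ler_norm.
by rewrite ler_wpM2l // HB.
Qed.

Lemma sXi_le A (c : R) : (forall l, Xi mu l -> \sum_(i < n) A i * l i <= c) -> sXi mu A <= c.
Proof.
move=> H; apply: ge_sup; last by move=> _ [l Xl ->]; exact: H.
by exists (\sum_(i < n) A i * 0); exists (fun=> 0) => //; exact: Xi0.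
Qed.

Lemma sXi_ge0 A : 0 <= sXi mu A.
Proof. by apply: le_trans (sXi_ge A Xi0); rewrite big1 // => i _; rewrite mulr0. Qed.

Lemma body i : convex_body2 (Om i). Proof. by case: MA. Qed.

Lemma UsetE (u v : 'I_n -> R) : Uset Om mu (u, v) <-> Xi mu (fun i => gauge (Om i) (u i, v i)).
Proof. by split=> [h|[]//]; split => // i; apply: gauge_ge0; exact: body. Qed.

(* Pontryagin's Hamiltonian of the direction set splits over the planar factors *)
Lemma maximized_hamiltonian (h uv : 'I_n -> R * R) (c : R) :
  let H w := \sum_(i < n) dot (h i) (w i) in
  let A i := gauge (polar (Om i)) (h i) in
  let l i := gauge (Om i) (uv i) in
  Xi mu l -> H uv = c ->
  (forall w, Xi mu (fun i => gauge (Om i) (w i)) -> H w <= c) ->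
  [/\ c = sXi mu A, \sum_(i < n) A i * l i = sXi mu A & forall i, dot (h i) (uv i) = A i * l i].
Proof.
move=> H A l Xl Huv Hmax.
have le i : dot (h i) (uv i) <= A i * l i by apply: dot_le_gauge; exact: body.
have Hle : H uv <= \sum_(i < n) A i * l i by exact: ler_sum.
have sl := sXi_ge A Xl.
(* Competitors: in each plane take a point of [Om i] supported by [h i] and scale it by [l' i]. The
   Hamiltonian then takes the value [\sum A i * l' i]. *)
have cs : sXi mu A <= c.
  apply: sXi_le => l' Xl'.
  have [w Hw] : exists w : 'I_n -> R * R, forall i, Om i (w i) /\ dot (h i) (w i) = A i.
    have E i : exists w : R * R, Om i w /\ dot (h i) w = A i by have [w ? ?] := support_attained (h i) (body i); exists w.
    by have [w Hw] := choice E; exists w.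
  apply: le_trans (Hmax (fun i => sc (l' i) (w i)) _).
    by rewrite /H le_eqVlt; apply/orP; left; apply/eqP/eq_bigr => i _; rewrite dot_scr (Hw i).2 mulrC.
  apply: (Xi_le _ _ Xl') => i; first by apply: gauge_ge0; exact: body.
  have [l0 _] := Xl'; rewrite gauge_sc //; last exact: body.
  by rewrite ler_piMr //; apply/gauge_le1; [exact: body|exact: (Hw i).1].
have cE : \sum_(i < n) A i * l i = c by apply/eqP; rewrite eq_le -{2}Huv Hle (le_trans sl cs).
have sE : sXi mu A = c by apply/eqP; rewrite eq_le cs -cE sl.
split; [by []|by rewrite cE|].
(* All inequalities in the chain are now equalities, and a zero sum of nonnegative defects vanishes
   term by term. *)
have : \sum_(i < n) (A i * l i - dot (h i) (uv i)) == 0 by rewrite sumrB cE -Huv subrr.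
rewrite psumr_eq0; last by move=> i _; rewrite subr_ge0.
by move=> /allP Hall i; have := Hall i (mem_index_enum i); rewrite /= subr_eq0 => /eqP.
Qed.

End Gauges.

(* [comp] is also the name of composition in ssrfun *)
Notation component := (@Defs.comp _ _).

(** * The maximum principle with the adjoint system solved *)

Section Reduction.
Variables (R : realType) (n : nat) (Om : 'I_n -> set (R * R)) (mu : ('I_n -> R) -> R).
Variables (T : R) (x y : R -> 'I_n -> R) (z : R -> R).
Hypotheses (MA : main_assumption Om mu) (T0 : 0 <= T).

Lemma is_derive_derive1 (f : R -> R) (t d : R) : is_derive t 1 f d -> derivable f t 1 /\ derive1 f t = d.
Proof. by move=> h; split; [exact: ex_derive|rewrite derive1E; exact: derive_val]. Qed.

Lemma derivable_is_derive1 (f : R -> R) (t : R) : derivable f t 1 -> is_derive t 1 f (derive1 f t).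
Proof. by move=> /derivableP; rewrite derive1E. Qed.

(* the covector along the horizontal frame; on an extremal it is an affine function of (x, y) *)
Definition momentum (g : R) (p q : 'I_n -> R) (t : R) (i : 'I_n) : R * R := (p i - g * y t i, q i + g * x t i).

Lemma hamH_dot (px py : 'I_n -> R) (pz : R) (t : R) (u v : 'I_n -> R) :
  hamH (x t) (y t) px py pz u v = \sum_(i < n) dot (px i - 2^-1 * pz * y t i, py i + 2^-1 * pz * x t i) (u i, v i).
Proof.
rewrite /hamH !mulr_sumr -!big_split /=; apply: eq_bigr => i _; rewrite /dot /=; ring.
Qed.

Definition start_at_origin := (forall i, x 0 i = 0 /\ y 0 i = 0) /\ z 0 = 0.
Definition lipschitz_curve := (forall i, lipschitz0T T (component x i) /\ lipschitz0T T (component y i)) /\ lipschitz0T T z.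

(** Here [g] is the constant value of [pz], [(p, q)] is the momentum at time 0, and [U], [V] are
    values of the velocities, kept apart from [derive1] so that they may be bounded and
    measurable. *)
Definition reduced_pmp (g c : R) (p q : 'I_n -> R) (U V : R -> 'I_n -> R) (t : R) : Prop :=
  [/\ forall i, is_derive t 1 (component x i) (U t i) /\ is_derive t 1 (component y i) (V t i),
      is_derive t 1 z (2^-1 * \sum_(i < n) (x t i * V t i - U t i * y t i)),
      Xi mu (fun i => gauge (Om i) (U t i, V t i)),
      \sum_(i < n) dot (momentum g p q t i) (U t i, V t i) = c &
      forall w : 'I_n -> R * R, Xi mu (fun i => gauge (Om i) (w i)) ->
        \sum_(i < n) dot (momentum g p q t i) (w i) <= c].

Lemma extremal_intro g c p q U V : start_at_origin -> lipschitz_curve -> 0 <= c ->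
  ~ (g = 0 /\ forall i, p i = 0 /\ q i = 0) ->
  ae0T T (reduced_pmp g c p q U V) -> extremal Om mu T x y z.
Proof.
move=> s0 lc c0 nt ae; have [lxy lz] := lc.
(* Half of the affine term of the momentum comes from the covector and half from the frame, hence
   the factor [2^-1]. *)
pose px t i := p i - 2^-1 * g * y t i; pose py t i := q i + 2^-1 * g * x t i.
have hamE t u v : hamH (x t) (y t) (px t) (py t) g u v = \sum_(i < n) dot (momentum g p q t i) (u i, v i).
  by rewrite hamH_dot; apply: eq_bigr => i _; congr dot; rewrite /momentum /px /py; congr (_, _); field.
split => //.
  apply: ae0T_imp ae => t tT [dxy dz XU _ _].
  have dxE i : derive1 (component x i) t = U t i by case: (dxy i) => /is_derive_derive1[].
  have dyE i : derive1 (component y i) t = V t i by case: (dxy i) => _ /is_derive_derive1[].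
  have [dz1 dz2] := is_derive_derive1 dz; split; last 1 first.
  - by rewrite dz2; congr (_ * _); apply: eq_bigr => i _; rewrite dxE dyE.
  - by move=> i; have [/is_derive_derive1[h1 _] /is_derive_derive1[h2 _]] := dxy i.
  - exact: dz1.
  - by under [X in Uset _ _ (X, _)]eq_fun do rewrite dxE; under [X in Uset _ _ (_, X)]eq_fun do rewrite dyE; apply/(UsetE MA).
exists px, py, (fun=> g); split.
- split; last by apply: lipschitz_abscont; exact: lipschitz_cst.
  move=> i; have [lx ly] := lxy i; split; apply: lipschitz_abscont.
    by apply: (lipschitzB (lipschitz_cst _ _)); exact: lipschitzZ.
  by apply: (lipschitzD (lipschitz_cst _ _)); exact: lipschitzZ.
- move=> t _ [h0 g0]; apply: nt; split => // i; have [] := h0 i.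
  by rewrite /px /py g0 mulr0 !mul0r subr0 addr0.
- apply: ae0T_imp ae => t tT [dxy _ _ _ _]; split.
  + move=> i; have [_ hy] := dxy i; have [_ ->] := is_derive_derive1 hy.
    have := derB (der_cst (p i) t) (derZ (2^-1 * g) hy).
    by rewrite sub0r => /is_derive_derive1.
  + move=> i; have [hx _] := dxy i; have [_ ->] := is_derive_derive1 hx.
    have := derD (der_cst (q i) t) (derZ (2^-1 * g) hx).
    by rewrite add0r => /is_derive_derive1.
  + exact: is_derive_derive1 (der_cst g t).
- exists c => //; apply: ae0T_imp ae => t tT [dxy _ _ Hc Hm].
  have dxE i : derive1 (component x i) t = U t i by case: (dxy i) => /is_derive_derive1[].
  have dyE i : derive1 (component y i) t = V t i by case: (dxy i) => _ /is_derive_derive1[].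
  split; first by rewrite hamE -Hc; apply: eq_bigr => i _; rewrite dxE dyE.
  by move=> [u v] /(UsetE MA) Xuv; rewrite hamE; exact: (Hm (fun i => (u i, v i))).
Qed.

(** The adjoint system makes [pz] constant and then determines the covector as an affine function of
    the position, both by uniqueness for absolutely continuous functions. All conditions are
    homogeneous in the covector. *)
Lemma extremal_elim : extremal Om mu T x y z -> [/\ start_at_origin, lipschitz_curve &
  exists g c p q U V, [/\ g = 0 \/ g = 1 \/ g = -1, ~ (g = 0 /\ forall i, p i = 0 /\ q i = 0),
   forall i, bounded_mfun T (component U i) /\ bounded_mfun T (component V i) & ae0T T (reduced_pmp g c p q U V)]].
Proof.
move=> [s0 lc adm [px [py [pz [[acp acz] nt adj [c c0 max]]]]]].
split => //; have [lxy lz] := lc; have [_ z0] := s0.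
have in00 : in0T T 0 by rewrite /in0T lexx.
have [U HU] : exists U : 'I_n -> R -> R, forall i, bounded_mfun T (U i) /\ ae0T T (fun t => is_derive t 1 (component x i) (U i t)).
  have H i : exists u, bounded_mfun T u /\ ae0T T (fun t => is_derive t 1 (component x i) (u t)).
    by apply: lipschitz_derive_version => //; exact: (lxy i).1.
  by have [U HU] := choice H; exists U.
have [V HV] : exists V : 'I_n -> R -> R, forall i, bounded_mfun T (V i) /\ ae0T T (fun t => is_derive t 1 (component y i) (V i t)).
  have H i : exists u, bounded_mfun T u /\ ae0T T (fun t => is_derive t 1 (component y i) (u t)).
    by apply: lipschitz_derive_version => //; exact: (lxy i).2.
  by have [V HV] := choice H; exists V.
have aeUV : ae0T T (fun t => forall i, is_derive t 1 (component x i) (U i t) /\ is_derive t 1 (component y i) (V i t)).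
  by apply: ae0T_all => i; apply: ae0T_and; [exact: (HU i).2|exact: (HV i).2].
pose r := pz 0.
have pzE t : in0T T t -> pz t = r.
  apply: (abscont_unique acz (lipschitz_abscont (lipschitz_cst T r))) => //.
  apply: ae0T_imp adj => s sT [_ _ [h1 h2]]; exists 0; last exact: der_cst.
  by rewrite -h2; exact: derivable_is_derive1.
have pxE t i : in0T T t -> px t i = px 0 i - 2^-1 * r * y t i.
  move=> tT; apply: (@abscont_unique _ T (component px i) (fun t => px 0 i - 2^-1 * r * y t i)) => //.
  - exact: (acp i).1.
  - by apply: lipschitz_abscont; apply: (lipschitzB (lipschitz_cst _ _)); apply: lipschitzZ; exact: (lxy i).2.
  - apply: ae0T_imp (ae0T_and adj aeUV) => s sT [[h _ _] duv].
    have [h1 h2] := h i; have [_ hy] := duv i.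
    exists (- (2^-1 * r * V i s)).
      by have [_ E] := is_derive_derive1 hy; rewrite -E -(pzE s sT) -h2; exact: derivable_is_derive1.
    by have := derB (der_cst (px 0 i) s) (derZ (2^-1 * r) hy); rewrite sub0r.
  - by rewrite /Defs.comp (s0.1 i).2 mulr0 subr0.
have pyE t i : in0T T t -> py t i = py 0 i + 2^-1 * r * x t i.
  move=> tT; apply: (@abscont_unique _ T (component py i) (fun t => py 0 i + 2^-1 * r * x t i)) => //.
  - exact: (acp i).2.
  - by apply: lipschitz_abscont; apply: (lipschitzD (lipschitz_cst _ _)); apply: lipschitzZ; exact: (lxy i).1.
  - apply: ae0T_imp (ae0T_and adj aeUV) => s sT [[_ h _] duv].
    have [h1 h2] := h i; have [hx _] := duv i.
    exists (2^-1 * r * U i s).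
      by have [_ E] := is_derive_derive1 hx; rewrite -E -(pzE s sT) -h2; exact: derivable_is_derive1.
    by have := derD (der_cst (py 0 i) s) (derZ (2^-1 * r) hx); rewrite add0r.
  - by rewrite /Defs.comp (s0.1 i).1 mulr0 addr0.
(* A positive factor preserves the maximum condition, so [pz] can be normalized up to its sign. *)
have [s s0' [g gE rg]] : exists2 s : R, 0 < s & exists2 g : R, g = 0 \/ g = 1 \/ g = -1 & s * r = g.
  have [r0|r0|r0] := ltgtP r 0.
  - by exists (- r)^-1; rewrite ?invr_gt0 ?oppr_gt0 //; exists (-1); [right; right|rewrite invrN mulNr mulVf // lt_eqF].
  - by exists r^-1; rewrite ?invr_gt0 //; exists 1; [right; left|rewrite mulVf // gt_eqF].
  - by exists 1 => //; exists 0; [left|rewrite r0 mulr0].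
exists g, (s * c), (fun i => s * px 0 i), (fun i => s * py 0 i), (fun t i => U i t), (fun t i => V i t); split => //.
- move=> [g0 pq0]; apply: (nt 0 in00); rewrite -/r; split.
    move=> i; have [] := pq0 i => /eqP; rewrite mulf_eq0 gt_eqF //= => /eqP-> /eqP.
    by rewrite mulf_eq0 gt_eqF //= => /eqP->.
  by move/eqP: rg; rewrite g0 mulf_eq0 gt_eqF //= => /eqP.
- by move=> i; split; [exact: (HU i).1|exact: (HV i).1].
apply: ae0T_imp (ae0T_and (ae0T_and adm max) aeUV) => t tT [[[dxy dz XU zE] [Hc Hm]] duv].
have dxE i : derive1 (component x i) t = U i t by case: (duv i) => /is_derive_derive1[].
have dyE i : derive1 (component y i) t = V i t by case: (duv i) => _ /is_derive_derive1[].
have hamE u v : s * hamH (x t) (y t) (px t) (py t) (pz t) u v =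
  \sum_(i < n) dot (momentum g (fun i => s * px 0 i) (fun i => s * py 0 i) t i) (u i, v i).
  rewrite hamH_dot mulr_sumr; apply: eq_bigr => i _; rewrite -dot_scl; congr dot.
  by rewrite /momentum /sc /= pzE // pxE // pyE // -rg; congr (_, _); field.
split => //.
- have -> : \sum_(i < n) (x t i * V i t - U i t * y t i) = \sum_(i < n) (x t i * derive1 (component y i) t - derive1 (component x i) t * y t i).
    by apply: eq_bigr => i _; rewrite dxE dyE.
  by rewrite -zE; exact: derivable_is_derive1.
- have := (UsetE MA _ _).1 XU; congr (Xi mu _); apply/funext => i; by rewrite dxE dyE.
- by rewrite -hamE -Hc; congr (_ * hamH _ _ _ _ _ _ _); apply/funext => i.
- move=> w Xw; have -> : w = (fun i => ((w i).1, (w i).2)) by apply/funext => i; rewrite -surjective_pairing.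
  rewrite -(hamE (fun i => (w i).1) (fun i => (w i).2)); rewrite ler_wpM2l ?(ltW s0') //.
  apply: (Hm (fun i => (w i).1, fun i => (w i).2)); apply/(UsetE MA).
  by under eq_fun do rewrite -surjective_pairing.
Qed.

End Reduction.

(** * Bounded measurable functions and touching arguments *)

Section BoundedMeasurable.
Context {R : realType}.
Implicit Types (f g : R -> R) (T t s : R).

Lemma bounded_mfunM T f g : bounded_mfun T f -> bounded_mfun T g -> bounded_mfun T (fun t => f t * g t).
Proof.
move=> [mf [M HM]] [mg [N HN]]; split; first exact: measurable_funM.
by exists (M * N) => t tT; rewrite normrM ler_pM ?HM ?HN.
Qed.

Lemma bounded_mfunD T f g : bounded_mfun T f -> bounded_mfun T g -> bounded_mfun T (fun t => f t + g t).
Proof.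
move=> [mf [M HM]] [mg [N HN]]; split; first exact: measurable_funD.
by exists (M + N) => t tT; apply: (le_trans (ler_normD _ _)); rewrite lerD ?HM ?HN.
Qed.

Lemma bounded_mfun_cst T (a : R) : bounded_mfun T (fun=> a).
Proof. by split; [exact: measurable_cst|exists `|a|]. Qed.

Lemma bounded_mfunZ T (a : R) f : bounded_mfun T f -> bounded_mfun T (fun t => a * f t).
Proof. by apply: bounded_mfunM; exact: bounded_mfun_cst. Qed.

Lemma bounded_mfunB T f g : bounded_mfun T f -> bounded_mfun T g -> bounded_mfun T (fun t => f t - g t).
Proof.
move=> bf /(bounded_mfunZ (-1)) bg; have := bounded_mfunD bf bg.
by under eq_fun do rewrite mulN1r.
Qed.

Lemma bounded_mfun_sum T (I : Type) (r : seq I) (F : I -> R -> R) :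
  (forall i, bounded_mfun T (F i)) -> bounded_mfun T (fun t => \sum_(i <- r) F i t).
Proof.
move=> H; elim: r => [|i r IH].
  by under eq_fun do rewrite big_nil; exact: bounded_mfun_cst.
by under eq_fun do rewrite big_cons; exact: bounded_mfunD.
Qed.

Lemma clamp_lip (T : R) : 0 <= T -> forall s t, `|clamp T s - clamp T t| <= 1 * `|s - t|.
Proof.
move=> T0; have H s t : s <= t -> `|clamp T s - clamp T t| <= 1 * `|s - t|.
  move=> st; rewrite distrC (distrC s) mul1r !ger0_norm ?subr_ge0 ?clamp_mono //.
  exact: clamp_le.
by move=> s t; have [/H//|/ltW/H] := leP s t; rewrite distrC (distrC t).
Qed.

Lemma measurable_clamp (T : R) : 0 <= T -> measurable_fun setT (clamp T).
Proof. by move=> T0; apply: continuous_measurable_fun; exact: lipschitz_continuous (clamp_lip T0). Qed.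

Lemma lipschitz_bounded_mfun T f : 0 <= T -> lipschitz0T T f -> bounded_mfun T f.
Proof.
move=> T0 lf; split; last by have [M _ HM] := lipschitz_bounded lf; exists M.
have [L L0 HL] := lipschitz_pos lf.
apply: (@eq_measurable_fun _ _ _ _ _ (f \o clamp T)) => [t|].
  by rewrite inE /= in_itv /= => tT; rewrite clamp_id.
apply: measurable_funTS; apply: continuous_measurable_fun; apply: (@lipschitz_continuous _ _ L L0) => s t /=.
apply: (le_trans (HL _ _ (clamp_in s T0) (clamp_in t T0))); rewrite ler_wpM2l ?(ltW L0) //.
by have := clamp_lip T0 s t; rewrite mul1r.
Qed.

Lemma int0Z T t (a : R) g : bounded_mfun T g -> in0T T t -> int0 t (fun s => a * g s) = a * int0 t g.
Proof.
move=> bg tT; have := @lipschitz_int0 _ T (fun t => a * int0 t g) (fun t => a * g t).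
rewrite int00 mulr0 => H; rewrite H ?add0r //.
- by apply: lipschitzZ; exact: int0_lipschitz.
- exact: bounded_mfunZ.
- by apply: ae0T_imp (int0_derive bg) => s _ h; exact: derZ.
Qed.

Lemma touching_derive0 (f : R -> R) t (d : R) : is_derive t 1 f d -> (forall s, 0 <= f s) -> f t = 0 -> d = 0.
Proof.
move=> /is_derive_epsP H f0 ft; apply/eqP/negPn/negP => d0.
have e0 : 0 < `|d| / 2 by rewrite divr_gt0 // normr_gt0.
have [del del0 Hd] := H _ e0.
pose h := - (Num.sg d * (del / 2)).
have hn : `|h| = del / 2 by rewrite normrN normrM normr_sg d0 mul1r ger0_norm // divr_ge0 // ltW.
have hd : d * h = - (`|d| * (del / 2)) by rewrite (normrEsg d) /h; ring.
have := Hd h; rewrite hn ltr_pdivrMr // ltr_pMr // ltr1n => /(_ isT).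
rewrite ft subr0 hd opprK ger0_norm; last by rewrite addr_ge0 // mulr_ge0 // divr_ge0 // ltW.
have := f0 (t + h); have : 0 < `|d| * (del / 2) by rewrite mulr_gt0 ?normr_gt0 ?divr_gt0.
lra.
Qed.

Lemma trig_bounded (K : set (R * R)) : convex_body2 K -> exists M : R, forall th, `|cosO K th| <= M /\ `|sinO K th| <= M.
Proof.
move=> bK; have [M M0 HM] := gauge_lb bK; exists M => th.
have := HM (trig K th); rewrite trig_gauge // mulr1 /nrm /= => h.
by have := normr_ge0 (cosO K th); have := normr_ge0 (sinO K th); split; lra.
Qed.

(* a point moving on the boundary of the polar moves along the direction J w, w being a point supported by it *)
Lemma polar_trig_velocity (K : set (R * R)) T om th0 : 0 <= T -> convex_body2 K -> bounded_mfun T om ->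
  let c1 t := cosO (polar K) (th0 + int0 t om) in let c2 t := sinO (polar K) (th0 + int0 t om) in
  ae0T T (fun t => exists w : R * R, [/\ K w, dot (c1 t, c2 t) w = 1,
     is_derive t 1 c1 (- om t * w.2) & is_derive t 1 c2 (om t * w.1)]).
Proof.
move=> T0 bK bom c1 c2; have bP := polar_body bK.
have [_ _ _ ae] := area_law_trig bP T0 th0 bom.
apply: ae0T_imp ae => t _ [d1 [d2 [D1 D2 E]]].
have gc s : gauge (polar K) (c1 s, c2 s) = 1 by exact: (@trig_gauge _ _ (th0 + int0 s om) bP).
have [w Kw dw] := support_attained (c1 t, c2 t) bK; rewrite gc in dw.
exists w; have W0 : d1 * w.1 + d2 * w.2 = 0.
  (* As [w] lies in [K], this function of [s] is nonnegative, and it vanishes at [t]; so its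
     derivative there is 0. *)
  have D : is_derive t 1 (fun s => 1 - (w.1 * c1 s + w.2 * c2 s)) (0 - (w.1 * d1 + w.2 * d2)).
    by apply: derB (der_cst _ _) (derD (derZ _ D1) (derZ _ D2)).
  have := touching_derive0 D; rewrite sub0r => H.
  suff : - (w.1 * d1 + w.2 * d2) = 0 by move=> h; rewrite mulrC (mulrC d2) -[LHS]opprK h oppr0.
  apply: H => [s|]; last by rewrite mulrC (mulrC w.2) -[X in 1 - X]/(dot (c1 t, c2 t) w) dw subrr.
  rewrite subr_ge0 mulrC (mulrC w.2) -[X in X <= _]/(dot (c1 s, c2 s) w).
  by apply: (le_trans (dot_le_gauge _ _ bK)); rewrite gc mul1r; apply/gauge_le1.
have dw' : c1 t * w.1 + c2 t * w.2 = 1 by [].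
have E1 : c1 t * d2 - c2 t * d1 = om t by [].
have {}D1 : is_derive t 1 c1 d1 by [].
have {}D2 : is_derive t 1 c2 d2 by [].
clearbody c1 c2; split => //.
(* Cramer's rule: the velocity is orthogonal to [w], its cross product with [c] is [om t], and [c]
   pairs to 1 with [w]. *)
- apply: derE D1 _; rewrite -[LHS]mulr1 -dw' -E1.
  have -> : d1 * (c1 t * w.1 + c2 t * w.2) = c1 t * (d1 * w.1 + d2 * w.2) - (c1 t * d2 - c2 t * d1) * w.2 by ring.
  by rewrite W0; ring.
- apply: derE D2 _; rewrite -[LHS]mulr1 -dw' -E1.
  have -> : d2 * (c1 t * w.1 + c2 t * w.2) = c2 t * (d1 * w.1 + d2 * w.2) + (c1 t * d2 - c2 t * d1) * w.1 by ring.
  by rewrite W0; ring.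
Qed.

End BoundedMeasurable.

(** * From the explicit form to extremals *)

Section Converse.
Variables (R : realType) (n : nat) (Om : 'I_n -> set (R * R)) (mu : ('I_n -> R) -> R).
Variables (T : R) (x y : R -> 'I_n -> R) (z : R -> R).
Hypotheses (MA : main_assumption Om mu) (T0 : 0 <= T).
Variables (g : R) (A th0 : 'I_n -> R) (lam : R -> 'I_n -> R).
Hypotheses (A0 : nonneg_vec A) (mlam : forall i, measurable_fun `[0, T]%classic (component lam i)).
Hypothesis dlam : ae0T T (fun t => dsXi mu A (lam t)).

(** Membership in [Xi] bounds [lam] almost everywhere only; clamping to the bounds of [Xi] gives
    bounds at all times without changing the integrals. *)
Lemma bounded_version : exists l : R -> 'I_n -> R, (forall i, bounded_mfun T (component l i)) /\
  ae0T T (fun t => forall i, l t i = lam t i).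
Proof.
have [B HB] : exists B : 'I_n -> R, forall i, 0 < B i /\ forall l, Xi mu l -> l i <= B i.
  have H i : exists b : R, 0 < b /\ forall l, Xi mu l -> l i <= b.
    by have [b b0 Hb] := Xi_bounded MA i; exists b.
  by have [B HB] := choice H; exists B.
exists (fun t i => clamp (B i) (lam t i)); split.
  move=> i; have B0 := ltW (HB i).1; split.
    exact: (measurableT_comp (measurable_clamp B0) (mlam i)).
  by exists (B i) => t _; have /andP[h1 h2] := clamp_in (lam t i) B0; rewrite ger0_norm.
apply: ae0T_imp dlam => t _ [Xl _] i; have [l0 _] := Xl.
by apply: clamp_id; rewrite /in0T l0 (HB i).2.
Qed.

Lemma dual_pairing_max (c : 'I_n -> R * R) (w : 'I_n -> R * R) :
  (forall i, gauge (polar (Om i)) (c i) = 1) -> Xi mu (fun i => gauge (Om i) (w i)) ->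
  \sum_(i < n) dot (sc (A i) (c i)) (w i) <= sXi mu A.
Proof.
move=> gc Xw; apply: le_trans (sXi_ge MA A Xw); apply: ler_sum => i _.
rewrite dot_scl ler_wpM2l //; apply: (le_trans (dot_le_gauge _ _ (body MA i))).
by rewrite gc mul1r.
Qed.

(** The velocities turn out to be [lam t i] times points [w i] of [Om i] supported by the momentum,
    so the maximum condition is equality in the polar inequality of every plane. *)
Lemma extremal_normal : g * g = 1 -> (forall i, A i = 0 -> forall t, in0T T t -> lam t i = 0) ->
  form_normal Om mu T x y z g A th0 lam -> extremal Om mu T x y z.
Proof.
move=> gg lam0 F; have [l [bl lE]] := bounded_version.
have in00 : in0T T 0 by rewrite /in0T lexx.
have bP i : convex_body2 (polar (Om i)) by apply: polar_body; exact: body MA i.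
(* For [A i = 0] the quotient is 0 by convention, so [c1 i] and [c2 i] are constant and the formulas
   below, which carry a factor [A i], hold for all indices alike. *)
pose om i t := g / A i * l t i.
have bom i : bounded_mfun T (om i) by apply: bounded_mfunZ; exact: bl.
pose c1 i t := cosO (polar (Om i)) (th0 i + int0 t (om i)).
pose c2 i t := sinO (polar (Om i)) (th0 i + int0 t (om i)).
have thE i t : in0T T t -> thetad g A th0 lam i t = th0 i + int0 t (om i).
  move=> tT; rewrite /thetad; congr (_ + _); rewrite /om (int0Z _ (bl i) tT); congr (_ * _).
  by apply: (int0_eq tT); apply: ae0T_imp lE => s _ h; rewrite /Defs.comp h.
have c10 i : c1 i 0 = cosO (polar (Om i)) (th0 i) by rewrite /c1 int00 addr0.
have c20 i : c2 i 0 = sinO (polar (Om i)) (th0 i) by rewrite /c2 int00 addr0.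
have xE i t : in0T T t -> x t i = g * A i * (c2 i t - c2 i 0) /\ y t i = g * A i * (c1 i 0 - c1 i t).
  move=> tT; have [F1 F2 _] := F t tT; rewrite c10 c20 /c1 /c2 -(thE i t tT).
  have := A0 i; rewrite le_eqVlt => /orP[/eqP Ai|/F1 //].
  by have [-> ->] := F2 i (esym Ai); rewrite -Ai mulr0 !mul0r.
have zE t : in0T T t -> 2 * z t = g * sXi mu A * t + \sum_(i < n) A i ^+ 2 * (c2 i 0 * c1 i t - c1 i 0 * c2 i t).
  move=> tT; have [_ _ ->] := F t tT; congr (_ + _); rewrite big_mkcond; apply: eq_bigr => i _.
  rewrite c10 c20 /c1 /c2 -(thE i t tT); case: ifPn => // nA.
  have -> : A i = 0 by apply/eqP; rewrite eq_le A0 leNgt nA.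
  by rewrite expr2 !mul0r.
have lc i : lipschitz0T T (c1 i) /\ lipschitz0T T (c2 i).
  by have [h1 h2 _ _] := area_law_trig (bP i) T0 (th0 i) (bom i).
have gc i t : gauge (polar (Om i)) (c1 i t, c2 i t) = 1 by exact: trig_gauge.
have vel : ae0T T (fun t => forall i, exists w : R * R, [/\ Om i w, dot (c1 i t, c2 i t) w = 1,
     is_derive t 1 (c1 i) (- om i t * w.2) & is_derive t 1 (c2 i) (om i t * w.1)]).
  by apply: ae0T_all => i; exact: (polar_trig_velocity (th0 i) T0 (body MA i) (bom i)).
clearbody c1 c2.
(* With this initial covector and [g * g = 1] the momentum at time [t] is [A i] times the moving
   point of the polar. *)
pose p i := A i * c1 i 0; pose q i := A i * c2 i 0.
have hE t i : in0T T t -> momentum x y g p q t i = sc (A i) (c1 i t, c2 i t).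
  move=> tT; rewrite /momentum /p /q; have [-> ->] := xE i t tT; rewrite /sc /=; congr (_, _).
    have -> : A i * c1 i 0 - g * (g * A i * (c1 i 0 - c1 i t)) = A i * c1 i 0 - g * g * (A i * (c1 i 0 - c1 i t)) by ring.
    by rewrite gg; ring.
  have -> : A i * c2 i 0 + g * (g * A i * (c2 i t - c2 i 0)) = A i * c2 i 0 + g * g * (A i * (c2 i t - c2 i 0)) by ring.
  by rewrite gg; ring.
have lip_in0T f f' : (forall t, in0T T t -> f t = f' t) -> lipschitz0T T f' -> lipschitz0T T f.
  by move=> ff [L HL]; exists L => s t hs ht; rewrite !ff //; exact: HL.
apply: (@extremal_intro _ n _ mu T x y z MA g (sXi mu A) p q (fun t i => derive1 (component x i) t) (fun t i => derive1 (component y i) t)).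
- split; first by move=> i; have [-> ->] := xE i 0 in00; rewrite !subrr mulr0.
  have := zE 0 in00; rewrite mulr0 add0r big1; last by move=> i _; rewrite (mulrC (c2 i 0)) subrr mulr0.
  by move/eqP; rewrite mulf_eq0 pnatr_eq0 /= => /eqP.
- split.
    move=> i; have [l1 l2] := lc i; split.
      by apply: (@lip_in0T _ _ (fun t tT => (xE i t tT).1)); apply: lipschitzZ; apply: lipschitzB => //; exact: lipschitz_cst.
    by apply: (@lip_in0T _ _ (fun t tT => (xE i t tT).2)); apply: lipschitzZ; apply: lipschitzB => //; exact: lipschitz_cst.
  apply: (@lip_in0T _ (fun t => 2^-1 * (g * sXi mu A * t + \sum_(i < n) A i ^+ 2 * (c2 i 0 * c1 i t - c1 i 0 * c2 i t)))).
    by move=> t tT; rewrite -zE // mulKf // pnatr_eq0.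
  have l1 := lipschitzZ (g * sXi mu A) (lipschitz0T_id T).
  have l2 : lipschitz0T T (fun t => \sum_(i < n) A i ^+ 2 * (c2 i 0 * c1 i t - c1 i 0 * c2 i t)).
    apply: lipschitz_sum => i; have [h1 h2] := lc i.
    exact: lipschitzZ (lipschitzB (lipschitzZ _ h1) (lipschitzZ _ h2)).
  exact: lipschitzZ (lipschitzD l1 l2).
- exact: sXi_ge0 MA A.
- by move=> [g0 _]; move/eqP: gg; rewrite g0 mul0r eq_sym oner_eq0.
apply: ae0T_imp (ae0T_and (ae0T_and (ae0T_and dlam lE) vel) (ae0T_interior T)) => t tT [[[[Xl sE] ll] Hw] ti].
have [w {}Hw] := choice Hw.
have dx i : is_derive t 1 (component x i) (lam t i * (w i).1) /\ is_derive t 1 (component y i) (lam t i * (w i).2).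
  have [_ _ D1 D2] := Hw i; have [Ai|Ai] := eqVneq (A i) 0.
    rewrite (lam0 i Ai t tT) !mul0r; split.
      by apply: (is_derive_in0T (g := fun=> 0) ti) (der_cst _ _) => s sT; rewrite /Defs.comp (xE i s sT).1 Ai mulr0 mul0r.
    by apply: (is_derive_in0T (g := fun=> 0) ti) (der_cst _ _) => s sT; rewrite /Defs.comp (xE i s sT).2 Ai mulr0 mul0r.
  have gA : g * A i * om i t = lam t i.
    by rewrite /om ll -[RHS]mul1r -gg; field.
  split; apply: (is_derive_in0T ti) => [s sT|].
  - exact: (xE i s sT).1.
  - by apply: derE (derZ (g * A i) (derB D2 (der_cst _ t))) _; rewrite -gA; ring.
  - exact: (xE i s sT).2.
  - by apply: derE (derZ (g * A i) (derB (der_cst _ t) D1)) _; rewrite -gA; ring.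
have [lam_ge0 _] := Xl.
have dxE i : derive1 (component x i) t = lam t i * (w i).1 by case: (dx i) => /is_derive_derive1[].
have dyE i : derive1 (component y i) t = lam t i * (w i).2 by case: (dx i) => _ /is_derive_derive1[].
have sumE : \sum_(i < n) dot (momentum x y g p q t i) (derive1 (component x i) t, derive1 (component y i) t) = sXi mu A.
  rewrite -sE; apply: eq_bigr => i _; rewrite hE // dxE dyE -/(sc (lam t i) (w i)) dot_scl dot_scr.
  by have [_ -> _ _] := Hw i; rewrite mulr1.
split => //.
- by move=> i; rewrite dxE dyE.
(* In plane [i] the doubled area velocity is [g * A i * lam t i] times 1 minus the pairing of the
   initial point with [w i]. The ones add up to [g * sXi mu A]; the rest is the derivative of
   [G i]. *)
- pose G i s := A i ^+ 2 * (c2 i 0 * c1 i s - c1 i 0 * c2 i s).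
  pose G' i := A i ^+ 2 * (c2 i 0 * (- om i t * (w i).2) - c1 i 0 * (om i t * (w i).1)).
  have dG i : is_derive t 1 (G i) (G' i).
    by have [_ _ D1 D2] := Hw i; exact: derZ (derB (derZ _ D1) (derZ _ D2)).
  have D := derZ 2^-1 (derD (derZ (g * sXi mu A) (der_id t))
    (@der_sum _ _ (index_enum 'I_n) xpredT G G' t (fun i _ => dG i))).
  apply: (is_derive_in0T ti) (derE D _) => [s sT|].
    by rewrite -zE // mulKf // pnatr_eq0.
  congr (_ * _); rewrite mulr1 -sE mulr_sumr -big_split /=; apply: eq_bigr => i _.
  rewrite /G' dxE dyE (xE i t tT).1 (xE i t tT).2.
  have [_ dw _ _] := Hw i; have [Ai|Ai] := eqVneq (A i) 0.
    by rewrite Ai expr2 !(mul0r, mulr0) subrr addr0.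
  have -> : g * A i * (c2 i t - c2 i 0) * (lam t i * (w i).2) - lam t i * (w i).1 * (g * A i * (c1 i 0 - c1 i t))
    = g * A i * lam t i * (dot (c1 i t, c2 i t) (w i) - c2 i 0 * (w i).2 - c1 i 0 * (w i).1) by rewrite /dot /=; ring.
  by rewrite dw /om ll; field.
- apply: (Xi_le MA _ _ Xl) => i; first by apply: gauge_ge0; exact: body MA i.
  rewrite dxE dyE -/(sc (lam t i) (w i)) gauge_sc //; last exact: body MA i.
  by rewrite ler_piMr //; apply/gauge_le1; [exact: body MA i|have [] := Hw i].
- move=> w' Xw'; under eq_bigr do rewrite hE //.
  exact: (@dual_pairing_max (fun i => (c1 i t, c2 i t))).
Qed.

(** With [g = 0] the momentum is constant, and [trig_dual] says that it supports [Om i] at the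
    direction of the velocity. It is nonzero because boundary points of the polar are and some [A i]
    is. *)
Lemma extremal_abnormal : ~ (forall i, A i = 0) -> form_abnormal Om T x y z A th0 lam -> extremal Om mu T x y z.
Proof.
move=> nA [th [mth dual F]]; have [l [bl lE]] := bounded_version.
have in00 : in0T T 0 by rewrite /in0T lexx.
have bP i : convex_body2 (polar (Om i)) by apply: polar_body; exact: body MA i.
pose U t i := l t i * cosO (Om i) (th t i); pose V t i := l t i * sinO (Om i) (th t i).
have bU i : bounded_mfun T (component U i) /\ bounded_mfun T (component V i).
  have [M HM] := trig_bounded (body MA i); split; apply: bounded_mfunM; try exact: bl.
  - split; first exact: (measurableT_comp (measurable_cosO (body MA i)) (mth i)).
    by exists M => t _; have [] := HM (th t i).
  - split; first exact: (measurableT_comp (measurable_sinO (body MA i)) (mth i)).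
    by exists M => t _; have [] := HM (th t i).
have xE i t : in0T T t -> x t i = int0 t (component U i) /\ y t i = int0 t (component V i).
  move=> tT; have [/(_ i)[-> ->] _] := F t tT.
  by split; apply: (int0_eq tT); apply: ae0T_imp lE => s _ h; rewrite /Defs.comp /U /V h.
have lip_in0T (f f' : R -> R) : (forall t, in0T T t -> f t = f' t) -> lipschitz0T T f' -> lipschitz0T T f.
  by move=> ff [L HL]; exists L => s t hs ht; rewrite !ff //; exact: HL.
have lxy i : lipschitz0T T (component x i) /\ lipschitz0T T (component y i).
  split; first by apply: (lip_in0T _ _ (fun t tT => (xE i t tT).1)); apply: int0_lipschitz; exact: (bU i).1.
  by apply: (lip_in0T _ _ (fun t tT => (xE i t tT).2)); apply: int0_lipschitz; exact: (bU i).2.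
have dxy : ae0T T (fun t => forall i, is_derive t 1 (component x i) (U t i) /\ is_derive t 1 (component y i) (V t i)).
  apply: ae0T_all => i; have [b1 b2] := bU i.
  apply: ae0T_imp (ae0T_and (ae0T_interior T) (ae0T_and (int0_derive b1) (int0_derive b2))) => t tT [ti [h1 h2]].
  by split; [exact: is_derive_in0T ti (fun s sT => (xE i s sT).1) h1|exact: is_derive_in0T ti (fun s sT => (xE i s sT).2) h2].
pose w t := \sum_(i < n) (x t i * V t i - U t i * y t i).
have bw : bounded_mfun T w.
  apply: bounded_mfun_sum => i; have [b1 b2] := bU i; have [l1 l2] := lxy i.
  by apply: bounded_mfunB; apply: bounded_mfunM => //; exact: lipschitz_bounded_mfun.
have zE t : in0T T t -> z t = 2^-1 * int0 t w.
  (* The form integrates [derive1], of which only the values almost everywhere are known; [int0_eq]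
     replaces it by [U] and [V]. *)
  move=> tT; have [_ ->] := F t tT; congr (_ * _); apply: (int0_eq tT).
  apply: ae0T_imp dxy => s _ h; apply: eq_bigr => i _.
  by have [/is_derive_derive1[_ ->] /is_derive_derive1[_ ->]] := h i.
pose p i := A i * cosO (polar (Om i)) (th0 i); pose q i := A i * sinO (polar (Om i)) (th0 i).
have hE t i : momentum x y 0 p q t i = sc (A i) (trig (polar (Om i)) (th0 i)).
  by rewrite /momentum !mul0r subr0 addr0.
apply: (@extremal_intro _ n _ mu T x y z MA 0 (sXi mu A) p q U V).
- split; first by move=> i; have [-> ->] := xE i 0 in00; rewrite !int00.
  by rewrite zE // int00 mulr0.
- split => //; apply: (lip_in0T _ _ zE); apply: lipschitzZ; exact: int0_lipschitz.
- exact: sXi_ge0 MA A.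
- move=> [_ pq0]; apply: nA => i; apply/eqP/negPn/negP => Ai; have [] := pq0 i.
  move=> /eqP; rewrite mulf_eq0 (negPf Ai) /= => /eqP c0 /eqP; rewrite mulf_eq0 (negPf Ai) /= => /eqP s0.
  have := trig_gauge (th0 i) (bP i); rewrite /trig c0 s0.
  have := @gauge_sc _ _ (0, 0) 0 (bP i) (lexx _); rewrite /sc /= mul0r => -> /eqP.
  by rewrite mul0r eq_sym oner_eq0.
have aedual : ae0T T (fun t => forall i, 0 < A i -> trig_dual (Om i) (th t i) (th0 i)).
  apply: ae0T_all => i; have [Ai|Ai] := ltP 0 (A i); first by apply: ae0T_imp (dual i Ai).
  by apply: ae0T_W => t _ h.
apply: ae0T_imp (ae0T_and (ae0T_and (ae0T_and dlam lE) (ae0T_and dxy (int0_derive bw)))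
  (ae0T_and (ae0T_interior T) aedual)) => t tT [[[[Xl sE] ll] [dxyt dw]] [ti du]].
have [lam_ge0 _] := Xl.
have UVE i : (U t i, V t i) = sc (lam t i) (trig (Om i) (th t i)) by rewrite /U /V ll.
split => //.
- by apply: (is_derive_in0T ti zE); exact: derZ.
- apply: (Xi_le MA _ _ Xl) => i; first by apply: gauge_ge0; exact: body MA i.
  by rewrite UVE gauge_sc ?trig_gauge ?mulr1 //; exact: body MA i.
- rewrite -sE; apply: eq_bigr => i _; rewrite hE UVE dot_scl dot_scr.
  have := A0 i; rewrite le_eqVlt => /orP[/eqP<-|Ai]; first by rewrite !mul0r.
  by rewrite dotC; have /trig_dualE-> := du i Ai; rewrite mulr1.
- move=> w' Xw'; under eq_bigr do rewrite hE.
  by apply: (@dual_pairing_max (fun i => trig (polar (Om i)) (th0 i))) => // i; exact: trig_gauge.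
Qed.

End Converse.

(** * From extremals to the explicit form *)

Section GaugeOfCurve.
Context {R : realType}.
Implicit Types (K : set (R * R)) (T t : R) (f g : R -> R).

Lemma gauge_continuous K : convex_body2 K -> continuous (gauge K).
Proof.
move=> bK p; have [L L0 HL] := gauge_lip bK; apply/cvgrPdist_lt => e e0.
apply/nbhs_plane; exists (e / L); first by rewrite divr_gt0.
move=> q; rewrite ltr_pdivlMr // mulrC => h; rewrite distrC; exact: le_lt_trans (HL _ _) h.
Qed.

Lemma measurable_gauge K : convex_body2 K -> measurable_fun setT (gauge K).
Proof.
move=> bK _; apply: (measurability _ (RGenOInfty.measurableE R)) => //.
move=> _ [_ [x ->] <-]; rewrite setTI; apply: open_measurable2.
by apply: open_comp; [move=> p _; exact: gauge_continuous|exact: interval_open].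
Qed.

Lemma measurable_fun_pair_on (D : set R) f g : measurable D -> measurable_fun D f -> measurable_fun D g ->
  measurable_fun D (fun t => (f t, g t) : R * R).
Proof.
move=> mD /(measurable_restrictT _ mD) mf /(measurable_restrictT _ mD) mg.
apply: (@eq_measurable_fun _ _ _ _ _ (fun t => ((f \_ D) t, (g \_ D) t))) => [t tD|].
  by rewrite !patchE tD.
by apply: measurable_funTS; exact: measurable_fun_pair.
Qed.

Lemma bounded_mfun_gauge K T f g : convex_body2 K -> bounded_mfun T f -> bounded_mfun T g ->
  bounded_mfun T (fun t => gauge K (f t, g t)).
Proof.
move=> bK [mf [M HM]] [mg [N HN]]; split.
  by apply: (measurableT_comp (measurable_gauge bK)); exact: measurable_fun_pair_on.
have [L L0 HL] := gauge_ub bK; exists (L * (M + N)) => t tT.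
rewrite ger0_norm ?gauge_ge0 //; apply: (le_trans (HL _)); rewrite ler_wpM2l ?(ltW L0) //.
by rewrite /nrm lerD ?HM ?HN.
Qed.

Lemma lipschitz_gauge K T f g : convex_body2 K -> lipschitz0T T f -> lipschitz0T T g ->
  lipschitz0T T (fun t => gauge K (f t, g t)).
Proof.
move=> bK [Lf HLf] [Lg HLg]; have [L L0 HL] := gauge_lip bK; exists (L * (Lf + Lg)) => s t hs ht.
apply: (le_trans (HL _ _)); rewrite -mulrA ler_wpM2l ?(ltW L0) // mulrDl.
by rewrite /nrm lerD ?HLf ?HLg.
Qed.

Lemma gauge0 K : convex_body2 K -> gauge K (0, 0) = 0.
Proof.
by move=> bK; have := @gauge_sc _ K (0, 0) 0 bK (lexx _); rewrite /sc /= !mul0r.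
Qed.

Lemma gauge_eq0 K p : convex_body2 K -> gauge K p = 0 -> p = (0, 0).
Proof.
move=> bK g0; have [M M0 HM] := gauge_lb bK; have := HM p; rewrite g0 mulr0 /nrm => h.
have := normr_ge0 p.1; have := normr_ge0 p.2 => h2 h1.
by rewrite [LHS]surjective_pairing; congr (_, _); apply/eqP; rewrite -normr_le0; clear - h h1 h2; lra.
Qed.

(* Borel polar coordinates relative to K; w only fixes the direction assigned to the origin *)
Lemma measurable_direction K T f g (w : R * R) : convex_body2 K -> gauge K w = 1 ->
  bounded_mfun T f -> bounded_mfun T g ->
  exists th : R -> R, measurable_fun `[0, T]%classic th /\ forall t,
   sc (gauge K (f t, g t)) (trig K (th t)) = (f t, g t) /\ (gauge K (f t, g t) = 0 -> trig K (th t) = w).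
Proof.
move=> bK gw bf bg; pose r t := gauge K (f t, g t).
have [mr _] : bounded_mfun T r by exact: bounded_mfun_gauge.
have r0 t : 0 <= r t by exact: gauge_ge0.
(* On nonnegative numbers the power with exponent -1 is the inverse, and [powR] is measurable; where
   the vector is 0 the direction [w] is substituted. *)
pose d (h : R -> R) (a : R) t := if r t == 0 then a else h t * (r t) `^ (-1).
have md h a : measurable_fun `[0, T]%classic h -> measurable_fun `[0, T]%classic (d h a).
  move=> mh; apply: measurable_fun_if => //; first exact: measurable_fun_eqr.
  apply: (measurable_funS (E := `[0, T]%classic)) => //.
  by apply: measurable_funM => //; exact: (measurableT_comp (measurable_powR _) mr).
exists (fun t => trig_angle K (d f w.1 t, d g w.2 t)); split.
  apply: (measurableT_comp (measurable_trig_angle bK)); apply: measurable_fun_pair_on => //; apply: md.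
    by case: bf.
  by case: bg.
move=> t; rewrite -/(r t) /d powR_inv1 //; have [rt|rt] := eqVneq (r t) 0.
  rewrite -surjective_pairing trig_angleK //; split => //.
  by rewrite rt /sc !mul0r; apply/esym; apply: (gauge_eq0 bK rt).
have rt0 : 0 < r t by rewrite lt_neqAle eq_sym rt r0.
have -> : (f t / r t, g t / r t) = sc (r t)^-1 (f t, g t) by rewrite /sc /= mulrC (mulrC (g t)).
rewrite trig_angleK //; last by rewrite gauge_sc ?invr_ge0 // -/(r t) mulVf.
by rewrite scK //; split => // h; rewrite h eqxx in rt.
Qed.

End GaugeOfCurve.

Section Forward.
Variables (R : realType) (n : nat) (Om : 'I_n -> set (R * R)) (mu : ('I_n -> R) -> R).
Variables (T : R) (x y : R -> 'I_n -> R) (z : R -> R).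
Hypotheses (MA : main_assumption Om mu) (T0 : 0 <= T).
Hypotheses (s0 : start_at_origin x y z) (lc : lipschitz_curve T x y z).
Variables (g c : R) (p q : 'I_n -> R) (U V : R -> 'I_n -> R).
Hypothesis gE : g = 0 \/ g = 1 \/ g = -1.
Hypothesis nt : ~ (g = 0 /\ forall i, p i = 0 /\ q i = 0).
Hypothesis bUV : forall i, bounded_mfun T (component U i) /\ bounded_mfun T (component V i).
Hypothesis pmp : ae0T T (reduced_pmp Om mu x y z g c p q U V).

Let in00 : in0T T 0. Proof. by rewrite /in0T lexx. Qed.
Let bO i : convex_body2 (Om i). Proof. exact: body MA i. Qed.
Let bP i : convex_body2 (polar (Om i)). Proof. exact: polar_body. Qed.

Let h t i := momentum x y g p q t i.
Let A i := gauge (polar (Om i)) (p i, q i).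
Let l t i := gauge (Om i) (U t i, V t i).

Let h0 i : h 0 i = (p i, q i).
Proof. by rewrite /h /momentum; have [-> ->] := s0.1 i; rewrite mulr0 subr0 addr0. Qed.

Let lip_h i : lipschitz0T T (fun t => (h t i).1) /\ lipschitz0T T (fun t => (h t i).2).
Proof.
have [lx ly] := lc.1 i; split => /=.
  exact: lipschitzB (lipschitz_cst _ _) (lipschitzZ g ly).
exact: lipschitzD (lipschitz_cst _ _) (lipschitzZ g lx).
Qed.

Lemma is_derive_momentum t : reduced_pmp Om mu x y z g c p q U V t -> forall i,
  is_derive t 1 (fun s => (h s i).1) (- g * V t i) /\ is_derive t 1 (fun s => (h s i).2) (g * U t i).
Proof.
move=> [dxy _ _ _ _] i; have [dx dy] := dxy i; split.
  by apply: derE (derB (der_cst (p i) t) (derZ g dy)) _; rewrite sub0r mulNr.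
by apply: derE (derD (der_cst (q i) t) (derZ g dx)) _; rewrite add0r.
Qed.

(** For [w] in [Om i] the function [dot (h s i) w] stays below the support function. At almost every
    [t] some [w] gives equality and is parallel to the velocity; the momentum moves orthogonally to
    the velocity, so the touching function has derivative 0. *)
Lemma support_of_momentum i t : in0T T t -> gauge (polar (Om i)) (h t i) = A i.
Proof.
pose G t := gauge (polar (Om i)) ((h t i).1, (h t i).2).
have [l1 l2] := lip_h i; have lG : lipschitz0T T G by exact: lipschitz_gauge.
move=> tT; rewrite -[LHS]/(G t).
apply: (abscont_unique (lipschitz_abscont lG) (lipschitz_abscont (lipschitz_cst T (A i)))) tT; last first.
  by rewrite /G h0.
apply: ae0T_imp (ae0T_and pmp (lipschitz_ae_derive T0 lG)) => {}t tT [P dG].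
exists 0; last exact: der_cst.
have {}dG := derivable_is_derive1 dG; apply: (derE dG).
have [D1 D2] := is_derive_momentum P i; have [_ _ XU Hc Hm] := P.
have [_ _ /(_ i) dE] := maximized_hamiltonian MA XU Hc Hm.
rewrite -/(h t i) -/(l t i) in dE.
(* A nonzero velocity divided by its gauge is supported by the momentum, by the equality in [dE]. If
   the velocity is 0, the momentum has derivative 0 and any supported point will do. *)
have [w Kw [dw cw]] : exists2 w : R * R, Om i w & dot (h t i) w = G t /\ U t i * w.2 = V t i * w.1.
  have [l0|lN0] := eqVneq (l t i) 0.
    have [w Kw dw] := support_attained (h t i) (bO i); exists w => //; split => //.
    by have [-> ->] := gauge_eq0 (bO i) l0; rewrite !mul0r.
  have lp : 0 < l t i by rewrite lt_neqAle eq_sym lN0 gauge_ge0.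
  exists (sc (l t i)^-1 (U t i, V t i)); first by apply: gauge_mem.
  split; first by rewrite dot_scr dE mulrC mulfK.
  by rewrite /=; ring.
have D : is_derive t 1 (fun s => G s - (w.1 * (h s i).1 + w.2 * (h s i).2)) (derive1 G t - (w.1 * (- g * V t i) + w.2 * (g * U t i))).
  exact: derB dG (derD (derZ _ D1) (derZ _ D2)).
have E : w.1 * (- g * V t i) + w.2 * (g * U t i) = 0.
  have -> : w.1 * (- g * V t i) + w.2 * (g * U t i) = g * (U t i * w.2 - V t i * w.1) by ring.
  by rewrite cw subrr mulr0.
rewrite E subr0 in D; apply: (touching_derive0 D) => [s|].
  rewrite subr_ge0 mulrC (mulrC w.2) -[X in X <= _]/(dot (h s i) w).
  apply: (le_trans (dot_le_gauge _ _ (bO i))); rewrite ler_piMr ?gauge_ge0 //.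
  exact/gauge_le1.
by rewrite mulrC (mulrC w.2) -[X in _ - X]/(dot (h t i) w) dw subrr.
Qed.

Lemma ae_multipliers : ae0T T (fun t => [/\ reduced_pmp Om mu x y z g c p q U V t, dsXi mu A (l t), c = sXi mu A &
  forall i, dot (h t i) (U t i, V t i) = A i * l t i]).
Proof.
apply: ae0T_imp pmp => t tT P; have [_ _ XU Hc Hm] := P.
have [cE sE dE] := maximized_hamiltonian MA XU Hc Hm.
have AE : (fun i => gauge (polar (Om i)) (h t i)) = A by apply/funext => i; exact: support_of_momentum.
split => //.
- by split => //; rewrite -AE.
- by rewrite -AE.
- by move=> i; rewrite -(support_of_momentum i tT); exact: dE.
Qed.

(** The momentum is constant, so what remains is a measurable angle for the velocity. Where [l t i]
    is nonzero, duality is the pairing identity divided by [A i * l t i]. *)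
Lemma forward_abnormal : g = 0 -> extremal_form Om mu T x y z.
Proof.
move=> g0.
have bl i : bounded_mfun T (component l i) by have [? ?] := bUV i; exact: bounded_mfun_gauge.
have hE t i : h t i = (p i, q i) by rewrite /h /momentum g0 !mul0r subr0 addr0.
(* The direction assigned at times when the velocity in plane [i] vanishes. Duality is demanded
   there too if [A i > 0], so it must be a boundary point supported by the momentum. *)
have [w Hw] : exists w : 'I_n -> R * R, forall i, gauge (Om i) (w i) = 1 /\ (0 < A i -> dot (p i, q i) (w i) = A i).
  have H i : exists w : R * R, gauge (Om i) w = 1 /\ (0 < A i -> dot (p i, q i) w = A i).
    have [w Kw dw] := support_attained (p i, q i) (bO i); have [Ai|Ai] := ltP 0 (A i).
      exists w; split => //; apply/eqP; rewrite eq_le; apply/andP; split; first exact/gauge_le1.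
      by have := dot_le_gauge (p i, q i) w (bO i); rewrite dw -/(A i) -{1}[A i]mulr1 ler_pM2l.
    by exists (trig (Om i) 0); split; [exact: trig_gauge|].
  by have [w Hw] := choice H; exists w.
have [th Hth] : exists th : 'I_n -> R -> R, forall i, measurable_fun `[0, T]%classic (th i) /\ forall t,
   sc (l t i) (trig (Om i) (th i t)) = (U t i, V t i) /\ (l t i = 0 -> trig (Om i) (th i t) = w i).
  have H i := measurable_direction (bO i) (Hw i).1 (bUV i).1 (bUV i).2.
  by have [th Hth] := choice H; exists th.
exists 0, A, (fun i => trig_angle (polar (Om i)) (sc (A i)^-1 (p i, q i))), l; split; split => //.
- by left.
- by move=> i; exact: gauge_ge0.
- move=> [_ A0]; apply: nt; split => // i.
  by have [-> ->] := gauge_eq0 (bP i) (A0 i).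
- by move=> i; case: (bl i).
- by apply: ae0T_imp ae_multipliers => t _ [].
move=> _; exists (fun t i => th i t); split.
- by move=> i; case: (Hth i).
- move=> i Ai; apply: ae0T_imp ae_multipliers => t tT [_ _ _ dE].
  apply/trig_dualE; rewrite trig_angleK //; last first.
    by rewrite gauge_sc ?invr_ge0 ?(ltW Ai) // mulVf // gt_eqF.
  have [_ /(_ t)[E1 E2]] := Hth i.
  suff H : dot (p i, q i) (trig (Om i) (th i t)) = A i.
    by rewrite dot_scr dotC H mulVf // gt_eqF.
  have [l0|lN0] := eqVneq (l t i) 0; first by rewrite E2 // (Hw i).2.
  by apply: (mulfI lN0); rewrite -dot_scr E1 -(hE t i) dE mulrC.
move=> t tT; have [lxy lz] := lc; have ae1 : ae0T T (reduced_pmp Om mu x y z g c p q U V) := pmp.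
split.
  move=> i; have [lx ly] := lxy i; have [bU bV] := bUV i.
  have xE := lipschitz_int0 lx bU; have yE := lipschitz_int0 ly bV.
  have [x0 y0] := s0.1 i; rewrite /Defs.comp x0 y0 in xE yE; rewrite xE ?yE // ?add0r.
  - split; apply: (int0_eq tT); apply: ae0T_W => s _; have [_ /(_ s)[E1 _]] := Hth i.
      by case: E1.
    by case: E1.
  - by apply: ae0T_imp pmp => s _ [dxy _ _ _ _]; exact: (dxy i).2.
  - by apply: ae0T_imp pmp => s _ [dxy _ _ _ _]; exact: (dxy i).1.
pose w' t := \sum_(i < n) (x t i * V t i - U t i * y t i).
have bw : bounded_mfun T w'.
  apply: bounded_mfun_sum => i; have [b1 b2] := bUV i; have [l1 l2] := lxy i.
  by apply: bounded_mfunB; apply: bounded_mfunM => //; exact: lipschitz_bounded_mfun.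
have zE := lipschitz_int0 lz (bounded_mfunZ 2^-1 bw).
rewrite zE //; last by apply: ae0T_imp pmp => s _ [_ dz _ _ _].
rewrite s0.2 add0r (int0Z _ bw tT); congr (_ * _); apply: (int0_eq tT).
apply: ae0T_imp pmp => s _ [dxy _ _ _ _]; apply: eq_bigr => i _.
by have [/is_derive_derive1[_ ->] /is_derive_derive1[_ ->]] := dxy i.
Qed.

(** As [g * g = 1], position and momentum determine each other, so it suffices to find the momentum;
    [A i] times a curve obeying the area law gives it. *)
Lemma forward_normal : g != 0 -> extremal_form Om mu T x y z.
Proof.
move=> gN0; have gg : g * g = 1.
  by case: gE => [g0|[->|->]]; rewrite ?mulrNN ?mulr1 //; rewrite g0 eqxx in gN0.
have A0 i : 0 <= A i by exact: gauge_ge0.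
(* If [A i = 0], the momentum in plane [i] has support value 0 at all times, so it vanishes, and the
   position with it. *)
have xy0 i : A i = 0 -> p i = 0 /\ q i = 0 /\ forall t, in0T T t -> x t i = 0 /\ y t i = 0.
  move=> Ai; have [p0 q0] := gauge_eq0 (bP i) Ai; split => //; split => // t tT.
  have := support_of_momentum i tT; rewrite Ai => /(gauge_eq0 (bP i)).
  rewrite /h /momentum p0 q0 sub0r add0r => -[/eqP].
  rewrite oppr_eq0 mulf_eq0 (negPf gN0) /= => /eqP -> /eqP.
  by rewrite mulf_eq0 (negPf gN0) /= => /eqP ->.
(* The form wants [lam t i = 0] at every time when [A i = 0]; the gauge [l] of the chosen velocities
   vanishes there only almost everywhere. *)
pose lam t i := (A i != 0)%:R * l t i.
have blam i : bounded_mfun T (component lam i).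
  by have [? ?] := bUV i; apply: bounded_mfunZ; exact: bounded_mfun_gauge.
have lamE : ae0T T (fun t => forall i, lam t i = l t i).
  apply: ae0T_imp (ae0T_and pmp (ae0T_interior T)) => t tT [[dxy _ _ _ _] ti] i.
  rewrite /lam; have [Ai|Ai] := eqVneq (A i) 0; last by rewrite mul1r.
  have [_ [_ H]] := xy0 i Ai; have [dx dy] := dxy i.
  have U0 : U t i = 0 by apply: der_uniq dx (is_derive_in0T ti (fun s sT => (H s sT).1) (der_cst 0 t)).
  have V0 : V t i = 0 by apply: der_uniq dy (is_derive_in0T ti (fun s sT => (H s sT).2) (der_cst 0 t)).
  by rewrite mul0r /l U0 V0 gauge0.
pose th0 i := trig_angle (polar (Om i)) (sc (A i)^-1 (p i, q i)).
(* The cross product of the momentum and its derivative is [g] times its pairing with the velocity,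
   that is [g * A i * l t i]. Dividing the momentum by [A i] divides this by [A i] squared, whence
   the angular rate [g / A i * lam t i]. *)
have curve i : 0 < A i -> forall t, in0T T t ->
   (h t i).1 = A i * cosO (polar (Om i)) (thetad g A th0 lam i t) /\
   (h t i).2 = A i * sinO (polar (Om i)) (thetad g A th0 lam i t).
  move=> Ai t tT; have [lh1 lh2] := lip_h i; have AN0 : A i != 0 by rewrite gt_eqF.
  have bom : bounded_mfun T (fun t => g / A i * lam t i) by apply: bounded_mfunZ; exact: blam.
  have := @area_law_solve _ (polar (Om i)) T (fun t => g / A i * lam t i) (bP i) T0
    (fun t => (A i)^-1 * (h t i).1) (fun t => (A i)^-1 * (h t i).2) (th0 i) bom => H.
  have -> : thetad g A th0 lam i t = th0 i + int0 t (fun t => g / A i * lam t i).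
    by rewrite (int0Z _ (blam i) tT).
  have [||H1 H2] := H _ _ t tT.
  - split; [exact: lipschitzZ|exact: lipschitzZ| |].
      move=> s sT; rewrite -[X in gauge _ X]/(sc (A i)^-1 (h s i)) gauge_sc ?invr_ge0 //.
      by rewrite support_of_momentum // mulVf.
    apply: ae0T_imp (ae0T_and ae_multipliers lamE) => s sT [[P _ _ dE] ll].
    have [D1 D2] := is_derive_momentum P i.
    exists ((A i)^-1 * (- g * V s i)), ((A i)^-1 * (g * U s i)); split; [exact: derZ|exact: derZ|].
    rewrite ll; apply: (mulfI AN0); apply: (mulfI AN0).
    have -> : A i * (A i * (g / A i * l s i)) = g * (A i * l s i) by field.
    by rewrite -dE /dot /=; field.
  - rewrite h0 -[LHS]/(sc (A i)^-1 (p i, q i)) /th0 trig_angleK //.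
    by rewrite gauge_sc ?invr_ge0 // mulVf.
  - by rewrite -H1 -H2 !mulrA !divff // !mul1r.
have curve0 i : 0 < A i -> p i = A i * cosO (polar (Om i)) (th0 i) /\ q i = A i * sinO (polar (Om i)) (th0 i).
  move=> Ai; have := curve i Ai 0 in00; rewrite h0 /= /thetad int00 mulr0 addr0.
  by [].
(* Expanding the momentum in the constant Hamiltonian [c = sXi mu A] expresses the doubled area
   velocity through [c] and the derivative of the linear function of the position; this identity is
   integrated. *)
have zE t : in0T T t -> 2 * z t = g * sXi mu A * t - g * \sum_(i < n) (p i * x t i + q i * y t i).
  move=> tT; have [lxy lz] := lc.
  have l1 := lipschitzZ (g * sXi mu A) (lipschitz0T_id T).
  have l2 : lipschitz0T T (fun t => \sum_(i < n) (p i * x t i + q i * y t i)).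
    by apply: lipschitz_sum => i; have [lx ly] := lxy i; exact: lipschitzD (lipschitzZ _ lx) (lipschitzZ _ ly).
  apply: (abscont_unique (lipschitz_abscont (lipschitzZ 2 lz)) (lipschitz_abscont (lipschitzB l1 (lipschitzZ g l2)))) tT.
    apply: ae0T_imp ae_multipliers => s sT [[dxy dz _ Hc _] _ cE _].
    pose F' i := p i * U s i + q i * V s i.
    have dF i : is_derive s 1 (fun t => p i * x t i + q i * y t i) (F' i).
      by have [dx dy] := dxy i; exact: derD (derZ _ dx) (derZ _ dy).
    have D2 := @der_sum _ _ (index_enum 'I_n) xpredT _ F' s (fun i _ => dF i).
    exists (2 * (2^-1 * \sum_(i < n) (x s i * V s i - U s i * y s i))); first exact: derZ.
    apply: derE (derB (derZ (g * sXi mu A) (der_id s)) (derZ g D2)) _.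
    rewrite mulr1 -cE -Hc mulrA divff ?pnatr_eq0 // mul1r -mulrBr -sumrB mulr_sumr.
    apply: eq_bigr => i _; rewrite /dot /F' /momentum /=.
    have -> : g * ((p i - g * y s i) * U s i + (q i + g * x s i) * V s i - (p i * U s i + q i * V s i)) =
      g * g * (x s i * V s i - U s i * y s i) by ring.
    by rewrite gg mul1r.
  rewrite s0.2 !mulr0 sub0r big1 ?mulr0 ?oppr0 // => i _.
  by have [-> ->] := s0.1 i; rewrite !mulr0 addr0.
exists g, A, th0, lam; split; split => //.
- by move=> [g0 _]; rewrite g0 eqxx in gN0.
- by move=> i; case: (blam i).
- apply: ae0T_imp (ae0T_and ae_multipliers lamE) => t _ [[_ dl _ _] ll].
  by have -> : lam t = l t by apply/funext.
- by move=> _ i Ai t _; rewrite /lam Ai eqxx mul0r.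
- move=> _ t tT; split.
  + move=> i Ai; have [H1 H2] := curve i Ai t tT; have [p0 q0] := curve0 i Ai.
    split; rewrite -mulrA mulrBr.
      rewrite -H2 -q0 /h /momentum /=.
      have -> : g * (q i + g * x t i - q i) = g * g * x t i by ring.
      by rewrite gg mul1r.
    rewrite -H1 -p0 /h /momentum /=.
    have -> : g * (p i - (p i - g * y t i)) = g * g * y t i by ring.
    by rewrite gg mul1r.
  + by move=> i Ai; exact: (xy0 i Ai).2.2.
  + rewrite zE //; congr (_ + _); rewrite -mulrN -sumrN mulr_sumr [RHS]big_mkcond.
    apply: eq_bigr => i _; case: ifPn => [Ai|nA].
      have [H1 H2] := curve i Ai t tT; have [p0 q0] := curve0 i Ai.
      move: (cosO _ (th0 i)) (sinO _ (th0 i)) (cosO _ (thetad g A th0 lam i t)) (sinO _ (thetad g A th0 lam i t)) H1 H2 p0 q0 => a0 b0 a b.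
      rewrite /h /momentum /= => H1 H2 p0 q0.
      have -> : A i ^+ 2 * (b0 * a - a0 * b) = (A i * b0) * (A i * a) - (A i * a0) * (A i * b) by ring.
      by rewrite -H1 -H2 -p0 -q0; ring.
    have Ai : A i = 0 by apply/eqP; rewrite eq_le A0 leNgt nA.
    by have [-> [-> _]] := xy0 i Ai; rewrite !mul0r addr0 oppr0 mulr0.
- by move=> g0; rewrite g0 eqxx in gN0.
Qed.

End Forward.

Unset Implicit Arguments.

Theorem theorem1 (R : realType) (n : nat) (Om : 'I_n -> set (R * R))
    (mu : ('I_n -> R) -> R) (T : R) (x y : R -> 'I_n -> R) (z : R -> R) :
  main_assumption Om mu -> 0 <= T ->
  (extremal Om mu T x y z <-> extremal_form Om mu T x y z).
Proof.
move=> MA T0; split.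
  move=> /(extremal_elim MA T0)[s0 lc [g [c [p [q [U [V [gE nt bUV pmp]]]]]]]].
  have [g0|g0] := eqVneq g 0.
    exact: (forward_abnormal MA T0 s0 lc nt bUV pmp g0).
  exact: (forward_normal MA T0 s0 lc gE bUV pmp g0).
move=> [g [A [th0 [lam [[gE A0 nt mlam] [dlam lam0 Fn Fa]]]]]].
have [g0|/eqP g0] := eqVneq g 0.
  apply: (extremal_abnormal MA T0 A0 mlam dlam _ (Fa g0)) => H; exact: nt.
apply: (extremal_normal MA T0 A0 mlam dlam _ (lam0 g0) (Fn g0)).
by case: gE => [//|[->|->]]; rewrite ?mulrNN ?mulr1.
Qed.
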